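(* Let $2\le N<\infty$ be an integer, let $\mathbb{F}_N$ be the free group on $N$ generators with canonical unitary generators $a_1,\dots,a_N$ of the group von Neumann algebra $L(\mathbb{F}_N)$, and let $A=W^{*}\big(\sum_{i=1}^{N}(a_i+a_i^{-1})\big)\subset L(\mathbb{F}_N)$ be the Laplacian masa. Then the left-right measure of $A\subset L(\mathbb{F}_N)$ is the class of product measure: with $A$ represented on $[-2\sqrt{2N-1},\,2\sqrt{2N-1}]$ through $\chi_1=\sum_{i=1}^{N}(a_i+a_i^{-1})$ as described in the context, the left-right measure on $[-2\sqrt{2N-1},2\sqrt{2N-1}]^2$ is mutually absolutely continuous with $\lambda\otimes\lambda$, where $\lambda$ is the probability measure arising from the restriction to $A$ of the trace of $L(\mathbb{F}_N)$.
   Context: $L(\mathbb{F}_N)$ is the group von Neumann algebra of $\mathbb{F}_N$, a type II$_1$ factor with canonical faithful normal tracial state $\tau$, acting on $L^2(L(\mathbb{F}_N))=\ell^2(\mathbb{F}_N)$. $W^*(x)$ denotes the von Neumann subalgebra generated by $x$. A masa is a maximal abelian self-adjoint subalgebra; it is known that $A$ is a masa in $L(\mathbb{F}_N)$ (the Laplacian, or radial, masa). Left-right measure. Let $M$ be a separable II$_1$ factor with faithful normal tracial state $\tau$ and let $A\subset M$ be a masa. Write $L^2(M)$ for the completion of $M$ in $\|x\|_2=\tau(x^*x)^{1/2}$, with left and right actions of $M$, and $L^2(A)\subset L^2(M)$ for the closure of $A$. Choose a compact Hausdorff space $X$ and a norm-separable unital $C^*$-subalgebra $C(X)\subset A$ that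 is dense in $A$ in the weak operator topology. For $\zeta\in L^2(M)$, let $\eta_\zeta$ be the Radon measure on $X\times X$ determined by $$\langle a\zeta b,\zeta\rangle=\int_{X\times X}a(t)b(s)\,d\eta_\zeta(t,s),\qquad a,b\in C(X).$$ The left-right measure of $A$ is the measure class on $X\times X$ over which $L^2(M)\ominus L^2(A)$ decomposes as a direct integral of (nonzero) Hilbert spaces with respect to the left-right action of $C(X)\otimes C(X)$. Equivalently, it is the class $[\eta_{\zeta_0}]$ for a vector $0\ne\zeta_0\in L^2(M)\ominus L^2(A)$ such that $\eta_\zeta\ll\eta_{\zeta_0}$ for all $\zeta\in L^2(M)\ominus L^2(A)$. The trace restricted to $C(X)$ gives a probability measure on $X$. Representation used here. The spectrum of the self-adjoint operator $\chi_1$ is $[-2\sqrt{2N-1},2\sqrt{2N-1}]$. Take $X=[-2\sqrt{2N-1},2\sqrt{2N-1}]$ and identify $C^*(\{1,\chi_1\})$ with $C(X)$ so that $\chi_1$ corresponds to the function $t\mapsto t$. Then $\lambda$ is the probability measure on $X$ given by $\tau$ restricted to $C(X)$, i.e. the distribution of $\chi_1$ with respect to $\tau$. *)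

(* Defs.v *)
From HB Require Import structures.
From mathcomp Require Import all_boot all_order all_algebra.
From mathcomp Require Import ring lra complex.
From mathcomp Require Import all_classical all_reals all_analysis.

Set Implicit Arguments.
Unset Strict Implicit.
Unset Printing Implicit Defensive.

Import Order.TTheory GRing.Theory Num.Theory.
Import numFieldNormedType.Exports.

Local Open Scope classical_set_scope.
Local Open Scope ring_scope.
Local Open Scope complex_scope.

(* (i, true) stands for the i-th generator and (i, false) for its inverse. *)
Definition letter (N : nat) : Type := ('I_N * bool)%type.

Definition linv (N : nat) (x : letter N) : letter N := (x.1, ~~ x.2).

Definition reduced (N : nat) (w : seq (letter N)) : bool :=
  sorted (fun x y => y != linv x) w.

Definition lcons (N : nat) (x : letter N) (w : seq (letter N)) :=
  if w is y :: w' then if y == linv x then w' else x :: w else [:: x].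

Lemma linvK (N : nat) : involutive (@linv N).
Proof. by case=> i b; rewrite /linv /= negbK. Qed.

Lemma reduced_lcons (N : nat) (x : letter N) w :
  reduced w -> reduced (lcons x w).
Proof.
case: w => // y w /= rw; case: ifPn => [_|ne]; last by rewrite /= ne rw.
exact: path_sorted rw.
Qed.

Lemma lconsK (N : nat) (x : letter N) w :
  reduced w -> lcons x (lcons (linv x) w) = w.
Proof.
case: w => [|y w] /=; first by rewrite eqxx.
rewrite linvK; case: eqVneq => [->|ne] rw /=; last by rewrite eqxx.
by case: w rw => //= z w /andP[/negbTE ->].
Qed.

Lemma reduced_foldr (N : nat) (u v : seq (letter N)) :
  reduced v -> reduced (foldr (@lcons N) v u).
Proof. by move=> rv; elim: u => //= x u /reduced_lcons; exact. Qed.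

Lemma foldr_lcons (N : nat) (x : letter N) (u v : seq (letter N)) :
  reduced v ->
  foldr (@lcons N) v (lcons x u) = lcons x (foldr (@lcons N) v u).
Proof.
move=> rv; case: u => //= y u; case: eqVneq => //= ->.
by rewrite lconsK// reduced_foldr.
Qed.

Lemma foldr_lcons_nil (N : nat) (u : seq (letter N)) :
  reduced u -> foldr (@lcons N) [::] u = u.
Proof.
elim: u => //= x u IH rxu; have ru : reduced u := path_sorted rxu.
by rewrite IH//; case: u rxu {IH ru} => //= y u /andP[/negbTE ->].
Qed.

Record free_group (N : nat) : Type :=
  FreeGroup { word : seq (letter N); reducedP : reduced word }.

HB.instance Definition _ (N : nat) := [isSub for @word N].
HB.instance Definition _ (N : nat) := [Countable of free_group N by <:].

Section FreeGroupLaws.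
Variable N : nat.
Implicit Types u v w : free_group N.

Definition fg_one : free_group N := @FreeGroup N [::] isT.

Definition fg_mul u v : free_group N :=
  FreeGroup (reduced_foldr (word u) (reducedP v)).

Lemma reduced_inv u : reduced (rev (map (@linv N) (word u))).
Proof.
rewrite /reduced rev_sorted sorted_map; apply: sub_sorted (reducedP u).
by move=> x y /= ne; apply: contra ne => /eqP ->; rewrite linvK.
Qed.

Definition fg_inv u : free_group N := FreeGroup (reduced_inv u).

Lemma fg_mulA : associative fg_mul.
Proof.
move=> u v w; apply: val_inj => /=.
elim: (word u) => //= x s ->; rewrite foldr_lcons//; exact: reducedP.
Qed.

Lemma fg_mul1 : left_id fg_one fg_mul.
Proof. by move=> u; apply: val_inj. Qed.

Lemma fg_mulr1 : right_id fg_one fg_mul.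
Proof. by move=> u; apply: val_inj => /=; exact/foldr_lcons_nil/reducedP. Qed.

Lemma fg_mulV : left_inverse fg_one fg_inv fg_mul.
Proof.
move=> u; apply: val_inj => /=; have := reducedP u.
elim: (word u) => //= x s IH rxs; have rs := path_sorted rxs.
rewrite rev_cons foldr_rcons /= -[X in _ = X](IH rs); congr foldr.
by rewrite linvK eqxx.
Qed.

Lemma fg_mulrV : right_inverse fg_one fg_inv fg_mul.
Proof.
move=> u; rewrite -{1}[u]fg_mul1 -{1}(fg_mulV (fg_inv u)).
by rewrite -!fg_mulA (fg_mulA (fg_inv u)) fg_mulV fg_mul1 fg_mulV.
Qed.

End FreeGroupLaws.

HB.instance Definition _ (N : nat) := isGroup.Build (free_group N)
  (@fg_mulA N) (@fg_mul1 N) (@fg_mulr1 N) (@fg_mulV N) (@fg_mulrV N).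

Definition fg_gen (N : nat) (i : 'I_N) : free_group N :=
  @FreeGroup N [:: (i, true)] isT.

Notation modulus := Normc.normc.

Definition square_summable (R : realType) (G : choiceType) : {pred G -> R[i]} :=
  fun f => (\esum_(g in [set: G]) (modulus (f g) ^+ 2)%:E < +oo)%E.

Lemma square_summable_scale (R : realType) (G : choiceType) (k : R)
    (f : G -> R[i]) : 0 <= k -> f \in @square_summable R G ->
  (\esum_(g in [set: G]) (k%:E * (modulus (f g) ^+ 2)%:E) < +oo)%E.
Proof.
rewrite unfold_in /square_summable => k0 sf.
set s := esum _ _ in sf.
have s0 : (0 <= s)%E by apply: esum_ge0 => g _; rewrite lee_fin sqr_ge0.
apply: (@le_lt_trans _ _ (k%:E * s)%E).
  apply: ge_ereal_sup => _ [A [fA _] <-].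
  rewrite -ge0_mule_fsumr; last by move=> g; rewrite lee_fin sqr_ge0.
  rewrite lee_wpmul2l ?lee_fin//; apply: ereal_sup_ubound.
  by exists A => //; split.
by rewrite lte_mul_pinfty ?lee_fin.
Qed.

Lemma square_summable_submod (R : realType) (G : choiceType) :
  submod_closed (@square_summable R G).
Proof.
split => [|c f h sf sh].
  rewrite unfold_in /square_summable esum1 ?ltry// => g _.
  by rewrite (_ : (0 : G -> R[i]) g = 0)// Normc.normc0 expr0n.
set k := (modulus c) ^+ 2 * 2.
have k0 : 0 <= k by rewrite mulr_ge0 ?sqr_ge0.
rewrite unfold_in /square_summable.
apply: (@le_lt_trans _ _ (\esum_(g in [set: G])
    (k%:E * (modulus (f g) ^+ 2)%:E + 2%:E * (modulus (h g) ^+ 2)%:E))%E).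
  apply: le_esum => g _; rewrite -!EFinM -EFinD lee_fin.
  rewrite (_ : (c *: f + h) g = c * f g + h g)//.
  have := @le_normcD R (c * f g) (h g); rewrite Normc.normcM.
  have m0 (z : R[i]) : 0 <= modulus z by case: z => x y; rewrite sqrtr_ge0.
  have : 0 <= modulus c * modulus (f g) by rewrite mulr_ge0.
  move: (m0 (h g)); set a := modulus c * _; set b := modulus (h g).
  move=> b0 a0 ab.
  apply: (@le_trans _ _ ((a + b) ^+ 2)).
    by rewrite lerXn2r// nnegrE ?addr_ge0.
  rewrite (_ : k * _ = 2 * a ^+ 2); last by rewrite /k /a exprMn; ring.
  rewrite -subr_ge0 (_ : _ - _ = (a - b) ^+ 2) ?sqr_ge0//; ring.
have nn (r : R) (u : G -> R[i]) g : 0 <= r ->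
    (0 <= r%:E * (modulus (u g) ^+ 2)%:E)%E.
  by move=> r0; rewrite -EFinM lee_fin mulr_ge0// sqr_ge0.
rewrite esumD//; [|by move=> g _; exact: nn..].
by rewrite lte_add_pinfty// square_summable_scale.
Qed.

HB.instance Definition _ (R : realType) (G : choiceType) :=
  GRing.isSubmodClosed.Build R[i] (G -> R[i]) (@square_summable R G)
    (@square_summable_submod R G).

Record ell2 (R : realType) (G : choiceType) : Type := Ell2
  { ell2_val :> G -> R[i]; ell2P : ell2_val \in @square_summable R G }.

HB.instance Definition _ (R : realType) (G : choiceType) :=
  [isSub for @ell2_val R G].
HB.instance Definition _ (R : realType) (G : choiceType) :=
  [Choice of ell2 R G by <:].
HB.instance Definition _ (R : realType) (G : choiceType) :=
  [SubChoice_isSubLmodule of ell2 R G by <:].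

(* The sum of an absolutely summable family, \esum being reserved to
   nonnegative families. *)
Definition rsum (R : realType) (G : choiceType) (x : G -> R) : R :=
  fine (\esum_(g in [set: G]) (Num.max (x g) 0)%:E) -
  fine (\esum_(g in [set: G]) (Num.max (- x g) 0)%:E).

Definition csum (R : realType) (G : choiceType) (x : G -> R[i]) : R[i] :=
  rsum (fun g => complex.Re (x g)) +i* rsum (fun g => complex.Im (x g)).

Definition inner (R : realType) (G : choiceType) (xi eta : ell2 R G) : R[i] :=
  csum (fun g => xi g * conjc (eta g)).

Definition l2norm (R : realType) (G : choiceType) (xi : ell2 R G) : R :=
  Num.sqrt (fine (\esum_(g in [set: G]) (modulus (xi g) ^+ 2)%:E)).

Lemma square_summable_delta (R : realType) (G : choiceType) (x : G) :
  (fun g => (g == x)%:R : R[i]) \in @square_summable R G.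
Proof.
rewrite unfold_in /square_summable (esumID [set x])/=; last first.
  by move=> g _; rewrite lee_fin sqr_ge0.
rewrite setTI esum_set1 ?lee_fin ?sqr_ge0// esum1 ?adde0 ?ltry// => g.
by move=> [_ /= /eqP/negbTE ->]; rewrite Normc.normc0 expr0n.
Qed.

Definition delta (R : realType) (G : choiceType) (x : G) : ell2 R G :=
  Ell2 (@square_summable_delta R G x).

Notation operator R G := (ell2 R G -> ell2 R G).

Definition bounded_operator (R : realType) (G : choiceType) :
    set (operator R G) :=
  [set T | linear T /\ exists c : R, forall xi, l2norm (T xi) <= c * l2norm xi].

Definition opnorm (R : realType) (G : choiceType) (T : operator R G) : R :=
  inf [set c : R | 0 <= c /\ forall xi, l2norm (T xi) <= c * l2norm xi].

Definition is_adjoint (R : realType) (G : choiceType) (T S : operator R G) :=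
  forall xi eta, inner (T xi) eta = inner xi (S eta).

(* 0 is a junk value: a bounded operator has exactly one adjoint. *)
Definition adjoint (R : realType) (G : choiceType) (T : operator R G) :
    operator R G :=
  xget (0 : operator R G) [set S | is_adjoint T S].

Definition cstar_algebra (R : realType) (G : choiceType)
    (B : set (operator R G)) : Prop :=
  [/\ B `<=` @bounded_operator R G,
      B idfun,
      (forall (c : R[i]) S T, B S -> B T -> B (c *: S + T)),
      (forall S T, B S -> B T -> B (S \o T)) &
      (forall T, B T -> B (adjoint T)) /\
      (forall T, bounded_operator T ->
        (forall e : R, 0 < e -> exists2 S, B S & opnorm (T - S) < e) -> B T)].

Definition cstar_generated (R : realType) (G : choiceType)
    (F : set (operator R G)) : set (operator R G) :=
  smallest (@cstar_algebra R G) F.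

Definition commutant (R : realType) (G : choiceType) (M : set (operator R G)) :
    set (operator R G) :=
  [set T | bounded_operator T /\ forall S, M S -> T \o S = S \o T].

Definition von_neumann_algebra (R : realType) (G : choiceType)
    (M : set (operator R G)) : Prop :=
  [/\ M `<=` @bounded_operator R G,
      (forall T, M T -> M (adjoint T)) &
      commutant (commutant M) = M].

Lemma square_summable_reindex (R : realType) (G : choiceType) (s : G -> G)
    (f : G -> R[i]) : bijective s -> f \in @square_summable R G ->
  f \o s \in @square_summable R G.
Proof.
move=> bs; rewrite !unfold_in /square_summable.
by rewrite (reindex_esum [set: G] [set: G] s) ?setTT_bijective.
Qed.

Lemma square_summable_conj (R : realType) (G : choiceType)
    (f : G -> R[i]) : f \in @square_summable R G ->
  (fun g => conjc (f g)) \in @square_summable R G.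
Proof.
rewrite !unfold_in /square_summable; congr (_ < _)%E; apply: eq_esum => g _.
by case: (f g) => x y /=; rewrite sqrrN.
Qed.

Lemma mulg_bij (G : groupType) (x : G) : bijective (fun g : G => (x * g)%g).
Proof. by exists (fun g => x^-1 * g)%g; [exact: mulKg|exact: mulVKg]. Qed.

Lemma invg_bij (G : groupType) : bijective (fun g : G => (g^-1)%g).
Proof. by exists (fun g => g^-1)%g; exact: invgK. Qed.

(* The canonical unitary of x : (u_x xi)(g) = xi (x^-1 g). *)
Definition left_translation (R : realType) (G : groupType) (x : G) :
    operator R G :=
  fun xi => Ell2 (square_summable_reindex (mulg_bij (x^-1)%g) (ell2P xi)).

(* T |-> T delta_1 identifies the completion L^2(L(G)), for the trace below,
   with l^2(G). *)
Definition group_vN (R : realType) (G : groupType) : set (operator R G) :=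
  smallest (@von_neumann_algebra R G) (range (@left_translation R G)).

Definition trace (R : realType) (G : groupType) (T : operator R G) : R[i] :=
  inner (T (delta R 1%g)) (delta R 1%g).

(* W^*(x), as a von Neumann subalgebra of L(G). *)
Definition vN_generated (R : realType) (G : groupType) (x : operator R G) :
    set (operator R G) :=
  smallest [set B | von_neumann_algebra B /\ B `<=` @group_vN R G] [set x].

(* The modular conjugation J, extending T delta_1 |-> T^* delta_1. *)
Definition modular_conj (R : realType) (G : groupType) : operator R G :=
  fun xi => Ell2 (square_summable_reindex (@invg_bij G)
                    (square_summable_conj (ell2P xi))).

(* The right action xi b = J b^* J xi of b in L(G), extending the right
   multiplication (T delta_1) b = (T b) delta_1. *)
Definition right_action (R : realType) (G : groupType) (xi : ell2 R G)
    (b : operator R G) : ell2 R G :=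
  modular_conj (adjoint b (modular_conj xi)).

Definition L2_subalgebra (R : realType) (G : groupType)
    (A : set (operator R G)) : set (ell2 R G) :=
  [set xi | forall e : R, 0 < e ->
    exists2 T, A T & l2norm (xi - T (delta R 1%g)) < e].

Definition orthogonal_complement (R : realType) (G : choiceType)
    (V : set (ell2 R G)) : set (ell2 R G) :=
  [set zeta | forall xi, V xi -> inner zeta xi = 0].

(* R[i] seen through the numFieldType structure that carries its norm
   topology. *)
Definition Cfield (R : realType) : numFieldType := R[i].

(* C(X) consists of restrictions to X of functions defined on R; everything
   below depends only on these restrictions. *)
Definition C_of (R : realType) (X : set R) : set (R -> R[i]) :=
  [set f | {within X, continuous (f : R -> Cfield R)}].

Definition supnorm (R : realType) (X : set R) (f : R -> R[i]) : R :=
  sup [set modulus (f t) | t in X].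

Record C_of_isomorphism (R : realType) (G : choiceType) (X : set R)
    (B : set (operator R G)) (Phi : (R -> R[i]) -> operator R G) : Prop := {
  Phi_image : Phi @` C_of X = B;
  Phi_linear : forall (c : R[i]) f g, C_of X f -> C_of X g ->
    Phi (fun t => c * f t + g t) = c *: Phi f + Phi g;
  Phi_mul : forall f g, C_of X f -> C_of X g ->
    Phi (fun t => f t * g t) = Phi f \o Phi g;
  Phi_one : Phi (fun=> 1) = idfun;
  Phi_conj : forall f, C_of X f -> Phi (fun t => conjc (f t)) = adjoint (Phi f);
  Phi_isometry : forall f, C_of X f -> opnorm (Phi f) = supnorm X f }.

Definition cintegral (R : realType) d (T : measurableType d)
    (mu : {measure set T -> \bar R}) (D : set T) (f : T -> R[i]) : R[i] :=
  Rintegral mu D (fun t => complex.Re (f t)) +i*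
  Rintegral mu D (fun t => complex.Im (f t)).

(* Borel measures on X are encoded as Borel measures on R for which the
   complement of X is null. *)
Definition trace_measure (R : realType) (G : groupType) (X : set R)
    (Phi : (R -> R[i]) -> operator R G)
    (lambda : probability (measurableTypeR R) R) : Prop :=
  lambda (~` X) = 0%E /\
  forall f, C_of X f -> trace (Phi f) = cintegral lambda X f.

(* On X * X, Radon measures are finite Borel measures, here carried by R * R
   with null complement of X * X. *)
Definition is_eta (R : realType) (G : groupType) (X : set R)
    (Phi : (R -> R[i]) -> operator R G) (zeta : ell2 R G)
    (eta : {finite_measure set (measurableTypeR R * measurableTypeR R)%type
                           -> \bar R}) : Prop :=
  eta (~` (X `*` X)) = 0%E /\
  forall a b, C_of X a -> C_of X b ->
    inner (Phi a (right_action zeta (Phi b))) zeta =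
    cintegral eta (X `*` X) (fun p => a p.1 * b p.2).

(* mu belongs to the measure class of eta_zeta0, for zeta0 a vector of
   L^2(L(G)) orthogonal to L^2(A) whose eta dominates all the others; Phi represents C(X)
   as a weakly dense C*-subalgebra of A. *)
Definition left_right_measure (R : realType) (G : groupType)
    (A : set (operator R G)) (X : set R) (Phi : (R -> R[i]) -> operator R G)
    (mu : {measure set (measurableTypeR R * measurableTypeR R)%type
                   -> \bar R}) : Prop :=
  let H := orthogonal_complement (L2_subalgebra A) in
  exists zeta0 (eta0 : {finite_measure set
      (measurableTypeR R * measurableTypeR R)%type -> \bar R}),
    [/\ H zeta0, zeta0 <> 0, is_eta X Phi zeta0 eta0,
        (forall zeta, H zeta ->
          exists2 eta : {finite_measure set
              (measurableTypeR R * measurableTypeR R)%type -> \bar R},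
            is_eta X Phi zeta eta & eta `<< eta0) &
        mu `<< eta0 /\ eta0 `<< mu].

Definition chi1 (R : realType) (N : nat) : operator R (free_group N) :=
  \sum_(i < N) (left_translation (fg_gen i) +
                 left_translation ((fg_gen i)^-1)%g).

Definition laplacian_masa (R : realType) (N : nat) :
    set (operator R (free_group N)) :=
  vN_generated (@chi1 R N).

Definition chi1_spectrum (R : realType) (N : nat) : set R :=
  `[- (2 * Num.sqrt ((2 * N)%:R - 1)), 2 * Num.sqrt ((2 * N)%:R - 1)].

(* Main.v *)
From HB Require Import structures.
From mathcomp Require Import all_boot all_order all_algebra.
From mathcomp Require Import ring lra zify complex.
From mathcomp Require Import all_classical all_reals all_analysis.
Require Import Defs.

Set Implicit Arguments.
Unset Strict Implicit.
Unset Printing Implicit Defensive.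

Import Order.TTheory GRing.Theory Num.Theory.
Import numFieldNormedType.Exports measurable_realfun.

Local Open Scope classical_set_scope.
Local Open Scope ring_scope.
Local Open Scope complex_scope.

(** For real a and b in C(X), the form <a zeta b, zeta> defines a bilinear
functional, bimod zeta.  The theorem compares it with integration against
lambda x lambda, and the link between the two is the family of spherical
polynomials p_n (spol): p_n evaluated at the Laplacian is the sum of the reduced
words of length n, so the p_n are orthogonal in L^2(lambda), p_n having squared
norm |S_n|, the number of these words.  The density of the measure of zeta
must therefore be the sum over n and m of
<p_n zeta p_m, zeta> (p_n / |S_n|)(t) (p_m / |S_m|)(s).

Every measure is absolutely continuous (density_exists).  Let zeta be orthogonal
to the masa.  For a truncation of zeta to a ball, the coefficients
<p_n zeta p_m, zeta> are bounded uniformly in n and m (coefficients_bounded): the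
number of words z of length n for which g^-1 z h has length m is, up to a bounded
error, a function of the length of h (coef_near_radial), and the sums of zeta over
spheres vanish.  Since |S_n| >= 3^n, the L^1 norm of p_n / |S_n| decays
geometrically (nspol_L1), so that the double series converges in L^1.  To pass
from truncations to zeta, note that the L^1 norm of a density is computed by
testing it on the tensors of a partition of unity phi_i (L1_norm_tests), while
<phi_i zeta phi_j, zeta> is the square of a seminorm of zeta and these squares
add up to the squared norm of zeta (partition_sum).  Hence the density depends
continuously on zeta, for the L^1 norm (partition_test_diff).  Only polynomials
are tested against the series directly; they are dense in C(X) because Phi is an
isometry onto the C*-algebra generated by the Laplacian (C_of_approximable).

One measure dominates lambda x lambda.  Let a and b be two of the free generators
and zeta0 = (a - a^-1)(b - b^-1).  It is orthogonal to the masa, because the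
automorphism that inverts a fixes the Laplacian and changes the sign of zeta0
(zeta0_orthogonal).  Its coefficients factor and vanish unless n and m are 0 or 2
(zeta0_coefficients), whence its density is the squared norm of zeta0 times
w(t) w(s) with w = 1 - p_2 / |S_2| = (4 N^2 - t^2) / (2 N (2 N - 1)), which is
positive on the spectrum (weight_gt0). *)

(** * Summable families *)
Lemma max0_diff (R : realDomainType) (z : R) :
  Num.max z 0 - Num.max (- z) 0 = z.
Proof. by rewrite !maxEle; case: ifP; case: ifP; lra. Qed.

Section RealSums.
Variables (R : realType) (G : choiceType).
Implicit Types x y : G -> R.

Definition rsummable x := (\esum_(g in [set: G]) `|x g|%:E < +oo)%E.

Lemma le_rsummable x y : (forall g, `|x g| <= `|y g|) -> rsummable y -> rsummable x.
Proof. by move=> xy; apply: le_lt_trans; apply: le_esum => g _; rewrite lee_fin. Qed.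

Lemma rsummableD x y : rsummable x -> rsummable y -> rsummable (fun g => x g + y g).
Proof.
move=> sx sy; rewrite /rsummable.
apply: (@le_lt_trans _ _ (\esum_(g in [set: G]) (`|x g|%:E + `|y g|%:E))%E).
  by apply: le_esum => g _; rewrite -EFinD lee_fin ler_normD.
by rewrite esumD// ?lte_add_pinfty// => g _; rewrite lee_fin.
Qed.

Lemma fin_esum_ge0 x : (forall g, 0 <= x g) -> rsummable x ->
  (\esum_(g in [set: G]) (x g)%:E \is a fin_num)%E.
Proof.
move=> x0 sx; rewrite ge0_fin_numE; last by apply: esum_ge0 => g _; rewrite lee_fin.
by apply: le_lt_trans sx; apply: le_esum => g _; rewrite lee_fin ler_norm.
Qed.

(** The value does not depend on how the family is written as a difference of
two nonnegative summable families; linearity follows. *)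
Lemma rsum_diff x (u v : G -> R) : (forall g, 0 <= u g) -> (forall g, 0 <= v g) ->
  rsummable u -> rsummable v -> (forall g, x g = u g - v g) ->
  rsum x = fine (\esum_(g in [set: G]) (u g)%:E) -
           fine (\esum_(g in [set: G]) (v g)%:E).
Proof.
move=> u0 v0 su sv xE.
have p0 g : 0 <= Num.max (x g) 0 by rewrite le_max lexx orbT.
have n0 g : 0 <= Num.max (- x g) 0 by rewrite le_max lexx orbT.
have sp : rsummable (fun g => Num.max (x g) 0).
  apply: le_rsummable su => g; rewrite !ger0_norm// xE ge_max u0 andbT.
  by rewrite lerBlDr lerDl.
have sn : rsummable (fun g => Num.max (- x g) 0).
  apply: le_rsummable sv => g; rewrite !ger0_norm// xE ge_max v0 andbT.
  by rewrite opprB lerBlDr lerDl.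
apply/eqP; rewrite /rsum subr_eq addrAC eq_sym subr_eq; apply/eqP.
rewrite -!fineD ?fin_esum_ge0//.
rewrite -!esumD; try by move=> g _; rewrite lee_fin.
congr fine; apply: eq_esum => g _; rewrite -!EFinD; congr EFin.
by have := max0_diff (x g); rewrite [in X in _ = X -> _]xE; lra.
Qed.

Lemma rsum_ge0E x : (forall g, 0 <= x g) ->
  rsum x = fine (\esum_(g in [set: G]) (x g)%:E).
Proof.
move=> x0; rewrite /rsum [X in _ - fine X]esum1 ?subr0.
  by congr fine; apply: eq_esum => g _; rewrite (max_idPl _).
by move=> g _; rewrite (max_idPr _)// oppr_le0.
Qed.

Lemma eq_rsum x y : x =1 y -> rsum x = rsum y.
Proof. by move=> /funext ->. Qed.

Let pos x g : R := Num.max (x g) 0.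
Let neg x g : R := Num.max (- x g) 0.

Let pos0 x g : 0 <= pos x g. Proof. by rewrite le_max lexx orbT. Qed.
Let neg0 x g : 0 <= neg x g. Proof. by rewrite le_max lexx orbT. Qed.
Let spos x : rsummable x -> rsummable (pos x).
Proof.
apply: le_rsummable => g; rewrite ger0_norm//.
by rewrite /pos ge_max normr_ge0 ler_norm.
Qed.
Let sneg x : rsummable x -> rsummable (neg x).
Proof.
apply: le_rsummable => g; rewrite ger0_norm//.
by rewrite /neg ge_max normr_ge0 -normrN ler_norm.
Qed.
Let posneg x g : x g = pos x g - neg x g.
Proof. by rewrite max0_diff. Qed.

Lemma rsumD x y : rsummable x -> rsummable y ->
  rsum (fun g => x g + y g) = rsum x + rsum y.
Proof.
move=> sx sy.
rewrite (@rsum_diff _ (fun g => pos x g + pos y g) (fun g => neg x g + neg y g)).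
- have [spx spy snx sny] := And4 (spos sx) (spos sy) (sneg sx) (sneg sy).
  rewrite (@rsum_diff x (pos x) (neg x)) ?(@rsum_diff y (pos y) (neg y))//.
  have a1 : forall g, [set: G] g -> (0 <= (pos x g)%:E)%E by move=> *; rewrite lee_fin.
  have a2 : forall g, [set: G] g -> (0 <= (pos y g)%:E)%E by move=> *; rewrite lee_fin.
  have a3 : forall g, [set: G] g -> (0 <= (neg x g)%:E)%E by move=> *; rewrite lee_fin.
  have a4 : forall g, [set: G] g -> (0 <= (neg y g)%:E)%E by move=> *; rewrite lee_fin.
  under eq_esum do rewrite EFinD; under [X in _ - fine X]eq_esum do rewrite EFinD.
  rewrite !esumD// !fineD ?fin_esum_ge0//.
  by rewrite opprD addrACA.
- by move=> g; rewrite addr_ge0.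
- by move=> g; rewrite addr_ge0.
- by apply: rsummableD; exact: spos.
- by apply: rsummableD; exact: sneg.
- by move=> g; rewrite [x g]posneg [y g]posneg opprD addrACA.
Qed.

Lemma rsumN x : rsum (fun g => - x g) = - rsum x.
Proof.
by rewrite /rsum opprB; congr (_ - fine _); apply: eq_esum => g _; rewrite opprK.
Qed.

Lemma rsummableZ c x : rsummable x -> rsummable (fun g => c * x g).
Proof.
rewrite /rsummable => sx.
apply: (@le_lt_trans _ _ (`|c|%:E * \esum_(g in [set: G]) `|x g|%:E)%E).
  apply: ge_ereal_sup => _ [A [fA _] <-].
  under eq_fsbigr do rewrite normrM EFinM.
  rewrite -ge0_mule_fsumr; last by move=> g; rewrite lee_fin.
  rewrite lee_wpmul2l ?lee_fin//; apply: ereal_sup_ubound.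
  by exists A => //; split.
rewrite lte_mul_pinfty ?lee_fin//.
Qed.

Lemma rsumZ c x : rsummable x -> rsum (fun g => c * x g) = c * rsum x.
Proof.
suff H (d : R) (z : G -> R) : 0 < d -> (forall g, 0 <= z g) -> rsummable z ->
    fine (\esum_(g in [set: G]) (d * z g)%:E) = d * fine (\esum_(g in [set: G]) (z g)%:E).
  have Hp d : 0 < d -> rsummable x -> rsum (fun g => d * x g) = d * rsum x.
    move=> d0 sx; rewrite (@rsum_diff _ (fun g => d * pos x g) (fun g => d * neg x g)).
    - rewrite (@rsum_diff x (pos x) (neg x))//; [|exact: spos|exact: sneg].
      by rewrite mulrBr (H d (pos x))// ?(H d (neg x))//; [exact: sneg|exact: spos].
    - by move=> g; rewrite mulr_ge0// ltW.
    - by move=> g; rewrite mulr_ge0// ltW.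
    - by apply: rsummableZ; exact: spos.
    - by apply: rsummableZ; exact: sneg.
    - by move=> g; rewrite -mulrBr -posneg.
  move=> sx; case: (ltgtP c 0) => c0.
  - rewrite -[c]opprK mulNr -Hp ?oppr_gt0// -rsumN; apply: eq_rsum => g.
    by rewrite mulNr.
  - exact: Hp.
  - rewrite c0 mul0r rsum_ge0E; first by rewrite esum1// => g _; rewrite mul0r.
    by move=> g; rewrite mul0r.
have K (e : R) (y : G -> R) : 0 < e -> (forall g, 0 <= y g) ->
    (\esum_(g in [set: G]) (e * y g)%:E <= e%:E * \esum_(g in [set: G]) (y g)%:E)%E.
  move=> e0 y0; apply: ge_ereal_sup => _ [A [fA _] <-].
  under eq_fsbigr do rewrite EFinM.
  rewrite -ge0_mule_fsumr; last by move=> g; rewrite lee_fin.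
  apply: lee_wpmul2l; first by rewrite lee_fin ltW.
  apply: ereal_sup_ubound.
  by exists A => //; split.
move=> d0 z0 sz; have fz := fin_esum_ge0 z0 sz.
have fdz : (\esum_(g in [set: G]) (d * z g)%:E \is a fin_num)%E.
  by apply: fin_esum_ge0 (rsummableZ _ sz) => g; rewrite mulr_ge0// ltW.
apply/eqP; rewrite eq_le -!lee_fin EFinM !fineK// K//=.
have := @K d^-1 (fun g => d * z g); rewrite invr_gt0 => /(_ d0) H.
under eq_esum do rewrite -[z _](mulKf (lt0r_neq0 d0)).
apply: (@le_trans _ _ (d%:E * (d^-1%:E * \esum_(g in [set: G]) (d * z g)%:E)))%E.
  apply: lee_wpmul2l; first by rewrite lee_fin ltW.
  apply: H => g.
  by rewrite mulr_ge0// ltW.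
by rewrite muleA -EFinM divff ?lt0r_neq0// mul1e.
Qed.

Lemma rsum_reindex (s : G -> G) x : bijective s -> rsum (x \o s) = rsum x.
Proof.
move=> bs; rewrite /rsum.
congr (fine _ - fine _); apply: esym;
  by apply: (@reindex_esum _ _ _ [set: G] [set: G] s); rewrite ?setTT_bijective.
Qed.

Lemma rsum_single x g0 : (forall g, g != g0 -> x g = 0) -> rsum x = x g0.
Proof.
suff H (z : G -> R) : (forall g, 0 <= z g) -> (forall g, g != g0 -> z g = 0) ->
    fine (\esum_(g in [set: G]) (z g)%:E) = z g0.
  move=> x0; rewrite /rsum !H.
  - by rewrite [RHS](posneg x g0).
  - by move=> g; rewrite le_max lexx orbT.
  - by move=> g /x0 ->; rewrite oppr0 maxxx.
  - by move=> g; rewrite le_max lexx orbT.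
  - by move=> g /x0 ->; rewrite maxxx.
move=> z0 zs; rewrite (esumID [set g0])/=; last by move=> g _; rewrite lee_fin.
rewrite setTI esum_set1 ?lee_fin// esum1 ?adde0// => g [_ /= /eqP/zs ->].
by [].
Qed.

End RealSums.

Lemma rsum0 (R : realType) (G : choiceType) : rsum (fun _ : G => 0 : R) = 0.
Proof. by rewrite rsum_ge0E// esum1. Qed.

Section ComplexSums.
Variables (R : realType) (G : choiceType).
Implicit Types x y : G -> R[i].

Definition csummable x :=
  rsummable (fun g => complex.Re (x g)) /\ rsummable (fun g => complex.Im (x g)).

Lemma csumD x y : csummable x -> csummable y ->
  csum (fun g => x g + y g) = csum x + csum y.
Proof.
move=> [rx ix] [ry iy]; rewrite /csum.
rewrite [in RHS]/GRing.add /= -!rsumD//; congr (_ +i* _); apply: eq_rsum => g;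
by case: (x g) (y g) => ? ? [].
Qed.

Lemma csumZ (c : R[i]) x : csummable x -> csum (fun g => c * x g) = c * csum x.
Proof.
move=> [rx ix]; rewrite /csum; case: c => a b.
rewrite [in RHS]/GRing.mul /=; congr (_ +i* _).
  rewrite -(rsumZ a)// -(rsumZ b)// -rsumN -rsumD; [|exact: rsummableZ|].
    by apply: eq_rsum => g; case: (x g).
  by under eq_fun do rewrite -mulNr; apply: rsummableZ.
rewrite -(rsumZ a)// -(rsumZ b)// -rsumD; [|exact: rsummableZ|exact: rsummableZ].
by apply: eq_rsum => g; case: (x g).
Qed.

Lemma csum_conj x : csum (fun g => conjc (x g)) = conjc (csum x).
Proof.
rewrite /csum /=; congr (_ +i* _); first by apply: eq_rsum => g; case: (x g).
by rewrite -rsumN; apply: eq_rsum => g; case: (x g).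
Qed.

Lemma csum_reindex (s : G -> G) x : bijective s -> csum (x \o s) = csum x.
Proof.
move=> bs; rewrite /csum; congr (_ +i* _).
  by rewrite -[RHS](rsum_reindex _ bs).
by rewrite -[RHS](rsum_reindex _ bs).
Qed.

Lemma eq_csum x y : x =1 y -> csum x = csum y.
Proof. by move=> /funext ->. Qed.

Lemma csum_single x g0 : (forall g, g != g0 -> x g = 0) -> csum x = x g0.
Proof.
move=> x0; rewrite /csum (@rsum_single _ _ _ g0); last by move=> g /x0 ->.
rewrite (@rsum_single _ _ (fun g => complex.Im _) g0); last by move=> g /x0 ->.
by case: (x g0).
Qed.

End ComplexSums.

Lemma sqr_modulus (R : realType) (z : R[i]) :
  modulus z ^+ 2 = complex.Re z ^+ 2 + complex.Im z ^+ 2.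
Proof. by case: z => a b /=; rewrite sqr_sqrtr// addr_ge0// sqr_ge0. Qed.

Lemma modulus_ge0 (R : realType) (z : R[i]) : 0 <= modulus z.
Proof. by case: z => a b; rewrite sqrtr_ge0. Qed.

Arguments csum : simpl never.
Arguments inner : simpl never.
Arguments l2norm : simpl never.
Arguments Normc.normc : simpl never.

Section Conjugation.
Variable R : realType.
Implicit Types x y : R[i].
Lemma conjcD x y : conjc (x + y) = conjc x + conjc y. Proof. exact: rmorphD. Qed.
Lemma conjcM x y : conjc (x * y) = conjc x * conjc y. Proof. exact: rmorphM. Qed.
Lemma conjcN x : conjc (- x) = - conjc x. Proof. exact: rmorphN. Qed.
End Conjugation.

(** * The Hilbert space of square summable families *)

Section InnerProduct.
Variables (R : realType) (G : choiceType).
Implicit Types (xi eta zeta : ell2 R G) (c : R[i]).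

Lemma ell2_eqP xi eta : (forall g, xi g = eta g) -> xi = eta.
Proof. by move=> h; apply/val_inj/funext. Qed.

Lemma ell2_addE xi eta g : (xi + eta) g = xi g + eta g. Proof. by []. Qed.
Lemma ell2_oppE xi g : (- xi) g = - xi g. Proof. by []. Qed.
Lemma ell2_scaleE c xi g : (c *: xi) g = c * xi g. Proof. by []. Qed.
Lemma ell2_sumE I (r : seq I) (P : pred I) (F : I -> ell2 R G) g :
  (\sum_(i <- r | P i) F i) g = \sum_(i <- r | P i) F i g.
Proof. by elim/big_ind2 : _ => // x1 x2 y1 y2 <- <-. Qed.

Lemma ell2_rsummable xi : rsummable (fun g => modulus (xi g) ^+ 2).
Proof.
have := ell2P xi; rewrite unfold_in /square_summable; congr (_ < _)%E.
by apply: eq_esum => g _; rewrite ger0_norm// sqr_ge0.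
Qed.

Lemma inner_csummable xi eta : csummable (fun g => xi g * conjc (eta g)).
Proof.
have S := rsummableD (ell2_rsummable xi) (ell2_rsummable eta).
by split; apply: le_rsummable S => g; rewrite [leRHS]ger0_norm ?addr_ge0 ?sqr_ge0//
   !sqr_modulus; case: (xi g) (eta g) => a b [c d] /=; rewrite ler_norml;
  have := (sqr_ge0 (a + c), sqr_ge0 (a - c), sqr_ge0 (b + d), sqr_ge0 (b - d));
  have := (sqr_ge0 (a + d), sqr_ge0 (a - d), sqr_ge0 (b + c), sqr_ge0 (b - c));
  have := (sqr_ge0 a, sqr_ge0 b, sqr_ge0 c, sqr_ge0 d); rewrite !expr2 => -[[[? ?] ?] ?] -[[[? ?] ?] ?] -[[[? ?] ?] ?]; lra.
Qed.

Lemma innerDl xi eta zeta : inner (xi + eta) zeta = inner xi zeta + inner eta zeta.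
Proof.
rewrite /inner -csumD; [|exact: inner_csummable..].
by apply: eq_csum => g; rewrite ell2_addE mulrDl.
Qed.

Lemma innerZl c xi eta : inner (c *: xi) eta = c * inner xi eta.
Proof.
rewrite /inner -csumZ; last exact: inner_csummable.
by apply: eq_csum => g; rewrite ell2_scaleE mulrA.
Qed.

Lemma inner_conj xi eta : inner eta xi = conjc (inner xi eta).
Proof.
rewrite /inner -csum_conj; apply: eq_csum => g.
by rewrite conjcM conjcK mulrC.
Qed.

Lemma innerDr xi eta zeta : inner zeta (xi + eta) = inner zeta xi + inner zeta eta.
Proof. by rewrite inner_conj innerDl conjcD -!inner_conj. Qed.

Lemma innerZr c xi eta : inner xi (c *: eta) = conjc c * inner xi eta.
Proof. by rewrite inner_conj innerZl conjcM -inner_conj. Qed.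

Lemma inner0l xi : inner 0 xi = 0.
Proof. by rewrite -(scale0r (0 : ell2 R G)) innerZl mul0r. Qed.

Lemma inner0r xi : inner xi 0 = 0.
Proof. by rewrite inner_conj inner0l conjc0. Qed.

Lemma innerNl xi eta : inner (- xi) eta = - inner xi eta.
Proof. by rewrite -scaleN1r innerZl mulN1r. Qed.

Lemma innerNr xi eta : inner xi (- eta) = - inner xi eta.
Proof. by rewrite inner_conj innerNl conjcN -inner_conj. Qed.

Lemma inner_suml I (r : seq I) (P : pred I) (F : I -> ell2 R G) eta :
  inner (\sum_(i <- r | P i) F i) eta = \sum_(i <- r | P i) inner (F i) eta.
Proof.
by elim/big_ind2 : _ => [|x1 x2 y1 y2 <- <-|//]; rewrite ?inner0l// innerDl.
Qed.

Lemma inner_sumr I (r : seq I) (P : pred I) (F : I -> ell2 R G) eta :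
  inner eta (\sum_(i <- r | P i) F i) = \sum_(i <- r | P i) inner eta (F i).
Proof.
by elim/big_ind2 : _ => [|x1 x2 y1 y2 <- <-|//]; rewrite ?inner0r// innerDr.
Qed.

Lemma deltaE (g h : G) : delta R g h = (h == g)%:R :> R[i]. Proof. by []. Qed.

Lemma inner_deltar xi g : inner xi (delta R g) = xi g.
Proof.
rewrite /inner (@csum_single _ _ _ g) /= ?eqxx ?conjc1 ?mulr1// => h /negbTE hg.
by rewrite /= hg conjc0 mulr0.
Qed.

Lemma l2norm_ge0 xi : 0 <= l2norm xi.
Proof. exact: sqrtr_ge0. Qed.

Lemma sqr_l2norm xi :
  l2norm xi ^+ 2 = fine (\esum_(g in [set: G]) (modulus (xi g) ^+ 2)%:E).
Proof.
rewrite sqr_sqrtr//; apply: fine_ge0; apply: esum_ge0 => g _.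
by rewrite lee_fin sqr_ge0.
Qed.

Lemma inner_l2norm xi : inner xi xi = (l2norm xi ^+ 2)%:C.
Proof.
rewrite /inner /csum sqr_l2norm -rsum_ge0E; last by move=> g; rewrite sqr_ge0.
rewrite [X in _ +i* X](_ : _ = 0).
  by congr (_ +i* _); apply: eq_rsum => g; rewrite sqr_modulus;
    case: (xi g) => a b /=; ring.
rewrite (@eq_rsum _ _ _ (fun=> 0)) ?rsum0// => g.
by case: (xi g) => a b /=; ring.
Qed.

Definition rinner xi eta : R := complex.Re (inner xi eta).

Lemma rinnerC xi eta : rinner xi eta = rinner eta xi.
Proof. by rewrite /rinner inner_conj; case: (inner _ _). Qed.

Lemma rinner_norm xi : rinner xi xi = l2norm xi ^+ 2.
Proof. by rewrite /rinner inner_l2norm. Qed.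

Lemma rinnerDl xi eta zeta : rinner (xi + eta) zeta = rinner xi zeta + rinner eta zeta.
Proof. by rewrite /rinner innerDl; case: (inner _ _) (inner _ _) => ? ? []. Qed.

Lemma rinnerDr xi eta zeta : rinner zeta (xi + eta) = rinner zeta xi + rinner zeta eta.
Proof. by rewrite rinnerC rinnerDl !(rinnerC zeta). Qed.

Lemma rinnerZl (k : R) xi eta : rinner (k%:C *: xi) eta = k * rinner xi eta.
Proof. by rewrite /rinner innerZl; case: (inner _ _) => a b /=; ring. Qed.

Lemma rinnerZr (k : R) xi eta : rinner xi (k%:C *: eta) = k * rinner xi eta.
Proof. by rewrite rinnerC rinnerZl rinnerC. Qed.

Lemma rinnerNl xi eta : rinner (- xi) eta = - rinner xi eta.
Proof. by rewrite /rinner innerNl; case: (inner _ _). Qed.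

Lemma rinnerNr xi eta : rinner xi (- eta) = - rinner xi eta.
Proof. by rewrite rinnerC rinnerNl rinnerC. Qed.

Lemma inner_im xi eta : complex.Im (inner xi eta) = rinner xi ('i *: eta).
Proof. by rewrite /rinner innerZr; case: (inner _ _) => a b /=; ring. Qed.

Lemma rinner_cauchy xi eta : `|rinner xi eta| <= l2norm xi * l2norm eta.
Proof.
(* The discriminant of this nonnegative polynomial in s is not positive. *)
have P (s : R) : 0 <= l2norm xi ^+ 2 + s * s * l2norm eta ^+ 2 + 2 * s * rinner xi eta.
  have : 0 <= rinner (xi + s%:C *: eta) (xi + s%:C *: eta).
    by rewrite rinner_norm sqr_ge0.
  rewrite rinnerDl !rinnerDr rinnerZl !rinnerZr rinnerZl (rinnerC eta) !rinner_norm.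
  by congr (_ <= _); ring.
move: (l2norm_ge0 xi) (l2norm_ge0 eta) P.
move: (l2norm xi) (l2norm eta) (rinner xi eta) => a b r a0 b0 P.
rewrite -ler_sqr ?nnegrE ?mulr_ge0// real_normK ?num_real//.
have [b00|bn0] := eqVneq b 0.
  have [->|rn0] := eqVneq r 0; first by rewrite expr0n sqr_ge0.
  have := P (- (a ^+ 2 + 1) / (2 * r)); rewrite b00.
  have -> : a ^+ 2 + - (a ^+ 2 + 1) / (2 * r) * (- (a ^+ 2 + 1) / (2 * r)) * 0 ^+ 2 +
     2 * (- (a ^+ 2 + 1) / (2 * r)) * r = - 1 by field.
  by rewrite oppr_ge0 ler10.
have := P (- r / b ^+ 2).
have -> : a ^+ 2 + - r / b ^+ 2 * (- r / b ^+ 2) * b ^+ 2 + 2 * (- r / b ^+ 2) * r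
  = ((a * b) ^+ 2 - r ^+ 2) / b ^+ 2 by field.
have b2 : 0 < b ^+ 2 by rewrite exprn_gt0// lt0r bn0.
by rewrite pmulr_lge0 ?invr_gt0// subr_ge0.
Qed.

Lemma l2norm0_eq0 xi : l2norm xi = 0 -> xi = 0.
Proof.
move=> x0; apply: ell2_eqP => g; rewrite -inner_deltar.
suff H eta : rinner xi eta = 0.
  have := H (delta R g); have := H ('i *: delta R g); rewrite -inner_im /rinner.
  by case: inner => a b /= -> ->.
by have := rinner_cauchy xi eta; rewrite x0 mul0r normr_le0 => /eqP.
Qed.

Lemma l2norm0 : l2norm (0 : ell2 R G) = 0.
Proof.
by apply/eqP; rewrite -(sqrf_eq0 (l2norm _)) -rinner_norm /rinner inner0l.
Qed.

Lemma eq_l2norm xi eta : inner xi xi = inner eta eta -> l2norm xi = l2norm eta.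
Proof.
rewrite !inner_l2norm => /complexI /eqP; rewrite eqrXn2 ?l2norm_ge0//.
by move=> /eqP.
Qed.

Lemma l2normZ c xi : l2norm (c *: xi) = modulus c * l2norm xi.
Proof.
apply/eqP; rewrite -(@eqrXn2 _ 2) ?mulr_ge0 ?l2norm_ge0 ?modulus_ge0//.
rewrite exprMn -!rinner_norm sqr_modulus /rinner innerZl innerZr.
rewrite inner_l2norm; case: c => a b /=; apply/eqP; ring.
Qed.

Lemma l2normN xi : l2norm (- xi) = l2norm xi.
Proof. by apply: eq_l2norm; rewrite innerNl innerNr opprK. Qed.

Lemma l2normD xi eta : l2norm (xi + eta) <= l2norm xi + l2norm eta.
Proof.
rewrite -(@ler_pXn2r _ 2) ?nnegrE ?addr_ge0 ?l2norm_ge0//.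
rewrite -rinner_norm rinnerDl !rinnerDr (rinnerC eta) !rinner_norm.
by have := rinner_cauchy xi eta; rewrite ler_norml; lra.
Qed.

Lemma l2normB xi eta : l2norm (xi - eta) <= l2norm xi + l2norm eta.
Proof. by rewrite -(l2normN eta) l2normD. Qed.

(** Multiplying eta by the inner product reduces the inequality to the real
one. *)
Lemma inner_cauchy xi eta : modulus (inner xi eta) <= l2norm xi * l2norm eta.
Proof.
set z := inner xi eta; have [z0|z0] := eqVneq z 0.
  by rewrite z0 Normc.normc0 mulr_ge0 ?l2norm_ge0.
have m0 : 0 < modulus z.
  by rewrite lt0r modulus_ge0 andbT; apply: contraNneq z0 => /Normc.eq0_normc ->.
rewrite -(ler_pM2l m0) -expr2.
have := rinner_cauchy xi (z *: eta); rewrite l2normZ mulrCA => /(le_trans _); apply.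
apply: le_trans (ler_norm _).
by rewrite /rinner innerZr -/z sqr_modulus; case: z {z0 m0} => a b /=; lra.
Qed.

(** * Truncations of square summable families *)

Lemma square_summable_restrict (A : pred G) xi :
  (fun g => if A g then xi g else 0) \in @square_summable R G.
Proof.
rewrite unfold_in /square_summable; apply: le_lt_trans (ell2P xi).
apply: le_esum => g _; rewrite lee_fin; case: ifP => // _.
by rewrite Normc.normc0 expr0n sqr_ge0.
Qed.

Definition ell2_restrict (A : pred G) xi : ell2 R G :=
  Ell2 (square_summable_restrict A xi).

(** Stated for all supersets of s, so that it applies to balls. *)
Lemma ell2_finite_approx xi (e : R) : 0 < e -> exists s : seq G,
  forall A : pred G, {subset s <= A} -> l2norm (xi - ell2_restrict A xi) < e.
Proof.
move=> e0; set S := (\esum_(g in [set: G]) (modulus (xi g) ^+ 2)%:E)%E.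
have Sfin : (S \is a fin_num)%E.
  apply: (@fin_esum_ge0 _ _ (fun g => modulus (xi g) ^+ 2)) => [g|].
    exact: sqr_ge0.
  exact: ell2_rsummable.
have e2 : 0 < e ^+ 2 by rewrite exprn_gt0.
have [_ [F [finF _] <-] HF] := ub_ereal_sup_adherent e2 Sfin.
have S0 g : (0 <= (modulus (xi g) ^+ 2)%:E)%E by rewrite lee_fin sqr_ge0.
have SE : S = (\sum_(i \in F) (modulus (xi i) ^+ 2)%:E +
    \esum_(g in ~` F) (modulus (xi g) ^+ 2)%:E)%E.
  by rewrite /S (esumID F)//= !setTI esum_fset.
have Ffin : (\sum_(i \in F) (modulus (xi i) ^+ 2)%:E \is a fin_num)%E.
  by rewrite fsumEFin.
have tail : (\esum_(g in ~` F) (modulus (xi g) ^+ 2)%:E < (e ^+ 2)%:E)%E.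
  by have : (S - (e ^+ 2)%:E < \sum_(i \in F) (modulus (xi i) ^+ 2)%:E)%E := HF;
    rewrite SE lteBlDr// lteD2lE.
exists (finmap.enum_fset (fset_set F)) => A sA.
rewrite -ltr_sqr ?nnegrE ?l2norm_ge0 1?ltW// sqr_l2norm -lte_fin.
apply: le_lt_trans tail; rewrite fineK; last first.
  apply: (@fin_esum_ge0 _ _ (fun g => modulus ((xi - ell2_restrict A xi) g) ^+ 2)).
    by move=> g; rewrite sqr_ge0.
  exact: ell2_rsummable.
rewrite [leRHS]esum_mkcond; apply: le_esum => g _; rewrite ell2_addE ell2_oppE /=.
case: (boolP (A g)) => [_|nA].
  by rewrite subrr Normc.normc0 expr0n; case: ifP => _; rewrite ?lee_fin ?sqr_ge0.
rewrite subr0 ifT// inE => Fg; case/negP: nA; apply: (sA g).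
by rewrite in_fset_set// inE.
Qed.

Lemma sum_deltaE (s : seq G) (F : G -> R[i]) h : uniq s ->
  (\sum_(g <- s) F g *: delta R g) h = if h \in s then F h else 0.
Proof.
move=> us; rewrite ell2_sumE.
under eq_bigr do rewrite ell2_scaleE deltaE.
case: ifPn => hs.
  rewrite (big_rem h hs) /= eqxx mulr1 big_seq big1 ?addr0// => g.
  by rewrite mem_rem_uniq// inE eq_sym => /andP[/negbTE -> _]; rewrite mulr0.
rewrite big_seq big1// => g gs; case: eqP => [hg|]; rewrite ?mulr0//.
by move: hs; rewrite hg gs.
Qed.

Lemma ell2_restrict_seq (s : seq G) xi : uniq s ->
  ell2_restrict (mem s) xi = \sum_(g <- s) xi g *: delta R g.
Proof. by move=> us; apply: ell2_eqP => h; rewrite sum_deltaE. Qed.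

Lemma ell2_seq_approx xi (e : R) : 0 < e -> exists2 s : seq G, uniq s &
  l2norm (xi - \sum_(g <- s) xi g *: delta R g) < e.
Proof.
move=> /(ell2_finite_approx xi)[s Hs]; exists (undup s); first exact: undup_uniq.
by rewrite -ell2_restrict_seq ?undup_uniq//; apply: Hs => g; rewrite -topredE/= mem_undup.
Qed.

Lemma l2norm_small xi : (forall e : R, 0 < e -> l2norm xi <= e) -> xi = 0.
Proof.
move=> h; apply: l2norm0_eq0; apply/eqP; rewrite eq_le l2norm_ge0 andbT.
by apply/ler_addgt0Pl => e e0; rewrite addr0 h.
Qed.

End InnerProduct.

(** * Bounded operators and adjoints *)

Section Operators.
Variables (R : realType) (G : choiceType).
Implicit Types (T S : operator R G) (xi eta : ell2 R G).

Lemma linD T xi eta : linear T -> T (xi + eta) = T xi + T eta.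
Proof. by move=> /(_ 1 xi eta); rewrite !scale1r. Qed.

Lemma lin0 T : linear T -> T 0 = 0.
Proof. by move=> lT; apply: (addrI (T 0)); rewrite -linD// !addr0. Qed.

Lemma linZ T (c : R[i]) xi : linear T -> T (c *: xi) = c *: T xi.
Proof. by move=> lT; have := lT c xi 0; rewrite (lin0 lT) !addr0. Qed.

Lemma linN T xi : linear T -> T (- xi) = - T xi.
Proof. by move=> lT; rewrite -scaleN1r linZ// scaleN1r. Qed.

Lemma linB T xi eta : linear T -> T (xi - eta) = T xi - T eta.
Proof. by move=> lT; rewrite linD// linN. Qed.

Lemma lin_sum T I (r : seq I) (P : pred I) (F : I -> ell2 R G) : linear T ->
  T (\sum_(i <- r | P i) F i) = \sum_(i <- r | P i) T (F i).
Proof.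
move=> lT; elim/big_ind2 : _ => [|x1 x2 y1 y2 <- <-|//]; first exact: lin0.
exact: linD.
Qed.

Lemma bounded_operatorW T : bounded_operator T ->
  exists2 c : R, 0 <= c & forall xi, l2norm (T xi) <= c * l2norm xi.
Proof.
move=> [_ [c hc]]; exists `|c| => // xi; apply: le_trans (hc xi) _.
by rewrite ler_wpM2r ?l2norm_ge0// ler_norm.
Qed.

Lemma opnormP T xi : bounded_operator T -> l2norm (T xi) <= opnorm T * l2norm xi.
Proof.
move=> bT; have [c c0 hc] := bounded_operatorW bT.
have [n0|n0] := eqVneq (l2norm xi) 0.
  by have := hc xi; rewrite n0 !mulr0.
have n1 : 0 < l2norm xi by rewrite lt0r n0 l2norm_ge0.
rewrite -ler_pdivrMr//; apply: lb_le_inf; first by exists c.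
by move=> d [d0 hd]; rewrite ler_pdivrMr.
Qed.

Lemma opnorm_le T (c : R) : 0 <= c ->
  (forall xi, l2norm (T xi) <= c * l2norm xi) -> opnorm T <= c.
Proof.
move=> c0 hc; apply: ge_inf; last by split.
by exists 0 => d [].
Qed.

Lemma opnorm_ge0 T : 0 <= opnorm T.
Proof.
rewrite /opnorm; set S := [set c | _]; have [->|/set0P[c Sc]] := eqVneq S set0.
  by rewrite inf0.
by apply: lb_le_inf; [exists c|move=> d []].
Qed.

Lemma op_linE c T S xi : (c *: T + S) xi = c *: T xi + S xi. Proof. by []. Qed.

Lemma bounded_operatorD (c : R[i]) T S :
  bounded_operator T -> bounded_operator S -> bounded_operator (c *: T + S).
Proof.
move=> bT bS; have [a a0 ha] := bounded_operatorW bT.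
have [b b0 hb] := bounded_operatorW bS; split.
  move=> k x y; rewrite !op_linE (bT.1 k x y) (bS.1 k x y) !scalerDr.
  by rewrite !scalerA (mulrC c) !addrA; congr (_ + _); rewrite -!addrA; congr (_ + _); rewrite addrC.
exists (modulus c * a + b) => xi; rewrite op_linE mulrDl.
apply: le_trans (l2normD _ _) _; apply: lerD => //.
by rewrite l2normZ -mulrA ler_wpM2l ?modulus_ge0.
Qed.

Lemma bounded_operator_comp T S :
  bounded_operator T -> bounded_operator S -> bounded_operator (T \o S).
Proof.
move=> bT bS; have [a a0 ha] := bounded_operatorW bT.
have [b b0 hb] := bounded_operatorW bS; split.
  by move=> k x y /=; rewrite bS.1 bT.1.
exists (a * b) => xi /=; apply: le_trans (ha _) _.
by rewrite -mulrA ler_wpM2l.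
Qed.

Lemma bounded_operator_id : bounded_operator (idfun : operator R G).
Proof. by split => [k x y //|]; exists 1 => xi; rewrite mul1r. Qed.

Lemma is_adjoint_unique T S1 S2 : is_adjoint T S1 -> is_adjoint T S2 -> S1 = S2.
Proof.
move=> h1 h2; apply/funext => eta; apply: ell2_eqP => g.
by rewrite -!inner_deltar !(inner_conj (delta R g)) -h1 -h2.
Qed.

Lemma adjoint_eq T S : is_adjoint T S -> adjoint T = S.
Proof.
by move=> h; apply: (@is_adjoint_unique T) => //; apply: (xgetPex 0); exists S.
Qed.

Lemma is_adjointC T S : is_adjoint T S -> is_adjoint S T.
Proof. by move=> h xi eta; rewrite inner_conj -h -inner_conj. Qed.

(** The matrix of the adjoint is read off from the images of the basis
vectors; boundedness makes its columns square summable. *)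
Lemma adjoint_column_summable T eta : bounded_operator T ->
  (fun g => conjc (inner (T (delta R g)) eta)) \in @square_summable R G.
Proof.
move=> bT; have [c c0 hc] := bounded_operatorW bT.
pose a g := inner (T (delta R g)) eta.
rewrite unfold_in /square_summable.
apply: (@le_lt_trans _ _ ((c * l2norm eta) ^+ 2)%:E); last exact: ltry.
apply: ge_ereal_sup => _ [A [fA _] <-].
rewrite fsbig_finite// sumEFin lee_fin.
set s := finmap.enum_fset (fset_set A).
have us : uniq s by exact: finmap.fset_uniq.
pose v : ell2 R G := \sum_(g <- s) conjc (a g) *: delta R g.
set Q : R := \sum_(i <- s) modulus (conjc (a i)) ^+ 2.
change (Q <= (c * l2norm eta) ^+ 2).
have vE g : g \in s -> v g = conjc (a g).
  by move=> gs; rewrite /v sum_deltaE// gs.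
have mE z : conjc z * z = (modulus (conjc z) ^+ 2)%:C :> R[i].
  by rewrite sqr_modulus; case: z => x y; rewrite /= [LHS]/GRing.mul /=; congr (_ +i* _); ring.
have QE : inner (T v) eta = Q%:C.
  rewrite lin_sum; last exact: bT.1.
  rewrite inner_suml rmorph_sum; apply: eq_bigr => g _.
  by rewrite (linZ _ _ bT.1) innerZl; exact: mE.
have vv : l2norm v ^+ 2 = Q.
  apply: complexI; rewrite -inner_l2norm {1}/v inner_suml rmorph_sum.
  rewrite big_seq [RHS]big_seq; apply: eq_bigr => g gs.
  by rewrite innerZl inner_conj inner_deltar (vE g gs) conjcK; exact: mE.
have Q0 : 0 <= Q by rewrite sumr_ge0// => g _; rewrite sqr_ge0.
have QQ : Q <= c * l2norm v * l2norm eta.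
  have : rinner (T v) eta = Q by rewrite /rinner QE.
  move=> <-; apply: le_trans (ler_norm _) _; apply: le_trans (rinner_cauchy _ _) _.
  by rewrite ler_wpM2r ?l2norm_ge0.
have [v0|vn0] := eqVneq (l2norm v) 0; first by rewrite -vv v0 expr0n sqr_ge0.
have vp : 0 < l2norm v by rewrite lt0r vn0 l2norm_ge0.
rewrite -vv ler_sqr ?nnegrE ?mulr_ge0 ?l2norm_ge0//.
by rewrite -(ler_pM2l vp) -expr2 vv mulrCA mulrA.
Qed.

Lemma is_adjointP T : bounded_operator T -> is_adjoint T (adjoint T).
Proof.
move=> bT; have [c c0 hc] := bounded_operatorW bT.
pose S eta : ell2 R G := Ell2 (adjoint_column_summable eta bT).
suff TS : is_adjoint T S by rewrite (adjoint_eq TS).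
move=> xi eta; apply/eqP; rewrite -subr_eq0.
suff : modulus (inner (T xi) eta - inner xi (S eta)) = 0 by move=> /Normc.eq0_normc ->.
apply/eqP; rewrite eq_le modulus_ge0 andbT.
set k := c * l2norm eta + l2norm (S eta).
have k0 : 0 <= k by rewrite addr_ge0 ?mulr_ge0 ?l2norm_ge0.
apply/ler_addgt0Pl => e e0; rewrite addr0.
have e1 : 0 < e / (k + 1) by rewrite divr_gt0// ltr_wpDl.
have [s us hs] := ell2_seq_approx xi e1.
set y := \sum_(g <- s) _ in hs.
have yS : inner (T y) eta = inner y (S eta).
  rewrite lin_sum; last exact: bT.1.
  rewrite !inner_suml; apply: eq_bigr => g _; rewrite linZ; last exact: bT.1.
  rewrite !innerZl [in RHS]inner_conj inner_deltar.
  by rewrite (_ : S eta g = conjc (inner (T (delta R g)) eta))// conjcK.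
have -> : inner (T xi) eta - inner xi (S eta) =
    inner (T (xi - y)) eta + inner (- (xi - y)) (S eta).
  rewrite linB; last exact: bT.1.
  rewrite innerNl !innerDl !innerNl yS; ring.
apply: le_trans (le_normcD _ _) _.
apply: (@le_trans _ _ (k * l2norm (xi - y))).
  rewrite mulrDl; apply: lerD; apply: le_trans (inner_cauchy _ _) _.
    by rewrite mulrAC ler_wpM2r ?l2norm_ge0.
  by rewrite l2normN mulrC.
apply: (@le_trans _ _ (k * (e / (k + 1)))); first by rewrite ler_wpM2l// ltW.
by rewrite mulrCA -[leRHS]mulr1 ler_wpM2l 1?ltW// ltr_pdivrMr ?ltr_wpDl// mul1r ltrDl.
Qed.

Lemma is_adjoint_bounded T S : bounded_operator T -> is_adjoint T S ->
  bounded_operator S.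
Proof.
move=> bT h; have [c c0 hc] := bounded_operatorW bT; split.
  move=> k x y; apply: ell2_eqP => g.
  rewrite ell2_addE ell2_scaleE -!inner_deltar !(inner_conj (delta R g)) -!h.
  by rewrite innerDr innerZr conjcD conjcM conjcK.
exists c => xi; have [->|n0] := eqVneq (l2norm (S xi)) 0.
  by rewrite mulr_ge0 ?l2norm_ge0.
have np : 0 < l2norm (S xi) by rewrite lt0r n0 l2norm_ge0.
rewrite -(ler_pM2l np) -expr2 -rinner_norm /rinner -h.
apply: le_trans (ler_norm _) _; apply: le_trans (rinner_cauchy _ _) _.
by rewrite mulrA ler_wpM2r ?l2norm_ge0// mulrC.
Qed.

Lemma adjoint_bounded T : bounded_operator T -> bounded_operator (adjoint T).
Proof. by move=> bT; apply: (is_adjoint_bounded bT); exact: is_adjointP. Qed.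

End Operators.

(** * Sums over words *)

Section WordSums.
Variables (N : nat) (V : zmodType).
Implicit Types f : seq (letter N) -> V.

(** Recursion on the length lets sums over words be split letter by letter;
reducedness enters as a factor 0 or 1 of the summand. *)
Fixpoint sumw n f : V :=
  if n is m.+1 then \sum_(x : letter N) sumw m (fun w => f (x :: w)) else f [::].

Lemma eq_sumw n f1 f2 : (forall w, size w = n -> f1 w = f2 w) ->
  sumw n f1 = sumw n f2.
Proof.
elim: n f1 f2 => [|n IH] f1 f2 e /=; first exact: e.
by apply: eq_bigr => x _; apply: IH => w sw; apply: e; rewrite /= sw.
Qed.

Lemma sumwD n f1 f2 : sumw n (fun w => f1 w + f2 w) = sumw n f1 + sumw n f2.
Proof.
elim: n f1 f2 => [//|n IH] f1 f2 /=; rewrite -big_split /=.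
by apply: eq_bigr => x _; rewrite IH.
Qed.

Lemma sumw0 n : sumw n (fun=> 0) = 0.
Proof. by elim: n => [//|n IH] /=; rewrite big1. Qed.

Lemma sumwN n f : sumw n (fun w => - f w) = - sumw n f.
Proof.
elim: n f => [//|n IH] f /=; rewrite -sumrN.
by apply: eq_bigr => x _; rewrite IH.
Qed.

Lemma sumwMn n f k : sumw n f *+ k = sumw n (fun w => f w *+ k).
Proof.
elim: n f => [//|n IH] f /=; rewrite -sumrMnl.
by apply: eq_bigr => x _; rewrite IH.
Qed.

Lemma sumw_sum n (I : Type) (r : seq I) (P : pred I) (F : I -> seq (letter N) -> V) :
  sumw n (fun w => \sum_(i <- r | P i) F i w) = \sum_(i <- r | P i) sumw n (F i).
Proof.
elim: n F => [//|n IH] F /=; rewrite exchange_big /=.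
by apply: eq_bigr => x _; rewrite IH.
Qed.

Lemma sumw_cat n p f :
  sumw (n + p) f = sumw n (fun u => sumw p (fun v => f (u ++ v))).
Proof. by elim: n f => [//|n IH] f /=; apply: eq_bigr => x _; rewrite IH. Qed.

Lemma sumw_single n (w0 : seq (letter N)) (c : V) :
  sumw n (fun w => c *+ (w == w0)) = c *+ (size w0 == n).
Proof.
elim: n w0 => [|n IH] w0 /=; first by case: w0.
case: w0 => [|x0 w0].
  by rewrite (eq_bigr (fun=> 0)) ?big1_eq// => x _; rewrite -[RHS](sumw0 n); apply: eq_sumw.
rewrite (bigD1 x0)//= big1 ?addr0 => [|x xx].
  by rewrite -[eqbRHS]/(n.+1) eqSS -IH; apply: eq_sumw => w _; rewrite eqseq_cons eqxx.
by rewrite -[RHS](sumw0 n); apply: eq_sumw => w _; rewrite eqseq_cons (negbTE xx).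
Qed.

End WordSums.

Lemma sumw_morph N (V W : zmodType) (phi : V -> W) n (f : seq (letter N) -> V) :
  phi 0 = 0 -> {morph phi : x y / x + y} -> phi (sumw n f) = sumw n (phi \o f).
Proof.
move=> p0 pD; elim: n f => [//|n IH] f /=.
by rewrite (big_morph phi pD p0); apply: eq_bigr => x _; rewrite IH.
Qed.

Section WordSumsReal.
Variables (N : nat) (R : realType).

Lemma ler_norm_sumw n (f g : seq (letter N) -> R) :
  (forall w, size w = n -> `|f w| <= g w) -> `|sumw n f| <= sumw n g.
Proof.
elim: n f g => [|n IH] f g h /=; first exact: h.
apply: le_trans (ler_norm_sum _ _ _) _; apply: ler_sum => x _.
by apply: IH => w sw; apply: h; rewrite /= sw.
Qed.

Lemma sumw_const n (c : R) : sumw n (fun _ : seq (letter N) => c) = ((2 * N) ^ n)%:R * c.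
Proof.
elim: n => [|n IH] /=; first by rewrite mul1r.
rewrite sumr_const card_prod card_ord card_bool IH -mulrnAl -mulr_natr -natrM.
by rewrite expnS mulnC (mulnC N).
Qed.

End WordSumsReal.

Lemma sumwMl N (R : pzRingType) n (f : seq (letter N) -> R) c :
  c * sumw n f = sumw n (fun w => c * f w).
Proof. by apply: (sumw_morph (phi := *%R c)); [exact: mulr0|exact: mulrDr]. Qed.

Arguments reduced : simpl never.

(** * Reduced words and spheres in the free group *)

Section FreeGroupWords.
Variable N : nat.
Implicit Types (g h : free_group N) (x y : letter N) (w u v : seq (letter N)).

Definition letg x : free_group N := @FreeGroup N [:: x] isT.

Definition wprod w : free_group N := foldr (fun x g => letg x * g)%g 1%g w.

Lemma word_mul g h : word (g * h)%g = foldr (@lcons N) (word h) (word g).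
Proof. by []. Qed.

Lemma wprod_cons x w : wprod (x :: w) = (letg x * wprod w)%g. Proof. by []. Qed.

Lemma word_wprod_mul w g : word (wprod w * g)%g = foldr (@lcons N) (word g) w.
Proof.
elim: w => [|x w IH]; first by rewrite [wprod _]/(1%g) mul1g.
by rewrite wprod_cons -mulgA word_mul IH.
Qed.

Lemma word_wprod w : reduced w -> word (wprod w) = w.
Proof. by move=> rw; rewrite -[wprod w]mulg1 word_wprod_mul foldr_lcons_nil. Qed.

Lemma wprod_word g : wprod (word g) = g.
Proof. by apply: val_inj; rewrite /= word_wprod// reducedP. Qed.

Lemma letg_linv x : letg (linv x) = (letg x)^-1%g.
Proof. exact: val_inj. Qed.

Lemma word_letg_mul x g : word (letg x * g)%g = lcons x (word g).
Proof. by []. Qed.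

Lemma word_inv g : word g^-1%g = rev (map (@linv N) (word g)).
Proof. by []. Qed.

Lemma size_word_inv g : size (word g^-1%g) = size (word g).
Proof. by rewrite word_inv size_rev size_map. Qed.

Lemma reduced_cons x w : reduced (x :: w) = reduced w && (if w is y :: _ then y != linv x else true).
Proof. by case: w => //= y w; rewrite andbC. Qed.

Lemma linv_inj : injective (@linv N).
Proof. exact: inv_inj (@linvK N). Qed.

Definition gen_count (n : nat) : nat := if n is 0 then (2 * N)%N else (2 * N).-1.

Lemma card_letter : #|{: letter N}| = (2 * N)%N.
Proof. by rewrite card_prod card_ord card_bool mulnC. Qed.

(** Every letter may be put in front of w, except the inverse of its first one. *)
Lemma sum_prolong (V : zmodType) (c : V) w : reduced w ->
  \sum_(x : letter N) c *+ reduced (x :: w) = c *+ gen_count (size w).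
Proof.
move=> rw; rewrite sumrMnr; congr (_ *+ _).
case: w rw => [|y w] rw.
  by rewrite (eq_bigr (fun=> 1%N))// sum1_card card_letter.
rewrite (bigD1 (linv y))//= reduced_cons linvK eqxx andbF add0n.
rewrite (eq_bigr (fun=> 1%N)); last first.
  move=> x xy; rewrite reduced_cons rw (_ : _ != _)//.
  by apply: contra xy => /eqP ->; rewrite linvK.
by rewrite sum1_card cardC1 card_letter.
Qed.

End FreeGroupWords.

Section SphereSums.
Variables (N : nat) (V : zmodType).
Implicit Types (f : free_group N -> V) (g h : free_group N).

Definition lap f : free_group N -> V := fun h => \sum_(x : letter N) f (letg x * h)%g.

(** Left convolution by the indicator of the sphere of radius n. *)
Definition sphere n f : free_group N -> V :=
  fun h => sumw n (fun w => f (wprod w * h)%g *+ reduced w).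

Lemma sphere0 f : sphere 0 f = f.
Proof. by apply/funext => h; rewrite /sphere /= mul1g. Qed.

Lemma sphere1 f : sphere 1 f = lap f.
Proof.
by apply/funext => h; rewrite /sphere /lap /=; apply: eq_bigr => x _; rewrite mulg1.
Qed.

(** A letter placed in front of a reduced word either prolongs it or cancels
its first letter. *)
Lemma sphereS n f h :
  sphere n.+2 f h = sphere n.+1 (lap f) h - sphere n f h *+ gen_count N n.
Proof.
apply/eqP; rewrite eq_sym subr_eq eq_sym; apply/eqP.
have -> : sphere n f h *+ gen_count N n = sumw n (fun w =>
    \sum_(y : letter N) (f (wprod w * h)%g *+ reduced w) *+ reduced (y :: w)).
  rewrite /sphere sumwMn; apply: eq_sumw => w sw; case rw : (reduced w).
    by rewrite sum_prolong// sw.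
  by rewrite mulr0n mul0rn big1// => y _; rewrite mul0rn.
rewrite sumw_sum {1}/sphere /= exchange_big /= -big_split /=.
apply: eq_bigr => y _.
rewrite -sumw_sum -sumwD; apply: eq_sumw => w _.
case ryw : (reduced (y :: w)); last first.
  rewrite !mulr0n addr0 big1// => x _.
  by rewrite reduced_cons ryw.
have rw : reduced w by move: ryw; rewrite reduced_cons => /andP[].
rewrite rw !mulr1n /lap [RHS](bigD1 (linv y))//= addrC letg_linv -!mulgA mulKg.
congr (_ + _); rewrite (bigD1 (linv y))//=.
rewrite reduced_cons linvK eqxx andbF mulr0n add0r.
apply: eq_bigr => x xy; rewrite reduced_cons ryw (_ : y != linv x) ?mulr1n -?mulgA//.
by apply: contra xy => /eqP ->; rewrite linvK.
Qed.

End SphereSums.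

(** * Radial functions *)

Section Radial.
Variables (N : nat) (V : zmodType).
Implicit Types (f : free_group N -> V) (g h : free_group N).

Definition radial f := exists phi : nat -> V, forall g, f g = phi (size (word g)).

Lemma radial_lap f : radial f -> radial (lap f).
Proof.
move=> [phi E]; exists (fun n => if n is m.+1 then phi m + phi m.+2 *+ (2 * N).-1
                                 else phi 1 *+ (2 * N)) => g.
rewrite /lap; under eq_bigr do rewrite E word_letg_mul.
case: (word g) (reducedP g) => [|y w] rw /=.
  by rewrite sumr_const card_prod card_ord card_bool mulnC.
rewrite (bigD1 (linv y))//= linvK eqxx; congr (_ + _).
rewrite (eq_bigr (fun=> phi (size w).+2)); first by rewrite sumr_const cardC1 card_letter.
move=> x xy; rewrite ifN//; apply: contra xy => /eqP ->; by rewrite linvK.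
Qed.

(** The Laplacian preserves radial functions and generates the spheres through
sphereS. *)
Lemma radial_sphere n f : radial f -> radial (sphere n f).
Proof.
suff: forall f, radial f -> radial (sphere n f) /\ radial (sphere n.+1 f).
  by move=> H rf; have [] := H f rf.
elim: n => [|n IH] {}f rf; first by rewrite sphere0 sphere1; split=> //; exact: radial_lap.
split; first by have [] := IH f rf.
have [[p pE] _] := IH f rf; have [_ [r rE]] := IH _ (radial_lap rf).
exists (fun m => r m - p m *+ gen_count N n) => g.
by rewrite sphereS pE rE.
Qed.

End Radial.

(** * Cancellation in products of long words *)

Section Cancellation.
Variable N : nat.
Implicit Types (g h : free_group N) (x y : letter N) (w u v : seq (letter N)).

Lemma size_foldr_lcons u v :
  (size v - size u <= size (foldr (@lcons N) v u))%N.
Proof.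
elim: u => [|x u IH] /=; first by rewrite subn0.
have : (size (foldr (@lcons N) v u) <= (size (lcons x (foldr (@lcons N) v u))).+1)%N.
  case: (foldr _ _ _) => //= y s; case: ifP => _ //=; lia.
lia.
Qed.

(** Each letter of w cancels at most one letter of u, so that cancellation never
reaches v. *)
Lemma foldr_lcons_cat w u v : (size w <= size u)%N ->
  foldr (@lcons N) (u ++ v) w = foldr (@lcons N) u w ++ v.
Proof.
elim: w => [//|x w IH] /= sw; rewrite IH; last exact: ltnW.
have := size_foldr_lcons w u.
case: (foldr _ _ _) => [|y s] /= H; first lia.
by case: ifP.
Qed.

Lemma size_word_sandwich g h u z v :
  reduced (u ++ z ++ v) -> (size (word g) <= size u)%N -> (size (word h) <= size v)%N ->
  size (word (g * wprod (u ++ z ++ v) * h)%g) =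
  (size (word (g * wprod u)%g) + size z + size (word (wprod v * h)%g))%N.
Proof.
move=> rw gu hv.
have [ru rv] : reduced u /\ reduced v.
  by split; move: rw; rewrite /reduced; [move=> /cat_sorted2[]|rewrite catA => /cat_sorted2[]].
have E1 : word (g * wprod (u ++ z ++ v))%g = word (g * wprod u)%g ++ z ++ v.
  by rewrite !word_mul !word_wprod// foldr_lcons_cat.
move: E1; set W := (g * _)%g => E1.
rewrite -size_word_inv invgM (word_mul h^-1%g) (word_inv W) E1.
rewrite !map_cat !rev_cat -catA foldr_lcons_cat; last first.
  by rewrite size_word_inv size_rev size_map.
rewrite !size_cat !size_rev !size_map -(size_word_inv (wprod v * h)%g) invgM (word_mul h^-1%g).
by rewrite (word_inv (wprod v)) word_wprod// addnC (addnC (size z)).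
Qed.

(** The coefficient of the all-one matrix J in (J - P)^(p+1), where P is the
permutation matrix of the inversion of letters. *)
Fixpoint path_count (p : nat) : int :=
  if p is p'.+1 then (2 * N).-1%:Z * path_count p' + (-1) ^+ p else 1.

(** The matrix of admissible successors of a letter is J - P in the notation
above.  As J P = P J = J, its powers are a multiple of J up to a power of - P:
the number of reduced words between two prescribed letters hardly depends on
these letters. *)
Lemma sumw_path (R : realType) p x y :
  sumw p (fun w => (path (fun a b => b != linv a) x (rcons w y))%:R) =
  (path_count p)%:~R + (-1) ^+ p.+1 * (y == iter p.+1 (@linv N) x)%:R :> R.
Proof.
elim: p x => [|p IH] x /=.
  by rewrite andbT expr1 mulN1r; case: eqP => _ /=; rewrite ?subrr ?subr0.
rewrite (eq_bigr (fun x' => (x' != linv x)%:R *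
   sumw p (fun w => (path (fun a b => b != linv a) x' (rcons w y))%:R))); last first.
  move=> x' _; rewrite sumwMl; apply: eq_sumw => w _.
  by rewrite /= -mulnb natrM.
have iterK k a : iter k (@linv N) (iter k (@linv N) a) = a.
  by elim: k a => // k IHk a; rewrite iterSr iterS linvK.
have flip k a b : (b == iter k (@linv N) a) = (a == iter k (@linv N) b).
  by apply/eqP/eqP => ->; rewrite iterK.
rewrite (eq_bigr (fun x' => (path_count p)%:~R + (-1) ^+ p.+1 * (y == iter p.+1 (@linv N) x')%:R
   - (x' == linv x)%:R * ((path_count p)%:~R + (-1) ^+ p.+1 * (y == iter p.+1 (@linv N) x')%:R))); last first.
  by move=> x' _; rewrite IH; case: eqP => _ /=; ring.
rewrite sumrB big_split /= sumr_const card_letter -mulr_sumr.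
have -> : \sum_(i : letter N) (y == linv (iter p (@linv N) i))%:R = 1 :> R.
  rewrite (bigD1 (iter p.+1 (@linv N) y))//= -iterS flip eqxx big1 ?addr0// => i /negbTE iy.
  by rewrite -iterS flip iy.
rewrite (bigD1 (linv x))//= eqxx big1 ?addr0 => [|i /negbTE ->]; last by rewrite mul0r.
have N0 : (0 < N)%N by case: N x => [[[]]|].
rewrite -!iterS -iterSr rmorphD rmorphM /= rmorphXn /= rmorphN1 [(-1) ^+ p.+2]exprS.
rewrite -[X in _ *+ X]prednK ?muln_gt0// mulrS -mulr_natl -pmulrn; ring.
Qed.
End Cancellation.

Lemma sumw_exchange N (V : zmodType) n p (f : seq (letter N) -> seq (letter N) -> V) :
  sumw n (fun u => sumw p (fun v => f u v)) = sumw p (fun v => sumw n (fun u => f u v)).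
Proof.
elim: n f => [//|n IH] f /=; rewrite sumw_sum; apply: eq_bigr => x _; exact: IH.
Qed.

Section Coefficients.
Variables (R : realType) (N : nat).
Hypothesis N0 : (0 < N)%N.
Implicit Types (g h : free_group N) (u v w z : seq (letter N)).

(** The number of elements z of length n with g^-1 z h of length m. *)
Definition coef n m g : free_group N -> R :=
  sphere n (fun k => (size (word (g^-1 * k)%g) == m)%:R).

Lemma reduced_cat3 (x0 : letter N) u z v : (0 < size u)%N -> (0 < size v)%N ->
  reduced (u ++ z ++ v) = [&& reduced u, reduced v &
    path (fun a b => b != linv a) (last x0 u) (rcons z (head x0 v))].
Proof.
case: u v => [//|x u] [//|y v] _ _; rewrite /reduced /= cat_path cat_path rcons_path /=.
by case: (path _ x u) => //=; case: (path _ y v) => //=; rewrite ?andbT ?andbF.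
Qed.

Lemma coef_bound n m g h : `|coef n m g h| <= ((2 * N) ^ n)%:R.
Proof.
rewrite -[leRHS]mulr1 -(sumw_const _ n); apply: ler_norm_sumw => w _.
by case: (reduced w); rewrite ?mulr1n ?mulr0n ?normr0//; case: eqP => _; rewrite ?normr1 ?normr0.
Qed.

(** Cut a long z as z1 z2 z3 with z1 and z3 of length K.  Both cancellations
take place inside z1 and z3, and the number of admissible z2 depends on z1 and
z3 only up to an error of size one; without that error the count would be
a radial function of h. *)
Lemma coef_near_radial K n m g : (0 < K)%N -> (size (word g) <= K)%N ->
  exists2 Psi : free_group N -> R, radial Psi &
  forall h, (size (word h) <= K)%N ->
    `|coef n m g h - Psi h| <= ((2 * N) ^ (K + K))%:R.
Proof.
move=> K0 gK; have [nK|nK] := ltnP n (K + K).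
  exists (fun=> 0) => [|h _]; first by exists (fun=> 0).
  rewrite subr0; apply: le_trans (coef_bound _ _ _ _) _.
  by rewrite ler_nat leq_pexp2l ?muln_gt0// ltnW.
pose p := (n - (K + K))%N; have -> : n = (K + (p + K))%N by rewrite /p; lia.
pose x0 : letter N := (Ordinal N0, true).
pose A : R := (path_count N p)%:~R; pose s : R := (-1) ^+ p.+1.
pose E z1 z3 h : R := (size (word (g^-1 * wprod z1)%g) + p +
  size (word (wprod z3 * h)%g) == m)%:R *+ reduced z1 *+ reduced z3.
pose D l : R := sumw K (fun z1 =>
  (size (word (g^-1 * wprod z1)%g) + p + l == m)%:R *+ reduced z1).
exists (fun h => A * sphere K (fun k => D (size (word k))) h).
  have rD : radial (fun k : free_group N => D (size (word k))) by exists D.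
  by have [phi phiE] := radial_sphere K rD; exists (fun l => A * phi l) => h; rewrite phiE.
move=> h hK.
have -> : coef (K + (p + K)) m g h = sumw K (fun z1 => sumw K (fun z3 =>
    E z1 z3 h * (A + s * (head x0 z3 == iter p.+1 (@linv N) (last x0 z1))%:R))).
  rewrite /coef /sphere sumw_cat; apply: eq_sumw => z1 s1; rewrite sumw_cat sumw_exchange.
  apply: eq_sumw => z3 s3; rewrite -sumw_path sumwMl; apply: eq_sumw => z2 s2.
  rewrite mulgA; case rw : (reduced (z1 ++ z2 ++ z3)).
    rewrite size_word_sandwich ?size_word_inv ?s1 ?s3// s2.
    move: rw; rewrite (reduced_cat3 x0) ?s1 ?s3// /E => /and3P[-> -> ->].
    by rewrite !mulr1n mulr1.
  move: rw; rewrite (reduced_cat3 x0) ?s1 ?s3// /E.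
  rewrite mulr0n; case: (reduced z1) => /=; last by rewrite mulr0n mul0rn mul0r.
  by case: (reduced z3) => /= [->|_]; rewrite ?mulr0n ?mulr0 ?mul0r.
rewrite (_ : sphere _ _ h = sumw K (fun z1 => sumw K (fun z3 => E z1 z3 h))); last first.
  by rewrite sumw_exchange /sphere; apply: eq_sumw => z3 _; rewrite /D sumwMn.
rewrite sumwMl -sumwN -sumwD.
rewrite (@eq_sumw _ _ _ _ (fun z1 => sumw K (fun z3 =>
   E z1 z3 h * (s * (head x0 z3 == iter p.+1 (@linv N) (last x0 z1))%:R)))); last first.
  move=> z1 _; rewrite sumwMl -sumwN -sumwD; apply: eq_sumw => z3 _; ring.
rewrite expnD natrM -sumw_const; apply: ler_norm_sumw => z1 _.
rewrite -[leRHS]mulr1 -(sumw_const N); apply: ler_norm_sumw => z3 _.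
rewrite /E /s normrM normrM normrX normrN1 expr1n mul1r.
by rewrite -!mulrnA !normr_nat -natrM (ler_nat _ _ 1) !mulnb leq_b1.
Qed.

End Coefficients.

(** * Translations and the modular conjugation *)

Section GroupOperators.
Variables (R : realType) (G : groupType).
Implicit Types (xi eta : ell2 R G) (x g : G).
Local Notation J := (@modular_conj R G).

Lemma inner_reindex (s : G -> G) (xi eta xi' eta' : ell2 R G) : bijective s ->
  (forall g, xi' g = xi (s g)) -> (forall g, eta' g = eta (s g)) ->
  inner xi' eta' = inner xi eta.
Proof.
move=> bs hx he; rewrite /inner -[RHS](csum_reindex _ bs).
by apply: eq_csum => g; rewrite /= hx he.
Qed.

Lemma left_translationE x xi g : left_translation x xi g = xi (x^-1 * g)%g.
Proof. by []. Qed.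

Lemma left_translation_linear x : linear (@left_translation R G x).
Proof. by move=> c xi eta; apply: ell2_eqP. Qed.

Lemma left_translation_inner x xi eta :
  inner (left_translation x xi) (left_translation x eta) = inner xi eta.
Proof. exact: (inner_reindex (mulg_bij (x^-1)%g)). Qed.

Lemma left_translation_bounded x : bounded_operator (@left_translation R G x).
Proof.
split; first exact: left_translation_linear.
by exists 1 => xi; rewrite mul1r (@eq_l2norm _ _ _ xi)// left_translation_inner.
Qed.

Lemma left_translation_adjoint x :
  is_adjoint (@left_translation R G x) (left_translation x^-1%g).
Proof.
move=> xi eta; rewrite -[RHS](left_translation_inner x); congr inner.
by apply: ell2_eqP => g; rewrite !left_translationE invgK mulVKg.
Qed.

Lemma modular_conjE xi g : J xi g = conjc (xi g^-1%g). Proof. by []. Qed.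

Lemma modular_conjK xi : J (J xi) = xi.
Proof. by apply: ell2_eqP => g; rewrite !modular_conjE conjcK invgK. Qed.

Lemma modular_conjD xi eta : J (xi + eta) = J xi + J eta.
Proof. by apply: ell2_eqP => g; rewrite modular_conjE !ell2_addE conjcD. Qed.

Lemma modular_conjZ (c : R[i]) xi : J (c *: xi) = conjc c *: J xi.
Proof. by apply: ell2_eqP => g; rewrite modular_conjE !ell2_scaleE conjcM. Qed.

Lemma modular_conj_inner xi eta : inner (J xi) (J eta) = inner eta xi.
Proof.
rewrite [RHS]inner_conj /inner -csum_conj -[RHS](csum_reindex _ (@invg_bij G)).
by apply: eq_csum => g /=; rewrite conjcM.
Qed.

Lemma modular_conj_norm xi : l2norm (J xi) = l2norm xi.
Proof. by apply: eq_l2norm; rewrite modular_conj_inner. Qed.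

(** Conjugation by the modular conjugation exchanges left and right actions. *)
Definition right_copy (T : operator R G) : operator R G := fun xi => J (T (J xi)).

Lemma right_copy_bounded T : bounded_operator T -> bounded_operator (right_copy T).
Proof.
move=> bT; have [c c0 hc] := bounded_operatorW bT; split.
  move=> k xi eta; rewrite /right_copy modular_conjD modular_conjZ bT.1.
  by rewrite modular_conjD modular_conjZ conjcK.
exists c => xi; rewrite /right_copy modular_conj_norm.
by apply: le_trans (hc _) _; rewrite modular_conj_norm.
Qed.

Lemma right_copy_adjoint T S : is_adjoint T S -> is_adjoint (right_copy T) (right_copy S).
Proof.
move=> h xi eta; rewrite /right_copy -[in LHS](modular_conjK eta) modular_conj_inner.
by rewrite -[in RHS](modular_conjK xi) modular_conj_inner (is_adjointC h).
Qed.

End GroupOperators.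

(** * The Laplacian *)

Section Chi1.
Variables (R : realType) (N : nat).
Local Notation G := (free_group N).
Local Notation chi := (@chi1 R N).
Implicit Types (xi eta : ell2 R G).

Lemma letgE (i : 'I_N) : letg (i, true) = fg_gen i. Proof. exact: val_inj. Qed.

Lemma letgVE (i : 'I_N) : letg (i, false) = (fg_gen i)^-1%g.
Proof. exact: val_inj. Qed.

Lemma sum_opE I (r : seq I) (P : pred I) (F : I -> operator R G) xi :
  (\sum_(i <- r | P i) F i) xi = \sum_(i <- r | P i) F i xi.
Proof. by elim/big_ind2 : _ => // x1 x2 y1 y2 <- <-. Qed.

Lemma chi1_letters : chi = \sum_(x : letter N) left_translation (letg x)^-1%g.
Proof.
transitivity (\sum_(i < N) \sum_(b : bool) @left_translation R G (letg (i, b))^-1%g); last first.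
  by rewrite pair_bigA; apply: eq_bigr => -[].
apply: eq_bigr => i _; rewrite big_bool /= letgE letgVE invgK addrC; congr (_ + _).
Qed.

Lemma chi1E xi h : chi xi h = lap xi h.
Proof.
rewrite chi1_letters sum_opE ell2_sumE /lap; apply: eq_bigr => x _.
by rewrite left_translationE invgK.
Qed.

Lemma bounded_operator_sum I (r : seq I) (P : pred I) (F : I -> operator R G) :
  (forall i, bounded_operator (F i)) -> bounded_operator (\sum_(i <- r | P i) F i).
Proof.
move=> bF; elim/big_ind : _ => //.
- by split; [move=> c xi eta /=; rewrite scaler0 addr0|exists 0 => xi; rewrite l2norm0 mul0r].
- by move=> S T bS bT; rewrite -[S]scale1r; apply: bounded_operatorD.
Qed.

Lemma chi1_bounded : bounded_operator chi.
Proof.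
by rewrite chi1_letters; apply: bounded_operator_sum => x; exact: left_translation_bounded.
Qed.

Lemma chi1_adjoint : is_adjoint chi chi.
Proof.
move=> xi eta; rewrite chi1_letters !sum_opE inner_suml inner_sumr.
rewrite [RHS](reindex_inj (@linv_inj N)) /=; apply: eq_bigr => x _.
by rewrite left_translation_adjoint letg_linv.
Qed.

Lemma right_chi1E xi h : right_copy chi xi h = \sum_(x : letter N) xi (h * letg x)%g.
Proof.
rewrite /right_copy modular_conjE chi1E /lap.
rewrite (reindex_inj (@linv_inj N)) /= (big_morph _ (@conjcD R) (@conjc0 R)).
by apply: eq_bigr => x _; rewrite conjcK invgM invgK letg_linv invgK.
Qed.

Lemma chi1_right_commute : chi \o right_copy chi = right_copy chi \o chi.
Proof.
apply/funext => xi; apply: ell2_eqP => h.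
change (chi (right_copy chi xi) h = right_copy chi (chi xi) h).
rewrite chi1E right_chi1E /lap.
under eq_bigr do rewrite right_chi1E; under [RHS]eq_bigr do rewrite chi1E /lap.
rewrite exchange_big /=; apply: eq_bigr => x _; apply: eq_bigr => y _.
by rewrite mulgA.
Qed.

End Chi1.

(** * Functions of two consecutive letters *)

Section TwoLetterFunctions.
Variables (R : realType) (N : nat).
Hypothesis N0 : (0 < N)%N.
Let x0 : letter N := (Ordinal N0, true).
Local Notation G := (free_group N).
Variables (alpha beta : letter N -> R[i]).
Hypothesis left_cancel : forall y, \sum_(x | x != linv y) alpha x * beta y = 0.

(** A function of the letters in positions n and n+1 of the words of length
n+m+2. *)
Definition two_letter n m (g : G) : R[i] :=
  (alpha (nth x0 (word g) n) * beta (nth x0 (word g) n.+1)) *+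
  (size (word g) == n + m + 2)%N.

Lemma sum_neq (A : R[i]) (y : letter N) : \sum_(x | x != y) A = (2 * N).-1%:R * A.
Proof. by rewrite sumr_const cardC1 card_letter mulr_natl. Qed.

Lemma lap_two_letter0 m g : lap (two_letter 0 m) g = two_letter 1 m g.
Proof.
rewrite /lap /two_letter; under eq_bigr do rewrite word_letg_mul.
case: (word g) (reducedP g) => [|y w] rw /=.
  by rewrite big1 // => x _; rewrite add0n addn2.
rewrite (bigD1 (linv y))//= linvK eqxx addrC.
rewrite (eq_bigr (fun x => (alpha x * beta y) *+ ((size w).+2 == m + 2)%N)); last first.
  by move=> x xy; rewrite ifN//; apply: contra xy => /eqP ->; rewrite linvK.
rewrite sumrMnl left_cancel mul0rn add0r.
by congr (_ *+ _); rewrite !addn2 add1n !addSn eqSS.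
Qed.

Lemma lap_two_letterS n m g :
  lap (two_letter n.+1 m) g = two_letter n.+2 m g + (2 * N).-1%:R * two_letter n m g.
Proof.
rewrite /lap /two_letter; under eq_bigr do rewrite word_letg_mul.
case: (word g) (reducedP g) => [|y w] rw /=.
  by rewrite !addn2 /= !mulr0n mulr0 addr0 big1.
rewrite (bigD1 (linv y))//= linvK eqxx; congr (_ + _).
rewrite -(sum_neq _ (linv y)); apply: eq_bigr => x xy.
rewrite ifN /=; first by rewrite addSn addSn eqSS.
by apply: contra xy => /eqP ->; rewrite linvK.
Qed.

End TwoLetterFunctions.

(** * Inversion of a generator *)

Section SignFlip.
Variables (R : realType) (N : nat) (i0 : 'I_N).
Local Notation G := (free_group N).

Definition flip_letter (x : letter N) : letter N := if x.1 == i0 then linv x else x.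

Lemma flip_letterK : involutive flip_letter.
Proof.
move=> x; rewrite /flip_letter; case: (boolP (x.1 == i0)) => h.
  by rewrite [(linv x).1]/x.1 h linvK.
by rewrite (negbTE h).
Qed.

Lemma flip_letter_linv x : flip_letter (linv x) = linv (flip_letter x).
Proof. by rewrite /flip_letter [(linv x).1]/x.1; case: ifP. Qed.

Lemma flip_reduced (g : G) : reduced (map flip_letter (word g)).
Proof.
rewrite /reduced sorted_map; apply: sub_sorted (reducedP g) => x y /=.
by apply: contra => /eqP; rewrite -flip_letter_linv => /(inv_inj flip_letterK) ->.
Qed.

(** The automorphism that replaces the generator of index i0 by its inverse. *)
Definition flip (g : G) : G := FreeGroup (flip_reduced g).

Lemma flipK : involutive flip.
Proof.
move=> g; apply: val_inj => /=; rewrite -map_comp -[RHS]map_id.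
by apply: eq_map => x /=; rewrite flip_letterK.
Qed.

Lemma flip_bij : bijective flip. Proof. exact: inv_bij flipK. Qed.

Lemma flip_letg_mul x g : flip (letg x * g)%g = (letg (flip_letter x) * flip g)%g.
Proof.
apply: val_inj => /=; case: (word g) => [//|y w] /=.
rewrite -flip_letter_linv (inj_eq (inv_inj flip_letterK)).
by case: ifP.
Qed.

Definition flip_op : operator R G :=
  fun xi => Ell2 (square_summable_reindex flip_bij (ell2P xi)).

Lemma flip_opE xi g : flip_op xi g = xi (flip g). Proof. by []. Qed.

Lemma flip_op_inner xi eta : inner (flip_op xi) (flip_op eta) = inner xi eta.
Proof. exact: (inner_reindex flip_bij). Qed.

Lemma flip_op_bounded : bounded_operator flip_op.
Proof.
split; first by move=> c xi eta; apply: ell2_eqP.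
by exists 1 => xi; rewrite mul1r (@eq_l2norm _ _ _ xi)// flip_op_inner.
Qed.

Lemma flip_op_chi1 : flip_op \o @chi1 R N = @chi1 R N \o flip_op.
Proof.
apply/funext => xi; apply: ell2_eqP => g.
change (flip_op (@chi1 R N xi) g = @chi1 R N (flip_op xi) g).
rewrite flip_opE !chi1E /lap (reindex_inj (inv_inj flip_letterK)) /=.
apply: eq_bigr => x _; rewrite -[RHS]/(xi (flip (letg x * g)%g)).
by rewrite flip_letg_mul.
Qed.

Lemma flip_op_delta1 : flip_op (delta R 1%g) = delta R 1%g.
Proof.
apply: ell2_eqP => g; rewrite flip_opE !deltaE; congr (nat_of_bool _)%:R.
apply/eqP/eqP => [e|->]; last exact: val_inj.
by rewrite -[g]flipK e; apply: val_inj.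
Qed.

End SignFlip.

(** * The distinguished vector *)

Section Zeta0.
Variables (R : realType) (N : nat) (i0 i1 : 'I_N).
Hypothesis i01 : i0 != i1.
Local Notation G := (free_group N).

Definition letter_sign (i : 'I_N) (x : letter N) : R[i] :=
  if x.1 == i then (if x.2 then 1 else -1) else 0.

Lemma letter_sign_linv i x : letter_sign i (linv x) = - letter_sign i x.
Proof.
rewrite /letter_sign [(linv x).1]/x.1 [(linv x).2]/(~~ x.2).
by case: ifP => _; [case: x.2; rewrite ?opprK|rewrite oppr0].
Qed.

Lemma letter_sign_conj i x : conjc (letter_sign i x) = letter_sign i x.
Proof.
rewrite /letter_sign; case: ifP => _; last exact: conjc0.
by case: x.2; rewrite ?conjcN conjc1.
Qed.

Lemma letter_sign_flip i x :
  letter_sign i (flip_letter i0 x) = if i == i0 then - letter_sign i x else letter_sign i x.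
Proof.
rewrite /flip_letter; case: (eqVneq i i0) => [->|ii]; case: eqVneq => xi.
- by rewrite letter_sign_linv.
- by rewrite /letter_sign (negbTE xi) oppr0.
- by rewrite letter_sign_linv /letter_sign xi (eq_sym i0) (negbTE ii) oppr0.
- by [].
Qed.

Lemma letter_sign_sum i : \sum_(x : letter N) letter_sign i x = 0.
Proof.
have E : \sum_(x : letter N) letter_sign i x = - \sum_(x : letter N) letter_sign i x.
  rewrite {1}(reindex_inj (@linv_inj N)) -sumrN; apply: eq_bigr => x _.
  by rewrite letter_sign_linv.
by apply/eqP; move/eqP: E; rewrite -addr_eq0 -mulr2n mulrn_eq0.
Qed.

Lemma letter_sign_cancel i j y : i != j ->
  \sum_(x | x != linv y) letter_sign i x * letter_sign j y = 0.
Proof.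
move=> ij; have := letter_sign_sum i; rewrite (bigD1 (linv y))//= -mulr_suml.
rewrite letter_sign_linv addrC => /(canRL (addrK _)) ->.
rewrite opprK add0r /letter_sign; case: eqVneq => [->|_]; last by rewrite mul0r.
by rewrite (negbTE ij) mulr0.
Qed.

End Zeta0.

Section SphereLap.
Variables (N : nat) (V : zmodType).
Implicit Types (f : free_group N -> V).

Lemma lapB f1 f2 : lap (fun g => f1 g - f2 g) = fun h => lap f1 h - lap f2 h.
Proof. by apply/funext => h; rewrite /lap sumrB. Qed.

Lemma lapMn f k : lap (fun g => f g *+ k) = fun h => lap f h *+ k.
Proof. by apply/funext => h; rewrite /lap sumrMnl. Qed.

Lemma sphereB n f1 f2 h :
  sphere n (fun g => f1 g - f2 g) h = sphere n f1 h - sphere n f2 h.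
Proof.
by rewrite /sphere -sumwN -sumwD; apply: eq_sumw => w _; rewrite mulrnBl.
Qed.

Lemma sphere_lap n f : sphere n (lap f) = lap (sphere n f).
Proof.
suff: forall f, sphere n (lap f) = lap (sphere n f) /\
    sphere n.+1 (lap f) = lap (sphere n.+1 f) by move=> /(_ f)[].
elim: n => [|n IH] {}f; first by rewrite !sphere0 !sphere1.
split; first exact: (IH f).2.
have E (g : free_group N -> V) : sphere n.+2 g = fun h => sphere n.+1 (lap g) h - sphere n g h *+ gen_count N n.
  by apply/funext => h; rewrite sphereS.
by rewrite !E lapB lapMn (IH f).1 (IH (lap f)).2.
Qed.

Lemma sphereS' n f h :
  sphere n.+2 f h = lap (sphere n.+1 f) h - sphere n f h *+ gen_count N n.
Proof. by rewrite sphereS sphere_lap. Qed.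

End SphereLap.

Lemma real_complexM (R : realType) (x y : R) : (x * y)%:C = x%:C * y%:C.
Proof. exact: rmorphM. Qed.
Lemma real_complexD (R : realType) (x y : R) : (x + y)%:C = x%:C + y%:C.
Proof. exact: rmorphD. Qed.
Lemma real_complexN (R : realType) (x : R) : (- x)%:C = - x%:C.
Proof. exact: rmorphN. Qed.

Section TwoLetterSpheres.
Variables (R : realType) (N : nat).
Hypothesis N0 : (0 < N)%N.
Let x0 : letter N := (Ordinal N0, true).
Local Notation G := (free_group N).

(** For fixed m, the Laplacian acts on the functions two_letter n m by the recursion
of the spheres, except that 2 N - 1 replaces 2 N in its first step; this is what
the second term corrects.  The condition on alpha and beta removes the words of
length m + 1 that cancellation at the front would produce. *)
Lemma sphere_two_letter (alpha beta : letter N -> R[i]) n m :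
  (forall y, \sum_(x | x != linv y) alpha x * beta y = 0) ->
  sphere n (two_letter N0 alpha beta 0 m) =
  fun g => two_letter N0 alpha beta n m g -
    (if n is k.+2 then two_letter N0 alpha beta k m g else 0).
Proof.
move=> C; set T := two_letter N0 alpha beta.
have lapT0 k : lap (T 0 k) = T 1 k by apply/funext => g; exact: lap_two_letter0.
have lapTS j k : lap (T j.+1 k) = fun g => T j.+2 k g + (2 * N).-1%:R * T j k g.
  by apply/funext => g; exact: lap_two_letterS.
suff: sphere n (T 0 m) = (fun g => T n m g - (if n is k.+2 then T k m g else 0)) /\
  sphere n.+1 (T 0 m) = (fun g => T n.+1 m g - (if n.+1 is k.+2 then T k m g else 0)) by case.
elim: n => [|n [IH1 IH2]].
  by rewrite sphere0 sphere1 lapT0; split; apply/funext => g; rewrite subr0.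
split=> //; apply/funext => g; rewrite sphereS' IH2 IH1.
have E : (2 * N).-1%:R = (2 * N)%:R - 1 :> R[i].
  by rewrite -[in RHS](@prednK (2 * N)) ?muln_gt0// -natr1 addrK.
case: n {IH1 IH2} => [|[|n]].
- rewrite lapB lapTS (_ : lap (fun=> 0) = fun=> 0) /=; last first.
    by apply/funext => h; rewrite /lap big1.
  by rewrite -mulr_natl E; ring.
- by rewrite lapB lapTS lapT0 /= -mulr_natl; ring.
- by rewrite lapB !lapTS /= -mulr_natl; ring.
Qed.

Lemma two_letter_inv (alpha beta : letter N -> R[i]) n m (g : G) :
  (forall x, alpha (linv x) = - alpha x) -> (forall x, beta (linv x) = - beta x) ->
  two_letter N0 alpha beta n m g^-1%g = two_letter N0 beta alpha m n g.
Proof.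
move=> oa ob; rewrite /two_letter size_word_inv (addnC n).
case: eqP => [s|//]; rewrite word_inv !nth_rev ?size_map ?s; [|lia..].
rewrite !(nth_map x0) ?s; [|lia..].
have -> : (m + n + 2 - n.+1 = m.+1)%N by lia.
have -> : (m + n + 2 - n.+2 = m)%N by lia.
by rewrite oa ob mulrNN mulrC.
Qed.

End TwoLetterSpheres.

Section Zeta0Vector.
Variables (R : realType) (N : nat).
Hypothesis N0 : (0 < N)%N.
Variables (i0 i1 : 'I_N).
Hypothesis i01 : i0 != i1.
Local Notation G := (free_group N).
Local Notation al := (@letter_sign R N i0).
Local Notation be := (@letter_sign R N i1).
Local Notation T := (two_letter N0 al be).

Definition two_letter_elements : seq G :=
  undup [seq (letg x * letg y)%g | x <- enum {: letter N}, y <- enum {: letter N}].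

(** The element (a - a^-1)(b - b^-1) of the group ring, a and b being the
generators of indices i0 and i1. *)
Definition zeta0 : ell2 R G := \sum_(g <- two_letter_elements) T 0 0 g *: delta R g.

Lemma zeta0E g : zeta0 g = T 0 0 g.
Proof.
rewrite /zeta0 sum_deltaE ?undup_uniq//; case: ifPn => // gs.
rewrite /two_letter; case: eqP => // s; case/negP: gs; rewrite mem_undup.
case E : (word g) s => [|x [|y [|z w]]]// _; apply/allpairsP => /=.
exists (x, y); split; rewrite ?mem_enum//=; apply: val_inj.
have := reducedP g; rewrite E reduced_cons => /andP[_ yx].
rewrite [\val g]E; change ([:: x; y] = lcons x [:: y]).
by rewrite /lcons (negbTE yx).
Qed.

Lemma flip_zeta0 : flip_op i0 zeta0 = - zeta0.
Proof.
apply: ell2_eqP => g; rewrite flip_opE ell2_oppE !zeta0E /two_letter size_map.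
case: eqP => [s|]; last by rewrite oppr0.
rewrite !(nth_map (Ordinal N0, true)) ?s// !letter_sign_flip eqxx.
by rewrite eq_sym (negbTE i01) mulNr.
Qed.

Lemma zeta0_neq0 : zeta0 <> 0.
Proof.
move=> z0; have ai : (i1, true) != linv (i0, true).
  by apply/eqP => -[e]; move: i01; rewrite e eqxx.
have rw : reduced [:: (i0, true); (i1, true)] by rewrite reduced_cons ai.
have := zeta0E (FreeGroup rw); rewrite z0 /two_letter /= /letter_sign /= !eqxx mulr1 mulr1n.
by move/eqP; rewrite eq_sym oner_eq0.
Qed.

(** The integrals of the spherical polynomials against the density weight below. *)
Definition density_coef n : R := if n is 0 then 1 else if n == 2 then -1 else 0.

(** A sphere acting on the left (resp. right) of zeta0 yields words in which its
two letters are preceded (resp. followed) by others.  Only the part supported on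
words of length two meets zeta0, and it survives for degrees 0 and 2 only. *)
Lemma zeta0_coefficients n m (xi : ell2 R G) :
  (forall h, xi h = conjc (sphere m (modular_conj zeta0) h^-1%g)) ->
  forall eta : ell2 R G, (forall h, eta h = sphere n xi h) ->
  inner eta zeta0 = (density_coef n * density_coef m)%:C * inner zeta0 zeta0.
Proof.
move=> xiE eta etaE.
have Jz : modular_conj zeta0 = two_letter N0 be al 0 0 :> (G -> R[i]).
  apply/funext => g; rewrite modular_conjE zeta0E.
  rewrite two_letter_inv; [|exact: letter_sign_linv|exact: letter_sign_linv].
  by rewrite /two_letter; case: eqP => _; rewrite ?mulr0n ?conjc0// mulr1n conjcM !letter_sign_conj.
have conjT k l g : conjc (two_letter N0 be al k l g) = two_letter N0 be al k l g.
  by rewrite /two_letter; case: eqP => _; rewrite ?mulr0n ?conjc0// mulr1n conjcM !letter_sign_conj.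
have xiE' : xi = (fun g => T 0 m g - (if m is k.+2 then T 0 k g else 0)) :> (G -> R[i]).
  apply/funext => h; rewrite xiE Jz sphere_two_letter; last first.
    by move=> y; apply: letter_sign_cancel; rewrite eq_sym.
  have sw k : two_letter N0 be al k 0 h^-1%g = T 0 k h.
    by rewrite two_letter_inv//; exact: letter_sign_linv.
  rewrite conjcD conjcN conjT// sw; congr (_ - _).
  by case: (m) => [|[|k]]; rewrite ?conjc0// conjT// sw.
have C y : \sum_(x | x != linv y) al x * be y = 0 by exact: letter_sign_cancel.
have etaE' h : eta h = (T n m h - (if n is k.+2 then T k m h else 0)) -
    (if m is k.+2 then T n k h - (if n is j.+2 then T j k h else 0) else 0).
  rewrite etaE xiE' sphereB sphere_two_letter//; congr (_ - _).
  case: (m) => [|[|k]]; rewrite ?sphere_two_letter//;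
    by rewrite /sphere -[RHS](sumw0 N _ n); apply: eq_sumw => w _; rewrite mul0rn.
rewrite -innerZl /inner; apply: eq_csum => h.
rewrite ell2_scaleE zeta0E etaE'.
case: (eqVneq (size (word h)) 2%N) => [s|s]; last first.
  by rewrite [T 0 0 h]/two_letter !addn2 (negbTE s) mulr0n conjc0 !mulr0.
have T0 k l : (0 < k + l)%N -> T k l h = 0.
  by move=> kl; rewrite /two_letter s; case: eqP => // e; lia.
congr (_ * _).
have cE k : (density_coef k)%:C = (if k is 0 then 1 else if k == 2 then -1 else 0) :> R[i].
  by rewrite /density_coef; case: k => // k; case: ifP; rewrite ?rmorphN.
rewrite real_complexM !cE.
move: T0 {xiE etaE xiE' etaE' cE C Jz conjT}; move: (T) => U U0.
have Ul k l : U k.+1 l h = 0 by exact: U0.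
have Ur k l : U k l.+1 h = 0 by apply: U0; rewrite addnS.
case: n m => [|[|[|n]]] [|[|[|m]]]; rewrite /= ?(Ul, Ur); ring.
Qed.

End Zeta0Vector.

(** * Bounded measurable functions *)

Section BoundedMeasurable.
Context d (T : measurableType d) (R : realType).
Variables (mu : probability T R) (D : set T).
Hypothesis mD : measurable D.
Implicit Types f g : T -> R.

Definition bounded_measurable f :=
  measurable_fun [set: T] f /\ exists M : R, forall x, D x -> `|f x| <= M.

Lemma bounded_measurable_integrable f : bounded_measurable f ->
  mu.-integrable D (EFin \o f).
Proof.
move=> [mf [M hM]]; apply: measurable_bounded_integrable => //.
- by apply: le_lt_trans (probability_le1 mu mD) _; rewrite ltry.
- exact: measurable_funTS.
exists M; split; first exact: num_real.
by move=> y My x Dx; apply: le_trans (hM x Dx) _; exact: ltW.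
Qed.

Lemma bounded_measurable_cst (c : R) : bounded_measurable (fun=> c).
Proof. by split; [exact: measurable_cst|exists `|c|]. Qed.

Lemma bounded_measurableD f g : bounded_measurable f -> bounded_measurable g ->
  bounded_measurable (fun x => f x + g x).
Proof.
move=> [mf [M hM]] [mg [K hK]]; split; first exact: measurable_funD.
by exists (M + K) => x Dx; apply: le_trans (ler_normD _ _) _; rewrite lerD ?hM ?hK.
Qed.

Lemma bounded_measurableM f g : bounded_measurable f -> bounded_measurable g ->
  bounded_measurable (fun x => f x * g x).
Proof.
move=> [mf [M hM]] [mg [K hK]]; split; first exact: measurable_funM.
by exists (M * K) => x Dx; rewrite normrM ler_pM ?hM ?hK.
Qed.

Lemma bounded_measurableZ (c : R) f : bounded_measurable f ->
  bounded_measurable (fun x => c * f x).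
Proof. by move=> bf; apply: bounded_measurableM => //; exact: bounded_measurable_cst. Qed.

Lemma bounded_measurableB f g : bounded_measurable f -> bounded_measurable g ->
  bounded_measurable (fun x => f x - g x).
Proof.
move=> bf bg; have := bounded_measurableD bf (bounded_measurableZ (-1) bg).
by congr bounded_measurable; apply/funext => x; rewrite mulN1r.
Qed.

Lemma bounded_measurable_norm f : bounded_measurable f ->
  bounded_measurable (fun x => `|f x|).
Proof.
move=> [mf [M hM]]; split; last by exists M => x Dx; rewrite normr_id hM.
exact: measurableT_comp.
Qed.

Lemma bounded_measurable_sum I (r : seq I) (F : I -> T -> R) :
  (forall i, bounded_measurable (F i)) ->
  bounded_measurable (fun x => \sum_(i <- r) F i x).
Proof.
move=> bF; elim: r => [|i r IH].
  have := bounded_measurable_cst 0; congr bounded_measurable.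
  by apply/funext => x; rewrite big_nil.
have := bounded_measurableD (bF i) IH; congr bounded_measurable.
by apply/funext => x; rewrite big_cons.
Qed.

Local Notation II f := (Rintegral mu D f).

Lemma Rintegral_sum I (r : seq I) (F : I -> T -> R) :
  (forall i, bounded_measurable (F i)) ->
  II (fun x => \sum_(i <- r) F i x) = \sum_(i <- r) II (F i).
Proof.
move=> bF; elim: r => [|i r IH].
  rewrite big_nil /Rintegral.
  under eq_integral do rewrite big_nil.
  by rewrite integral0.
rewrite big_cons -IH -RintegralD//.
- by congr (Rintegral _ _ _); apply/funext => x; rewrite big_cons.
- exact: bounded_measurable_integrable.
- by apply: bounded_measurable_integrable; exact: bounded_measurable_sum.
Qed.

(** * Completeness of L^1 for rapidly converging sequences *)

Section RapidlyCauchy.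
Variable h : nat -> T -> R.
Hypothesis bh : forall k, bounded_measurable (h k).
Hypothesis rapid : forall k, II (fun x => `|h k.+1 x - h k x|) <= (1 / 2) ^+ k.

Let G x : \bar R := (\sum_(0 <= k <oo) (`|h k.+1 x - h k x|)%:E)%E.

Let bdiff k : bounded_measurable (fun x => `|h k.+1 x - h k x|).
Proof. by apply: bounded_measurable_norm; exact: bounded_measurableB. Qed.

Let mG : measurable_fun [set: T] G.
Proof.
apply: ge0_emeasurable_sum => // k _.
by apply/measurable_EFinP; case: (bdiff k).
Qed.

Let intG : mu.-integrable D G.
Proof.
apply/integrableP; split; first exact: measurable_funTS.
have G0 x : (0 <= G x)%E by apply: nneseries_ge0 => k _ _; rewrite lee_fin.
under eq_integral do rewrite gee0_abs//.
rewrite /G integral_nneseries//; last first.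
  by move=> k; apply: measurable_funTS; apply/measurable_EFinP; case: (bdiff k).
apply: (@le_lt_trans _ _ (\sum_(0 <= k <oo) ((1 / 2) ^+ k)%:E)%E).
  apply: lee_nneseries => [k *|k *]; first by apply: integral_ge0 => x _; rewrite lee_fin.
  have fk := bounded_measurable_integrable (bdiff k).
  by rewrite -[leLHS](fineK (integrable_fin_num mD fk)) lee_fin; exact: rapid.
apply: (@le_lt_trans _ _ 2%:E); last exact: ltry.
apply: lime_le; first by apply: is_cvg_nneseries => k _ _; rewrite lee_fin exprn_ge0// divr_ge0.
apply: nearW => n; rewrite sumEFin lee_fin.
suff -> : \sum_(0 <= i < n) (1 / 2) ^+ i = 2 - 2 * (1 / 2) ^+ n :> R.
  by rewrite lerBlDr lerDl mulr_ge0// exprn_ge0// divr_ge0.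
elim: n => [|n IH]; first by rewrite big_geq// expr0; ring.
by rewrite big_nat_recr//= IH exprS; field.
Qed.

(** An upper limit, hence measurable and defined everywhere. *)
Definition rapid_limit x : R := fine (limn_esup (fun k => (h k x)%:E)).

Let mlim : measurable_fun [set: T] rapid_limit.
Proof.
apply: measurableT_comp; first exact: fine_measurable.
by apply: measurable_fun_limn_esup => k; apply/measurable_EFinP; case: (bh k).
Qed.

Let cvg_rapid x : (G x < +oo)%E -> (fun k => (h k x)%:E) @ \oo --> (rapid_limit x)%:E.
Proof.
move=> Gx.
have cn : cvgn [normed series (telescope (h ^~ x))].
  rewrite -[X in cvgn X]/(series (fun k => `|telescope (h ^~ x) k|)).
  apply: nondecreasing_is_cvgn.
    by apply: nondecreasing_series => k _ _.
  exists (fine (G x)) => _ [n _ <-].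
  have Gf : (G x \is a fin_num)%E.
    by rewrite ge0_fin_numE//; apply: nneseries_ge0 => k _ _; rewrite lee_fin.
  rewrite -lee_fin fineK// /series/= -sumEFin.
  by apply: nneseries_lim_ge => k _ _; rewrite lee_fin.
have /cvg_ex[l hl] : cvgn (h ^~ x).
  have := normed_cvg cn; rewrite telescopeK => /cvg_ex[l hl].
  apply/cvg_ex; exists (l + h 0%N x).
  rewrite (_ : h ^~ x = fun n => (h n x - h 0%N x) + h 0%N x).
    by apply: cvgD; [exact: hl|exact: cvg_cst].
  by apply/funext => n; rewrite subrK.
have hE : (fun k => (h k x)%:E) @ \oo --> l%:E by apply: cvg_EFin; [exact: nearW|exact: hl].
have -> : rapid_limit x = l; last exact: hE.
rewrite /rapid_limit is_cvg_limn_esupE; last by apply/cvg_ex; exists l%:E.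
by rewrite (cvg_lim _ hE).
Qed.

Let dominated k x : (`|(h k x)%:E| <= `|h 0%N x|%:E + G x)%E.
Proof.
rewrite (eq_sum_telescope (h ^~ x) k).
apply: (@le_trans _ _ ((`|h 0%N x| + series (fun k => `|telescope (h ^~ x) k|) k)%:E)).
  by rewrite lee_fin; apply: le_trans (ler_normD _ _) _; rewrite lerD2l /series/= ler_norm_sum.
rewrite EFinD leeD2l// /series/= -sumEFin.
by apply: nneseries_lim_ge => j _ _; rewrite lee_fin.
Qed.

Lemma rapid_limitP : [/\ measurable_fun [set: T] rapid_limit,
  mu.-integrable D (EFin \o rapid_limit) &
  forall e : R, 0 < e -> exists k0, forall k, (k0 <= k)%N ->
    II (fun x => `|h k x - rapid_limit x|) <= e].
Proof.
have i0 : mu.-integrable D (fun x => `|h 0%N x|%:E).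
  exact: bounded_measurable_integrable (bounded_measurable_norm (bh 0)).
have ig : mu.-integrable D (fun x => `|h 0%N x|%:E + G x)%E by exact: integrableD.
have aeG : {ae mu, forall x, D x -> (fun k => (h k x)%:E) @ \oo --> (rapid_limit x)%:E}.
  have := integrable_ae mD intG; apply: filterS => x Gx Dx; apply: cvg_rapid.
  by have := Gx Dx; rewrite ge0_fin_numE//; apply: nneseries_ge0 => k _ _; rewrite lee_fin.
have [] := @dominated_convergence _ _ _ mu D mD (fun k x => (h k x)%:E)
  (EFin \o rapid_limit) (fun x => `|h 0%N x|%:E + G x)%E _ _ aeG ig _.
- by move=> k; apply: measurable_funTS; apply/measurable_EFinP; case: (bh k).
- by apply: measurable_funTS; apply/measurable_EFinP.
- by apply: aeW => x k _; exact: dominated.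
move=> il cl _; split=> // e e0.
have /fine_cvgP[_ /cvgrPdist_lt /(_ e e0)] := cl.
move=> [k0 _ hk0]; exists k0 => k kk.
have := hk0 k kk; rewrite /= sub0r normrN; move/ltW; apply: le_trans.
by apply: le_trans (ler_norm _).
Qed.

End RapidlyCauchy.
End BoundedMeasurable.

(** * Measures with a density *)

Section DensityMeasure.
Context d (T : measurableType d) (R : realType).
Variables (mu : probability T R) (D : set T).
Variable h : T -> R.

(** Measurability of D is included so that the structures of measure on
density_measure depend on this single hypothesis. *)
Definition density_on : Prop :=
  [/\ measurable D, measurable_fun [set: T] h, mu.-integrable D (EFin \o h) & forall x, 0 <= h x].

Definition density_measure (H : density_on) (A : set T) : \bar R :=
  (\int[mu]_(x in A) ((h \_ D) x)%:E)%E.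

Variable H : density_on.
Let nu := density_measure H.

Let mD : measurable D. Proof. by case: H. Qed.

Let hD0 x : 0 <= (h \_ D) x.
Proof. by rewrite patchE; case: ifP => // _; case: H => _ _ _ ->. Qed.

Let mhD : measurable_fun [set: T] (EFin \o (h \_ D)).
Proof.
apply/measurable_EFinP/(measurable_restrictT _ mD).1.
by apply: measurable_funTS; case: H.
Qed.

Let ihD : mu.-integrable [set: T] (EFin \o (h \_ D)).
Proof.
have := (integrable_mkcond (EFin \o h) mD).1; rewrite restrict_EFin; apply.
by case: H.
Qed.

Let nu0 : nu set0 = 0%E. Proof. exact: integral_set0. Qed.

Let nu_ge0 A : (0 <= nu A)%E.
Proof. by apply: integral_ge0 => x _; rewrite lee_fin. Qed.

Let nu_sigma_additive : semi_sigma_additive nu.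
Proof.
by apply: (@semi_sigma_additive_nng_induced _ _ _ mu (EFin \o (h \_ D))) => // x; rewrite lee_fin.
Qed.

HB.instance Definition _ := isMeasure.Build _ _ _ (density_measure H)
  nu0 nu_ge0 nu_sigma_additive.

Let nu_finite : fin_num_fun (density_measure H).
Proof.
by move=> A mA; apply: integrable_fin_num => //; exact: integrableS ihD.
Qed.

HB.instance Definition _ := @Measure_isFinite.Build _ _ _ (density_measure H) nu_finite.

Lemma density_measureC : density_measure H (~` D) = 0%E.
Proof.
rewrite /density_measure; apply: integral0_eq => x nDx.
by rewrite patchE memNset.
Qed.

Lemma density_measure_dominated : density_measure H `<< mu.
Proof.
apply/null_content_dominatesP => A mA mA0; apply: null_set_integral => //.
exact: measurable_funTS.
Qed.

Lemma dominated_density_measure : mu (~` D) = 0%E -> (forall x, D x -> 0 < h x) ->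
  mu `<< density_measure H.
Proof.
move=> muC hp; apply/null_content_dominatesP => A mA nuA.
have mAD : measurable (A `&` D) by exact: measurableI.
suff AD0 : mu (A `&` D) = 0%E.
  apply/eqP; rewrite eq_le measure_ge0 andbT.
  have -> : A = (A `&` D) `|` (A `&` ~` D) by rewrite -setIUr setUv setIT.
  have mAC : measurable (A `&` ~` D) by apply: measurableI => //; exact: measurableC.
  apply: (le_trans (measureU2 mu mAD mAC)).
  rewrite [X in (X + _)%E]AD0 add0e -muC; apply: le_measure; rewrite ?inE.
  - by apply: measurableI => //; exact: measurableC.
  - exact: measurableC.
  - exact: subIsetr.
have : (\int[mu]_(x in A) `|((h \_ D) x)%:E| = 0)%E.
  by under eq_integral do rewrite gee0_abs ?lee_fin//; exact: nuA.
have mA' : measurable_fun A (EFin \o (h \_ D)) by exact: measurable_funTS.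
move=> /(ae_eq_integral_abs mu mA mA').1 /=.
move=> [N [mN N0 subN]]; apply/eqP; rewrite eq_le measure_ge0 andbT -N0.
apply: le_measure; rewrite ?inE// => x [Ax Dx]; apply: subN => /= /(_ Ax).
by rewrite patchE mem_set// => -[h0]; have := hp x Dx; rewrite h0 ltxx.
Qed.

Lemma integral_density_measure (f : T -> R) : bounded_measurable D f ->
  Rintegral (density_measure H) D f = Rintegral mu D (fun x => f x * h x).
Proof.
move=> bf; have [mf [M hM]] := bf.
have fi : (density_measure H).-integrable D (EFin \o f).
  apply: measurable_bounded_integrable => //.
  - by rewrite -ge0_fin_numE//; exact: nu_finite.
  - exact: measurable_funTS.
  exists M; split; first exact: num_real.
  by move=> y My x Dx; apply: le_trans (hM x Dx) _; exact: ltW.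
rewrite /Rintegral -(Radon_Nikodym_change_of_variables density_measure_dominated mD fi).
congr fine; apply: ae_eq_integral => //.
- apply: emeasurable_funM; first by apply/measurable_EFinP; exact: measurable_funTS.
  apply: measurable_funTS; apply: measurable_int; apply: Radon_Nikodym_integrable.
  exact: density_measure_dominated.
- apply/measurable_EFinP; apply: measurable_funTS; apply: measurable_funM => //.
  by case: H.
have : ae_eq mu D (Radon_Nikodym (charge_of_finite_measure (density_measure H)) mu)
    (EFin \o (h \_ D)).
  apply: integral_ae_eq => //.
  - apply: (integrableS measurableT) => //; apply: Radon_Nikodym_integrable.
    exact: density_measure_dominated.
  - exact: measurable_funTS.
  move=> E ED mE; rewrite -Radon_Nikodym_integral//.
  exact: density_measure_dominated.
apply: filterS => x /= e Dx; rewrite e// patchE mem_set//.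
Qed.

End DensityMeasure.

(** * Integrals over a square *)

Lemma within_bounded (R : realType) (a b : R) (f : R -> R) : a <= b ->
  {within `[a, b], continuous f} ->
  exists2 M : R, 0 <= M & forall t, `[a, b]%classic t -> `|f t| <= M.
Proof.
move=> ab cf; have [c _ hc] := EVT_max ab cf; have [d _ hd] := EVT_min ab cf.
exists (`|f c| + `|f d|); first by rewrite addr_ge0.
move=> t Xt; have t1 := hc t Xt; have t2 := hd t Xt.
rewrite ler_norml; apply/andP; split.
  by have := ler_norm (- f d); rewrite normrN; have := normr_ge0 (f c); lra.
by have := ler_norm (f c); have := normr_ge0 (f d); lra.
Qed.

Section ProductIntegrals.
Variables (R : realType) (lambda : probability (measurableTypeR R) R) (r : R).
Hypothesis r0 : 0 < r.
Local Notation X := (`[- r, r]%classic : set R).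
Local Notation T2 := (measurableTypeR R * measurableTypeR R)%type.
Local Notation mm := ((lambda \x lambda)%E : probability T2 R).
Local Notation D := (X `*` X : set T2).
Implicit Types a b : R -> R.

Lemma measurable_square : measurable D.
Proof. by apply: measurableX; exact: measurable_itv. Qed.

Lemma continuous_bounded a : continuous a -> exists M : R, forall t, X t -> `|a t| <= M.
Proof.
move=> ca; have rr : - r <= r by rewrite ge0_cp// ltW.
by have [M _ hM] := within_bounded rr (continuous_subspaceT ca); exists M.
Qed.

Lemma continuous_measurable a : continuous a ->
  measurable_fun [set: measurableTypeR R] (a : measurableTypeR R -> measurableTypeR R).
Proof. exact: continuous_measurable_fun. Qed.

Lemma bounded_measurable_continuous a : continuous a ->
  bounded_measurable (T := measurableTypeR R) X a.
Proof. by move=> ca; split; [exact: continuous_measurable|exact: continuous_bounded]. Qed.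

Lemma bounded_measurable_tensor a b : continuous a -> continuous b ->
  bounded_measurable D (fun p : T2 => a p.1 * b p.2).
Proof.
move=> ca cb; apply: bounded_measurableM; split.
- by apply: (measurableT_comp (continuous_measurable ca)); exact: measurable_fst.
- by have [M hM] := continuous_bounded ca; exists M => p [p1 _]; exact: hM.
- by apply: (measurableT_comp (continuous_measurable cb)); exact: measurable_snd.
- by have [M hM] := continuous_bounded cb; exists M => p [_ p2]; exact: hM.
Qed.

Lemma Rintegral_tensor a b : continuous a -> continuous b ->
  Rintegral mm D (fun p : T2 => a p.1 * b p.2) = Rintegral lambda X a * Rintegral lambda X b.
Proof.
move=> ca cb; rewrite [LHS]Rintegral_mkcond.
have mkX c : Rintegral lambda X c = Rintegral lambda [set: measurableTypeR R] (c \_ X).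
  exact: Rintegral_mkcond.
rewrite (mkX a) (mkX b).
have mX : measurable (X : set (measurableTypeR R)) by exact: measurable_itv.
have ia := bounded_measurable_integrable lambda mX (bounded_measurable_continuous ca).
have ib := bounded_measurable_integrable lambda mX (bounded_measurable_continuous cb).
have iaT : lambda.-integrable [set: _] (EFin \o (a \_ X)).
  by rewrite -restrict_EFin; apply/(integrable_mkcond _ mX).1.
have ibT : lambda.-integrable [set: _] (EFin \o (b \_ X)).
  by rewrite -restrict_EFin; apply/(integrable_mkcond _ mX).1.
have E : (fun p : T2 => a p.1 * b p.2) \_ D = fun p : T2 => (a \_ X) p.1 * (b \_ X) p.2.
  apply/funext => -[t s]; rewrite !patchE /=.
  have -> : ((t, s) \in D) = (t \in X) && (s \in X).
    apply/idP/andP => [/set_mem[/= h1 h2]|[/set_mem h1 /set_mem h2]].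
      by split; exact: mem_set.
    by apply: mem_set.
  by case: (t \in X); case: (s \in X); rewrite /= ?mulr0 ?mul0r.
have iD := bounded_measurable_integrable mm measurable_square (bounded_measurable_tensor ca cb).
have iDT : mm.-integrable [set: T2] (EFin \o (fun p : T2 => (a \_ X) p.1 * (b \_ X) p.2)).
  rewrite -E -restrict_EFin; apply/(integrable_mkcond _ measurable_square).1.
  exact: iD.
rewrite /Rintegral E -(integral12_prod_meas1 iDT) /fubini_F /=.
have Fb : (\int[lambda]_x ((b \_ X) x)%:E \is a fin_num)%E by exact: integrable_fin_num.
have Fa : (\int[lambda]_x ((a \_ X) x)%:E \is a fin_num)%E by exact: integrable_fin_num.
under eq_integral do (under eq_integral do rewrite EFinM).
under eq_integral do rewrite integralZl//.
rewrite -fineM// -[Y in (_ * Y)%E](fineK Fb).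
by rewrite -integralZr//; congr fine; apply: eq_integral => x _; rewrite fineK.
Qed.

(** * Partitions of unity *)

Definition partition_of_unity n (phi : 'I_n -> R -> R) : Prop :=
  [/\ forall i, continuous (phi i), forall i t, 0 <= phi i t &
      forall t, \sum_(i < n) phi i t = 1].

Section Hats.
Variable M : nat.
Hypothesis M0 : (0 < M)%N.
Let step : R := 2 * r / M%:R.
Let node (i : nat) : R := - r + step * i%:R.
(** A ramp that rises from 0 to 1 between the nodes i - 1 and i.  The hat
functions are the differences of consecutive ramps, and they add up to
psi 0 - psi M.+1 = 1 on the whole line. *)
Let psi (i : nat) (t : R) : R :=
  if i == 0 then 1 else if (M < i)%N then 0
  else Num.max 0 (Num.min ((t - node i.-1) / step) 1).

Let MR0 : 0 < M%:R :> R. Proof. by rewrite ltr0n. Qed.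
Let step0 : 0 < step. Proof. by rewrite /step divr_gt0// mulr_gt0. Qed.

Let stepM : step * M%:R = 2 * r.
Proof. by rewrite /step divfK// gt_eqF. Qed.

Let psi_continuous i : continuous (psi i).
Proof.
rewrite /psi; case: (i == 0); first by move=> t; exact: cvg_cst.
case: (M < i)%N; first by move=> t; exact: cvg_cst.
move=> t; apply: (@continuous_max R R (fun=> 0) (fun t => Num.min ((t - node i.-1) / step) 1)).
  exact: cvg_cst.
apply: (@continuous_min R R (fun t => (t - node i.-1) / step) (fun=> 1)).
  apply: (@cvgM R); last exact: (@cvg_cst R).
  by apply: (@cvgB R R); [exact: cvg_id|exact: (@cvg_cst R)].
exact: cvg_cst.
Qed.

Let psi_itv i t : 0 <= psi i t <= 1.
Proof.
rewrite /psi; case: ifP => _; first by rewrite ler01 lexx.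
case: ifP => _; first by rewrite lexx ler01.
by rewrite le_max lexx ge_max ler01 ge_min lexx orbT.
Qed.

Let node_le i j : (i <= j)%N -> node i <= node j.
Proof. by move=> ij; rewrite /node lerD2l ler_wpM2l ?ler_nat// ltW. Qed.

Let psi_nonincr i t : psi i.+1 t <= psi i t.
Proof.
have := psi_itv i.+1 t; have := psi_itv i t.
rewrite /psi /=; case: (eqVneq i 0) => [_|i0]; first by move=> _ /andP[].
case: (ltnP M i.+1) => Mi; first by move=> /andP[].
rewrite ifN -?leqNgt 1?ltnW// => _ _.
rewrite ge_max le_max lexx /= le_max; apply/orP; right.
rewrite le_min !ge_min lexx orbT andbT ler_wpM2r ?invr_ge0 ?(ltW step0)//.
by rewrite lerB//; apply: node_le; rewrite leq_pred.
Qed.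

Let psi_left i t : X t -> t <= node i -> psi i.+1 t = 0.
Proof.
move=> Xt ti; rewrite /psi /=; case: ifP => // _; apply/max_idPl.
by rewrite ge_min pmulr_lle0 ?invr_gt0// subr_le0 ti.
Qed.

Let psi_right i t : X t -> node i <= t -> psi i t = 1.
Proof.
rewrite /psi /= in_itv /= => /andP[_ tr] it; case: eqVneq => // i0.
case: ifPn => [Mi|_].
  have h : node M.+1 <= node i by exact: node_le.
  have : node M.+1 <= r by apply: le_trans h (le_trans it tr).
  rewrite /node -natr1 mulrDr stepM mulr1; move: step0; lra.
have -> : Num.min ((t - node i.-1) / step) 1 = 1.
  apply/min_idPr; rewrite ler_pdivlMr// mul1r lerBrDr; apply: le_trans it.
  rewrite -[in node i](@prednK i) ?lt0n// /node -natr1 mulrDr mulr1.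
  by move: (step * _) => z; lra.
by apply/max_idPr.
Qed.

Lemma partition_exists : exists n (phi : 'I_n -> R -> R) (c : 'I_n -> R),
  [/\ partition_of_unity phi, forall i, X (c i) &
      forall i t, X t -> phi i t != 0 -> `|t - c i| <= 2 * r / M%:R].
Proof.
exists M.+1, (fun i t => psi i t - psi i.+1 t), (fun i => node i); split.
- split.
  + move=> i t; apply: (@cvgB R R); exact: psi_continuous.
  + by move=> i t; rewrite subr_ge0.
  + move=> t; rewrite -(big_mkord xpredT (fun i => psi i t - psi i.+1 t)).
    rewrite (eq_bigr (fun i => - (psi i.+1 t - psi i t))); last by move=> i _; rewrite opprB.
    by rewrite sumrN telescope_sumr// /psi /= ltnSn sub0r opprK.
- move=> i; rewrite /= in_itv /= /node lerDl mulr_ge0 ?ler0n ?(ltW step0)//=.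
  have : step * i%:R <= step * M%:R by rewrite ler_wpM2l ?(ltW step0)// ler_nat -ltnS.
  rewrite stepM; lra.
move=> i t Xt nz.
have nodeS j : node j.+1 = node j + step by rewrite /node -natr1 mulrDr mulr1 addrA.
rewrite ler_distl -[2 * r / _]/step; apply/andP; split.
  rewrite leNgt; apply/negP => ti; case/eqP: nz.
  rewrite psi_left//; last by move: ti step0; lra.
  case: (nat_of_ord i) ti => [|j] ti.
    by move: Xt; rewrite /= in_itv /= => /andP[]; move: ti; rewrite /node mulr0 addr0; move: step0; lra.
  by rewrite psi_left ?subrr//; move: ti; rewrite nodeS; lra.
rewrite leNgt; apply/negP => ti; case/eqP: nz.
rewrite psi_right//; last by move: ti step0; lra.
by rewrite psi_right ?subrr// nodeS ltW.
Qed.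

End Hats.

(** * The L^1 norm is computed by tests on partitions of unity *)

Definition lipschitz_square (g : R -> R -> R) : Prop :=
  exists2 C : R, 0 <= C & forall t s t' s', X t -> X s -> X t' -> X s' ->
    `|g t s| <= C /\ `|g t s - g t' s'| <= C * (`|t - t'| + `|s - s'|).

(** On a partition so fine that g varies by at most e / 2 within each cell, the
signs of g at the nodes recover its absolute value up to e. *)
Lemma L1_norm_tests (g : R -> R -> R) (e : R) : 0 < e -> lipschitz_square g ->
  measurable_fun [set: T2] (fun p : T2 => g p.1 p.2) ->
  exists n (phi : 'I_n -> R -> R) (kappa : 'I_n -> 'I_n -> R),
  [/\ partition_of_unity phi, forall i j, `|kappa i j| <= 1 &
    Rintegral mm D (fun p : T2 => `|g p.1 p.2|) <=
    Rintegral mm D (fun p : T2 =>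
      (\sum_(i < n) \sum_(j < n) kappa i j * (phi i p.1 * phi j p.2)) * g p.1 p.2) + e].
Proof.
move=> e0 [C C0 hC] mg.
(* On a cell, g varies by at most 2 C times the mesh; this counts twice below. *)
have [M M0 hM] : exists2 M : nat, (0 < M)%N & 4 * C * (2 * r / M%:R) <= e.
  exists (Num.truncn (8 * C * r / e)).+1 => //.
  have h : 8 * C * r / e < (Num.truncn (8 * C * r / e)).+1%:R.
    by apply: truncnS_gt; rewrite num_real.
  rewrite ltr_pdivrMr// in h.
  by rewrite mulrA ler_pdivrMr ?ltr0n//; move: h; lra.
have [n [phi [c [[cphi phi0 phi1] cX hphi]]]] := partition_exists M0.
pose kappa (i j : 'I_n) : R := Num.sg (g (c i) (c j)).
have kappa1 i j : `|kappa i j| <= 1.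
  by rewrite /kappa normr_sg; case: eqP => _ /=; rewrite ?lexx ?ler01.
exists n, phi, kappa; split=> //.
have bphi : bounded_measurable D (fun p : T2 =>
    \sum_(i < n) \sum_(j < n) kappa i j * (phi i p.1 * phi j p.2)).
  apply: bounded_measurable_sum => i; apply: bounded_measurable_sum => j.
  by apply: bounded_measurableZ; exact: bounded_measurable_tensor.
have bg : bounded_measurable D (fun p : T2 => g p.1 p.2).
  by split=> //; exists C => p [p1 p2]; have [] := hC _ _ _ _ p1 p2 p1 p2.
have mD := measurable_square.
apply: (@le_trans _ _ (Rintegral mm D (fun p : T2 =>
  (\sum_(i < n) \sum_(j < n) kappa i j * (phi i p.1 * phi j p.2)) * g p.1 p.2 + e))).
  apply: le_Rintegral => //.
  - by apply: bounded_measurable_integrable => //; exact: bounded_measurable_norm.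
  - apply: bounded_measurable_integrable => //; apply: bounded_measurableD.
      exact: bounded_measurableM.
    exact: bounded_measurable_cst.
  move=> [t s] [/= Xt Xs]; rewrite -lerBlDl.
  have one : \sum_(i < n) \sum_(j < n) phi i t * phi j s = 1.
    under eq_bigr do rewrite -mulr_sumr phi1 mulr1.
    exact: phi1.
  have E1 z : z = \sum_(i < n) \sum_(j < n) phi i t * phi j s * z.
    rewrite -[LHS]mul1r -one mulr_suml; apply: eq_bigr => i _.
    by rewrite mulr_suml.
  rewrite [Y in Y - _]E1 [leRHS]E1 mulr_suml -sumrB.
  apply: ler_sum => i _; rewrite mulr_suml -sumrB; apply: ler_sum => j _.
  rewrite (_ : _ - _ = phi i t * phi j s * (`|g t s| - kappa i j * g t s)); last by ring.
  have [p0|p0] := eqVneq (phi i t * phi j s) 0; first by rewrite p0 !mul0r.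
  rewrite ler_wpM2l ?mulr_ge0//.
  move: p0; rewrite mulf_eq0 negb_or => /andP[pi pj].
  have h1 := hphi _ _ Xt pi; have h2 := hphi _ _ Xs pj.
  have [_ hg] := hC _ _ _ _ Xt Xs (cX i) (cX j).
  have k1 := kappa1 i j; have kE : kappa i j * g (c i) (c j) = `|g (c i) (c j)|.
    by rewrite /kappa normrEsg.
  have : `|g t s - g (c i) (c j)| <= 2 * C * (2 * r / M%:R).
    apply: le_trans hg _; set dl := 2 * r / M%:R.
    have -> : 2 * C * dl = C * (dl + dl) by ring.
    by rewrite ler_wpM2l// lerD.
  have a1 : `|g t s| <= `|g (c i) (c j)| + `|g t s - g (c i) (c j)|.
    by rewrite -{1}[g t s](subrK (g (c i) (c j))) addrC ler_normD.
  have a2 : - kappa i j * (g t s - g (c i) (c j)) <= `|g t s - g (c i) (c j)|.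
    apply: le_trans (ler_norm _) _; rewrite normrM normrN -[leRHS]mul1r.
    by rewrite ler_wpM2r.
  move=> hd; move: hM kE hd a1 a2; set dl := 2 * r / M%:R; lra.
rewrite RintegralD//; last 2 first.
- by apply: bounded_measurable_integrable => //; exact: bounded_measurableM.
- by apply: bounded_measurable_integrable => //; exact: bounded_measurable_cst.
rewrite lerD2l Rintegral_cst// -[leRHS]mulr1 ler_wpM2l ?(ltW e0)//.
by rewrite -lee_fin fineK ?fin_num_measure// probability_le1.
Qed.

End ProductIntegrals.

(** * Lipschitz functions *)

Section Lipschitz.
Variables (R : realType) (r : R).
Local Notation X := (`[- r, r]%classic : set R).
Implicit Types f g : R -> R.

Definition lipschitz_on f : Prop :=
  exists2 C : R, 0 <= C & forall t t', X t -> X t' ->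
    `|f t| <= C /\ `|f t - f t'| <= C * `|t - t'|.

Lemma lipschitz_on_id : lipschitz_on id.
Proof.
exists (`|r| + 1); first by rewrite addr_ge0.
move=> t t'; rewrite /= !in_itv /= => /andP[t1 t2] _; split.
  by rewrite ler_norml; have := ler_norm r; lra.
by rewrite ler_peMl// lerDr.
Qed.

Lemma lipschitz_on_lin (k : R) f g : lipschitz_on f -> lipschitz_on g ->
  lipschitz_on (fun t => k * f t + g t).
Proof.
move=> [C C0 hC] [K K0 hK]; exists (`|k| * C + K); first by rewrite addr_ge0 ?mulr_ge0.
move=> t t' Xt Xt'; have [h1 h2] := hC _ _ Xt Xt'; have [h3 h4] := hK _ _ Xt Xt'; split.
  by apply: le_trans (ler_normD _ _) _; rewrite normrM lerD ?ler_wpM2l.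
have -> : k * f t + g t - (k * f t' + g t') = k * (f t - f t') + (g t - g t') by ring.
apply: le_trans (ler_normD _ _) _; rewrite normrM mulrDl lerD// -mulrA.
by rewrite ler_wpM2l.
Qed.

Lemma lipschitz_on_cst (c : R) : lipschitz_on (fun=> c).
Proof.
exists `|c| => // t t' _ _; split=> //.
by rewrite subrr normr0 mulr_ge0.
Qed.

Lemma lipschitz_on_prod f g : lipschitz_on f -> lipschitz_on g ->
  lipschitz_on (fun t => f t * g t).
Proof.
move=> [C C0 hC] [K K0 hK]; exists (C * K + C * K); first by rewrite addr_ge0 ?mulr_ge0.
move=> t t' Xt Xt'; have [h1 h2] := hC _ _ Xt Xt'; have [h3 h4] := hK _ _ Xt Xt'.
have [h5 _] := hK _ _ Xt' Xt; split.
  rewrite normrM; apply: (@le_trans _ _ (C * K)); first by rewrite ler_pM.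
  by rewrite lerDl mulr_ge0.
have -> : f t * g t - f t' * g t' = f t * (g t - g t') + (f t - f t') * g t' by ring.
apply: le_trans (ler_normD _ _) _; rewrite !normrM mulrDl lerD//.
  by rewrite -mulrA ler_pM.
by rewrite mulrAC ler_pM.
Qed.

Lemma lipschitz_square_tensor f g : lipschitz_on f -> lipschitz_on g ->
  lipschitz_square r (fun t s => f t * g s).
Proof.
move=> [C C0 hC] [K K0 hK]; exists (C * K); first by rewrite mulr_ge0.
move=> t s t' s' Xt Xs Xt' Xs'; have [h1 h2] := hC _ _ Xt Xt'; have [h3 h4] := hK _ _ Xs Xs'.
have [h5 _] := hK _ _ Xs' Xs; split.
  by rewrite normrM ler_pM.
have -> : f t * g s - f t' * g s' = (f t - f t') * g s' + f t * (g s - g s') by ring.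
apply: le_trans (ler_normD _ _) _; rewrite !normrM mulrDr lerD//.
  by rewrite mulrAC ler_pM.
by rewrite -mulrA ler_pM.
Qed.

Lemma lipschitz_square_lin (k : R) (g1 g2 : R -> R -> R) :
  lipschitz_square r g1 -> lipschitz_square r g2 ->
  lipschitz_square r (fun t s => k * g1 t s + g2 t s).
Proof.
move=> [C C0 hC] [K K0 hK]; exists (`|k| * C + K); first by rewrite addr_ge0 ?mulr_ge0.
move=> t s t' s' Xt Xs Xt' Xs'.
have [h1 h2] := hC _ _ _ _ Xt Xs Xt' Xs'; have [h3 h4] := hK _ _ _ _ Xt Xs Xt' Xs'; split.
  by apply: le_trans (ler_normD _ _) _; rewrite normrM lerD ?ler_wpM2l.
have -> : k * g1 t s + g2 t s - (k * g1 t' s' + g2 t' s') =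
  k * (g1 t s - g1 t' s') + (g2 t s - g2 t' s') by ring.
apply: le_trans (ler_normD _ _) _; rewrite normrM mulrDl lerD// -mulrA.
by rewrite ler_wpM2l.
Qed.

Lemma lipschitz_square_sum I (l : seq I) (k : I -> R) (g : I -> R -> R -> R) :
  (forall i, lipschitz_square r (g i)) ->
  lipschitz_square r (fun t s => \sum_(i <- l) k i * g i t s).
Proof.
move=> hg; elim: l => [|i l IH].
  have := lipschitz_square_tensor (lipschitz_on_cst 0) (lipschitz_on_cst 0).
  congr lipschitz_square; apply/funext => t; apply/funext => s.
  by rewrite big_nil mulr0.
have := lipschitz_square_lin (k i) (hg i) IH; congr lipschitz_square.
by apply/funext => t; apply/funext => s; rewrite big_cons.
Qed.

End Lipschitz.

(** * Continuous complex functions on an interval *)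

Section ComplexContinuity.
Variable R : realType.

Lemma real_complexB (x y : R) : (x - y)%:C = x%:C - y%:C.
Proof. exact: rmorphB. Qed.

Lemma normr_modulus (z : R[i]) : `|z| = (modulus z)%:C.
Proof. by rewrite normc_def; case: z. Qed.

Lemma modulus_real (x : R) : modulus (x%:C) = `|x|.
Proof. by rewrite -[LHS]/(Num.sqrt (x ^+ 2 + 0 ^+ 2)) expr0n addr0 sqrtr_sqr. Qed.

Lemma ler_Re_modulus (z : R[i]) : `|complex.Re z| <= modulus z.
Proof.
by case: z => a b; rewrite -sqrtr_sqr ler_wsqrtr// lerDl sqr_ge0.
Qed.

Lemma ler_Im_modulus (z : R[i]) : `|complex.Im z| <= modulus z.
Proof.
by case: z => a b; rewrite -sqrtr_sqr ler_wsqrtr// lerDr sqr_ge0.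
Qed.

Lemma continuous_real_complex : continuous ((fun x : R => x%:C) : R -> Cfield R).
Proof.
move=> x; apply/(@cvgrPdist_lt (Cfield R) (Cfield R)) => e e0.
have [e' eE] : exists e' : R, e = e'%:C.
  by exists (complex.Re e); move: e0; case: (e) => a b; rewrite ltcE /= => /andP[/eqP -> _].
have e'0 : 0 < e' by move: e0; rewrite eE (ltcR 0).
near=> y.
rewrite eE -real_complexB normr_modulus ltcR modulus_real.
near: y; apply: (@cvgr_dist_lt R R) => //; exact: cvg_id.
Unshelve. all: end_near. Qed.

Lemma continuous_Re : continuous (@complex.Re R : Cfield R -> R).
Proof.
move=> x; have FF : Filter (nbhs (x : Cfield R)) by exact: nbhs_filter.
apply/(@cvgrPdist_lt R R (Cfield R) (nbhs (x : Cfield R)) FF) => e e0; near=> y.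
have -> : complex.Re x - complex.Re y = complex.Re (x - y) by case: (x) (y) => ? ? [].
apply: le_lt_trans (ler_Re_modulus _) _; rewrite -ltcR -normr_modulus.
near: y; apply: (@cvgr_dist_lt (Cfield R) (Cfield R)); first exact: cvg_id.
by rewrite (ltcR 0).
Unshelve. all: end_near. Qed.

Lemma continuous_Im : continuous (@complex.Im R : Cfield R -> R).
Proof.
move=> x; have FF : Filter (nbhs (x : Cfield R)) by exact: nbhs_filter.
apply/(@cvgrPdist_lt R R (Cfield R) (nbhs (x : Cfield R)) FF) => e e0; near=> y.
have -> : complex.Im x - complex.Im y = complex.Im (x - y) by case: (x) (y) => ? ? [].
apply: le_lt_trans (ler_Im_modulus _) _; rewrite -ltcR -normr_modulus.
near: y; apply: (@cvgr_dist_lt (Cfield R) (Cfield R)); first exact: cvg_id.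
by rewrite (ltcR 0).
Unshelve. all: end_near. Qed.

Lemma C_of_real (X : set R) (f : R -> R) : continuous f -> C_of X (fun t => (f t)%:C).
Proof.
move=> cf; rewrite /C_of /=; apply: continuous_subspaceT => x.
apply: (@continuous_comp R R (Cfield R) f (fun x : R => x%:C)); first exact: cf.
exact: continuous_real_complex.
Qed.

Definition clamp (a b t : R) : R := Num.max a (Num.min t b).

Lemma clamp_continuous (a b : R) : continuous (clamp a b).
Proof.
move=> t; apply: (@continuous_max R R (fun=> a) (fun t => Num.min t b) t); first exact: cvg_cst.
apply: (@continuous_min R R id (fun=> b) t); [exact: cvg_id|exact: cvg_cst].
Qed.

Lemma clamp_itv (a b t : R) : a <= b -> `[a, b]%classic (clamp a b t).
Proof.
by move=> ab; rewrite /= in_itv /= /clamp le_max lexx /= ge_max ab ge_min lexx orbT.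
Qed.

Lemma clamp_id (a b t : R) : `[a, b]%classic t -> clamp a b t = t.
Proof.
rewrite /= in_itv /= => /andP[at_ tb]; rewrite /clamp (min_idPl tb).
exact/max_idPr.
Qed.

(** A function that is continuous on an interval is extended continuously to
the line by precomposition with the retraction onto the interval. *)
Lemma continuous_comp_clamp (a b : R) (f : R -> R) : a <= b ->
  {within `[a, b], continuous f} -> continuous (f \o clamp a b).
Proof.
move=> ab /subspace_continuousP cf t.
have /cf H := clamp_itv t ab.
apply: cvg_trans H => P WP.
have W : \forall u \near t, `[a, b]%classic (clamp a b u) -> P (f (clamp a b u)).
  exact: (@clamp_continuous a b t _ WP).
suff : \forall u \near t, P (f (clamp a b u)) by [].
by apply: filterS W => u; apply; exact: clamp_itv.
Qed.

End ComplexContinuity.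

Lemma mulr_frac_le (R : realFieldType) (e k : R) : 0 < e -> 0 <= k -> e / (k + 1) * k <= e.
Proof.
move=> e0 k0; have k1 : 0 < k + 1 by rewrite ltr_wpDl.
by rewrite mulrAC ler_pdivrMr//; nra.
Qed.

Section ComplexContinuousFunctions.
Variables (R : realType) (a b : R).
Local Notation X := (`[a, b]%classic : set R).
Implicit Types f g : R -> R[i].

Lemma continuous_conjc : continuous (@conjc R : Cfield R -> Cfield R).
Proof.
move=> x; have FF : Filter (nbhs (x : Cfield R)) by exact: nbhs_filter.
apply/(@cvgrPdist_lt (Cfield R) (Cfield R) (Cfield R) (nbhs (x : Cfield R)) FF) => e e0; near=> y.
have -> : `|conjc x - conjc y| = `|(x - y : Cfield R)|.
  rewrite !normr_modulus -conjcN -conjcD; case: (x - y) => u v.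
  by rewrite -[modulus _]/(Num.sqrt (u ^+ 2 + (- v) ^+ 2)) sqrrN.
near: y; apply: (@cvgr_dist_lt (Cfield R) (Cfield R)); first exact: cvg_id.
exact: e0.
Unshelve. all: end_near. Qed.

Lemma C_of_cst (c : R[i]) : C_of X (fun=> c).
Proof. by rewrite /C_of /= => x; exact: (@cvg_cst (Cfield R)). Qed.

Lemma C_of_lin (c : R[i]) f g : C_of X f -> C_of X g -> C_of X (fun t => c * f t + g t).
Proof.
rewrite /C_of /= => cf cg x.
apply: (@cvgD (Cfield R) (Cfield R)); last exact: cg.
apply: (@cvgM (Cfield R)); [exact: (@cvg_cst (Cfield R))|exact: cf].
Qed.

Lemma C_of_mul f g : C_of X f -> C_of X g -> C_of X (fun t => f t * g t).
Proof.
rewrite /C_of /= => cf cg x; apply: (@cvgM (Cfield R)); [exact: cf|exact: cg].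
Qed.

Lemma C_of_conj f : C_of X f -> C_of X (fun t => conjc (f t)).
Proof.
move=> cf; apply: (@within_continuous_comp (Cfield R) R (Cfield R) X f (@conjc R)) cf.
by move=> x _; exact: continuous_conjc.
Qed.

Lemma C_of_Re f : C_of X f -> {within X, continuous (fun t => complex.Re (f t))}.
Proof.
move=> cf; apply: (@within_continuous_comp (Cfield R) R R X f (@complex.Re R)) cf.
by move=> x _; exact: continuous_Re.
Qed.

Lemma C_of_Im f : C_of X f -> {within X, continuous (fun t => complex.Im (f t))}.
Proof.
move=> cf; apply: (@within_continuous_comp (Cfield R) R R X f (@complex.Im R)) cf.
by move=> x _; exact: continuous_Im.
Qed.

Lemma C_of_bounded f : a <= b -> C_of X f ->
  exists2 M : R, 0 <= M & forall t, X t -> modulus (f t) <= M.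
Proof.
move=> ab cf; have [M1 M10 h1] := within_bounded ab (C_of_Re cf).
have [M2 M20 h2] := within_bounded ab (C_of_Im cf).
exists (M1 + M2); first by rewrite addr_ge0.
move=> t Xt; have := h1 t Xt; have := h2 t Xt; case: (f t) => u v /= hv hu.
apply: le_trans (lerD hu hv).
rewrite -(@ler_pXn2r _ 2) ?nnegrE ?addr_ge0 ?modulus_ge0// sqr_modulus /=.
rewrite -(real_normK (num_real u)) -(real_normK (num_real v)).
by have := normr_ge0 u; have := normr_ge0 v; nra.
Qed.

Lemma supnorm_ge f t : a <= b -> C_of X f -> X t -> modulus (f t) <= supnorm X f.
Proof.
move=> ab cf Xt; have [M _ hM] := C_of_bounded ab cf.
apply: ub_le_sup; last by exists t.
by exists M => _ [u Xu <-]; exact: hM.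
Qed.

Lemma supnorm_le f (M : R) : a <= b -> (forall t, X t -> modulus (f t) <= M) ->
  supnorm X f <= M.
Proof.
move=> ab hM; apply: ge_sup; last by move=> _ [u Xu <-]; exact: hM.
by exists (modulus (f a)), a => //; rewrite /= in_itv /= lexx.
Qed.

End ComplexContinuousFunctions.

(** * C*-algebras of operators *)

Section CstarAlgebras.
Variables (R : realType) (G : choiceType).
Implicit Types (F B : set (operator R G)).

Lemma cstar_bounded : cstar_algebra (@bounded_operator R G).
Proof.
split=> //.
- exact: bounded_operator_id.
- by move=> c S T; exact: bounded_operatorD.
- by move=> S T; exact: bounded_operator_comp.
- by split=> // T; exact: adjoint_bounded.
Qed.

Lemma cstar_generated_min F B : cstar_algebra B -> F `<=` B ->
  cstar_generated F `<=` B.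
Proof. by move=> cB FB T; apply; split. Qed.

Lemma cstar_generated_closed F (T : operator R G) : bounded_operator T ->
  (forall e : R, 0 < e -> exists2 S, cstar_generated F S & opnorm (T - S) < e) ->
  cstar_generated F T.
Proof.
move=> bT hT B [cB FB]; have [_ _ _ _ [_ cl]] := cB; apply: cl => // e e0.
by have [S FS Se] := hT e e0; exists S => //; apply: FS.
Qed.

(** Since A is self-adjoint, the adjoint of an operator that commutes with A
commutes with A. *)
Lemma cstar_commuting (A : operator R G) : bounded_operator A -> is_adjoint A A ->
  cstar_algebra [set T | bounded_operator T /\ forall xi, T (A xi) = A (T xi)].
Proof.
move=> bA sA; split.
- by move=> T [].
- by split=> //; exact: bounded_operator_id.
- move=> c S T [bS hS] [bT hT]; split; first exact: bounded_operatorD.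
  by move=> xi; rewrite !op_linE hS hT (linD _ _ bA.1) (linZ _ _ bA.1).
- move=> S T [bS hS] [bT hT]; split; first exact: bounded_operator_comp.
  by move=> xi /=; rewrite hT hS.
split=> [T [bT hT]|T bT hT].
  split; first exact: adjoint_bounded.
  have aT := is_adjointC (is_adjointP bT).
  move=> xi; apply: ell2_eqP => g; rewrite -!inner_deltar.
  by rewrite [LHS]aT [LHS]sA -hT -[LHS]aT -[LHS]sA.
split=> // xi; apply/eqP; rewrite -subr_eq0; apply/eqP; apply: l2norm_small => e e0.
have [a a0 ha] := bounded_operatorW bA.
pose k := l2norm (A xi) + a * l2norm xi.
have k0 : 0 <= k by rewrite addr_ge0 ?mulr_ge0 ?l2norm_ge0.
have e1 : 0 < e / (k + 1) by rewrite divr_gt0// ltr_wpDl.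
have [S [bS hS] Se] := hT _ e1.
have bTS : bounded_operator (T - S).
  by rewrite addrC -scaleN1r; exact: bounded_operatorD.
have E x : (T - S) x = T x - S x by [].
have -> : T (A xi) - A (T xi) = (T - S) (A xi) - A ((T - S) xi).
  by rewrite !E (linB _ _ bA.1) hS opprB addrA subrK.
apply: le_trans (l2normB _ _) _.
apply: (@le_trans _ _ (opnorm (T - S) * k)).
  rewrite mulrDr; apply: lerD; first exact: opnormP.
  by apply: le_trans (ha _) _; rewrite mulrCA ler_wpM2l// opnormP.
apply: (@le_trans _ _ (e / (k + 1) * k)); first by rewrite ler_wpM2r// ltW.
exact: mulr_frac_le.
Qed.

End CstarAlgebras.

(** * Continuous functions of the Laplacian *)

Section PhiCalculus.
Variables (R : realType) (N : nat).
Hypothesis hN : (2 <= N)%N.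
Local Notation G := (free_group N).
Local Notation X := (@chi1_spectrum R N).
Local Notation chi := (@chi1 R N).
Variable Phi : (R -> R[i]) -> operator R G.
Hypothesis hPhi : C_of_isomorphism X (cstar_generated [set idfun; chi]%classic) Phi.
Hypothesis hPhi_chi1 : Phi (fun t : R => t%:C) = chi.
Implicit Types (f g a b : R -> R) (xi eta zeta : ell2 R G).

Definition radius : R := 2 * Num.sqrt ((2 * N)%:R - 1).

Lemma radius_gt0 : 0 < radius.
Proof.
rewrite /radius mulr_gt0// sqrtr_gt0 subr_gt0 ltr1n; lia.
Qed.

Lemma spectrumE : X = `[- radius, radius]%classic. Proof. by []. Qed.

Let rle : - radius <= radius.
Proof. by rewrite ge0_cp// ltW// radius_gt0. Qed.

Lemma spectrum0 : X 0.
Proof. by rewrite spectrumE /= in_itv /= oppr_le0 ltW// radius_gt0. Qed.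

Lemma spectrumP t : X t -> `|t| <= radius.
Proof. by rewrite spectrumE /= in_itv /= ler_norml. Qed.

Lemma cstar_generators_bounded : [set idfun; chi]%classic `<=` @bounded_operator R G.
Proof. by move=> _ [->|->]; [exact: bounded_operator_id|exact: chi1_bounded]. Qed.

Lemma Phi_mem (f : R -> R[i]) : C_of X f -> cstar_generated [set idfun; chi]%classic (Phi f).
Proof. by move=> cf; rewrite -(Phi_image hPhi); exists f. Qed.

Lemma Phi_bounded (f : R -> R[i]) : C_of X f -> bounded_operator (Phi f).
Proof.
move=> cf; apply: (cstar_generated_min (@cstar_bounded R G) cstar_generators_bounded).
exact: Phi_mem.
Qed.

Lemma C_of_sub (f g : R -> R[i]) : C_of X f -> C_of X g -> C_of X (fun t => f t - g t).
Proof.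
move=> cf cg; have := C_of_lin (c := -1) cg cf; congr (C_of X _).
by apply/funext => t; rewrite mulN1r addrC.
Qed.

Lemma Phi_sub (f g : R -> R[i]) : C_of X f -> C_of X g ->
  Phi (fun t => f t - g t) = Phi f - Phi g.
Proof.
move=> cf cg; rewrite addrC -scaleN1r -(Phi_linear hPhi)//.
by congr Phi; apply/funext => t; rewrite mulN1r addrC.
Qed.

Lemma Phi_norm_le (f : R -> R[i]) (M : R) xi : C_of X f ->
  (forall t, X t -> modulus (f t) <= M) -> l2norm (Phi f xi) <= M * l2norm xi.
Proof.
move=> cf hM; apply: le_trans (opnormP _ (Phi_bounded cf)) _.
by rewrite ler_wpM2r ?l2norm_ge0// (Phi_isometry hPhi)//; exact: supnorm_le.
Qed.

Lemma Phi_ext (f g : R -> R[i]) : C_of X f -> C_of X g ->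
  (forall t, X t -> f t = g t) -> Phi f = Phi g.
Proof.
move=> cf cg fg; apply/funext => xi; apply/eqP; rewrite -subr_eq0.
have -> : Phi f xi - Phi g xi = Phi (fun t => f t - g t) xi by rewrite Phi_sub.
apply/eqP; apply: l2norm0_eq0; apply/eqP; rewrite eq_le l2norm_ge0 andbT.
rewrite -(mul0r (l2norm xi)); apply: Phi_norm_le => [|t Xt].
  exact: C_of_sub.
by rewrite fg// subrr Normc.normc0.
Qed.

(** * Polynomials are dense in C(X) *)

Lemma C_of_id : C_of X (fun t => t%:C).
Proof. by apply: (@C_of_real R X id) => x; exact: cvg_id. Qed.

Lemma C_of_poly (p : {poly R[i]}) : C_of X (fun t => p.[t%:C]).
Proof.
elim/poly_ind: p => [|p c IH].
  have := @C_of_cst R (- radius) radius 0; congr (C_of _ _).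
  by apply/funext => t; rewrite horner0.
have := C_of_lin (c := 1) (C_of_mul IH C_of_id) (@C_of_cst R (- radius) radius c); congr (C_of _ _).
by apply/funext => t; rewrite hornerMXaddC mul1r.
Qed.

Definition poly_approximable (f : R -> R[i]) := forall e : R, 0 < e ->
  exists p : {poly R[i]}, forall t, X t -> modulus (f t - p.[t%:C]) <= e.

Lemma modulus_add (x y : R[i]) : modulus (x + y) <= modulus x + modulus y.
Proof. exact: le_normcD. Qed.

Lemma cstar_poly_approximable : cstar_algebra
  [set T | exists f : R -> R[i], [/\ C_of X f, T = Phi f & poly_approximable f]].
Proof.
split.
- by move=> T [f [cf -> _]]; exact: Phi_bounded.
- exists (fun=> 1); split; [exact: C_of_cst|by rewrite (Phi_one hPhi)|].
  by move=> e e0; exists 1 => t _; rewrite hornerC subrr Normc.normc0 ltW.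
- move=> c S T [f [cf -> pf]] [g [cg -> pg]].
  exists (fun t => c * f t + g t); split; [exact (C_of_lin cf cg)|exact (esym (Phi_linear hPhi c cf cg))|].
  move=> e e0; have e2 : 0 < e / 2 by rewrite divr_gt0.
  have e1 : 0 < e / 2 / (modulus c + 1) by rewrite divr_gt0// ltr_wpDl// modulus_ge0.
  have [p hp] := pf _ e1; have [q hq] := pg _ e2; exists (c *: p + q) => t Xt.
  rewrite hornerD hornerZ.
  have -> : c * f t + g t - (c * p.[t%:C] + q.[t%:C]) =
    c * (f t - p.[t%:C]) + (g t - q.[t%:C]) by ring.
  apply: le_trans (modulus_add _ _) _; rewrite [leRHS](splitr e) lerD ?hq//.
  rewrite Normc.normcM; apply: le_trans (mulr_frac_le e2 (modulus_ge0 c)).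
  by rewrite [leRHS]mulrC ler_wpM2l ?modulus_ge0// hp.
- move=> S T [f [cf -> pf]] [g [cg -> pg]].
  exists (fun t => f t * g t); split; [exact (C_of_mul cf cg)|exact (esym (Phi_mul hPhi cf cg))|].
  move=> e e0; have e2 : 0 < e / 2 by rewrite divr_gt0.
  have [M M0 hM] := C_of_bounded rle cf.
  have e1 : 0 < e / 2 / (M + 1) by rewrite divr_gt0// ltr_wpDl.
  have [q hq] := pg _ e1.
  have [L L0 hL] := C_of_bounded rle (C_of_poly (p := q)).
  have e3 : 0 < e / 2 / (L + 1) by rewrite divr_gt0// ltr_wpDl.
  have [p hp] := pf _ e3; exists (p * q) => t Xt; rewrite hornerM.
  have -> : f t * g t - p.[t%:C] * q.[t%:C] =
    f t * (g t - q.[t%:C]) + (f t - p.[t%:C]) * q.[t%:C] by ring.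
  apply: le_trans (modulus_add _ _) _; rewrite [leRHS](splitr e) !Normc.normcM.
  apply: lerD.
    apply: le_trans (mulr_frac_le e2 M0); rewrite [leRHS]mulrC.
    by apply: ler_pM; rewrite ?modulus_ge0 ?hM ?hq.
  apply: le_trans (mulr_frac_le e2 L0).
  by apply: ler_pM; rewrite ?modulus_ge0 ?hp ?hL.
split.
  move=> T [f [cf -> pf]]; exists (fun t => conjc (f t)); split.
  - exact: C_of_conj.
  - by rewrite (Phi_conj hPhi).
  move=> e e0; have [p hp] := pf _ e0; exists (map_poly (@conjc R) p) => t Xt.
  rewrite -[t%:C]conjc_real horner_map /= -conjcN -conjcD.
  apply: le_trans (hp t Xt); case: (f t - _) => u v.
  by rewrite -[modulus (conjc _)]/(Num.sqrt (u ^+ 2 + (- v) ^+ 2)) sqrrN.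
move=> T bT hT.
have gT : cstar_generated [set idfun; chi]%classic T.
  apply: cstar_generated_closed => // e e0; have [S [f [cf -> _]] Se] := hT e e0.
  by exists (Phi f) => //; exact: Phi_mem.
move: gT hT; rewrite -(Phi_image hPhi) => -[f cf <-] hT.
exists f; split=> // e e0; have e2 : 0 < e / 2 by rewrite divr_gt0.
have [_ [g [cg -> pg]] hg] := hT _ e2; have [p hp] := pg _ e2.
exists p => t Xt.
have -> : f t - p.[t%:C] = (f t - g t) + (g t - p.[t%:C]) by ring.
apply: le_trans (modulus_add _ _) _; rewrite [leRHS](splitr e) lerD ?hp//.
have cfg : C_of X (fun t => f t - g t).
  exact: C_of_sub.
move: hg; rewrite -Phi_sub// (Phi_isometry hPhi)// => /ltW; apply: le_trans.
exact: (supnorm_ge rle cfg).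
Qed.

(** The uniform limits of polynomials are mapped by Phi onto a C*-algebra, which
contains the generators of the image of C(X), hence is all of it. *)
Lemma C_of_approximable (f : R -> R[i]) : C_of X f -> poly_approximable f.
Proof.
move=> cf.
have gens : [set idfun; chi]%classic `<=`
    [set T | exists f : R -> R[i], [/\ C_of X f, T = Phi f & poly_approximable f]].
  move=> _ [->|->].
    exists (fun=> 1); split; [exact: C_of_cst|by rewrite (Phi_one hPhi)|].
    by move=> e e0; exists 1 => t _; rewrite hornerC subrr Normc.normc0 ltW.
  exists (fun t => t%:C); split; [exact C_of_id|exact (esym hPhi_chi1)|].
  by move=> e e0; exists 'X => t _; rewrite hornerX subrr Normc.normc0 ltW.
have [g [cg fg pg]] := cstar_generated_min cstar_poly_approximable gens (Phi_mem cf).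
move=> e e0; have [p hp] := pg e e0; exists p => t Xt.
suff -> : f t = g t by exact: hp.
have cfg : C_of X (fun t => f t - g t).
  exact: C_of_sub.
have := supnorm_ge rle cfg Xt; rewrite -(Phi_isometry hPhi)// Phi_sub// fg subrr.
have -> : opnorm (0 : operator R G) = 0.
  apply/eqP; rewrite eq_le opnorm_ge0 andbT; apply: opnorm_le => // xi.
  by rewrite mul0r -[_ xi]/(0 : ell2 R G) l2norm0.
move=> H; apply/eqP; rewrite -subr_eq0; apply/eqP/Normc.eq0_normc/eqP.
by rewrite eq_le H modulus_ge0.
Qed.

Lemma real_complexX (x : R) n : (x ^+ n)%:C = x%:C ^+ n.
Proof. exact: rmorphXn. Qed.

Lemma real_poly_approx f (e : R) : continuous f -> 0 < e ->
  exists p : {poly R}, forall t, X t -> `|f t - p.[t]| <= e.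
Proof.
move=> cf e0; have [p hp] := C_of_approximable (C_of_real (X := X) cf) e0.
exists (map_poly (@complex.Re R) p) => t Xt.
have -> : (map_poly (@complex.Re R) p).[t] = complex.Re p.[t%:C].
  have -> : map_poly (@complex.Re R) p = \poly_(i < size p) complex.Re p`_i by [].
  rewrite horner_poly [p.[_]]horner_coef (big_morph (@complex.Re R) (id1 := 0) (op1 := +%R)) //.
    by apply: eq_bigr => i _; rewrite -real_complexX; case: (p`_i) => u v /=; rewrite mulr0 subr0.
  by move=> [? ?] [? ?].
have -> : f t - complex.Re p.[t%:C] = complex.Re ((f t)%:C - p.[t%:C]) by case: (p.[_]).
by apply: le_trans (ler_Re_modulus _) _; exact: hp.
Qed.

(** * Real functions of the Laplacian, acting on the left and on the right *)

Definition PhiR f : operator R G := Phi (fun t => (f t)%:C).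

Lemma PhiR_bounded f : continuous f -> bounded_operator (PhiR f).
Proof. by move=> cf; apply: Phi_bounded; exact: C_of_real. Qed.

Lemma PhiR_adjoint f : continuous f -> is_adjoint (PhiR f) (PhiR f).
Proof.
move=> cf; have cf' := C_of_real (X := X) cf.
have := is_adjointP (PhiR_bounded cf); rewrite /PhiR -(Phi_conj hPhi)//.
by congr (is_adjoint _ (Phi _)); apply/funext => t; exact: conjc_real.
Qed.

Lemma PhiR_lin (k : R) f g xi : continuous f -> continuous g ->
  PhiR (fun t => k * f t + g t) xi = k%:C *: PhiR f xi + PhiR g xi.
Proof.
move=> cf cg; have cf' := C_of_real (X := X) cf; have cg' := C_of_real (X := X) cg.
rewrite -op_linE /PhiR -(Phi_linear hPhi k%:C cf' cg'); congr (Phi _ xi).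
by apply/funext => t; rewrite real_complexD real_complexM.
Qed.

Lemma PhiR_mul f g xi : continuous f -> continuous g ->
  PhiR (fun t => f t * g t) xi = PhiR f (PhiR g xi).
Proof.
move=> cf cg; have cf' := C_of_real (X := X) cf; have cg' := C_of_real (X := X) cg.
rewrite -[RHS]/((PhiR f \o PhiR g) xi) /PhiR -(Phi_mul hPhi cf' cg'); congr (Phi _ xi).
by apply/funext => t; rewrite real_complexM.
Qed.

Lemma PhiR1 xi : PhiR (fun=> 1) xi = xi.
Proof. by rewrite /PhiR (Phi_one hPhi). Qed.

Lemma PhiR_id xi : PhiR id xi = chi xi.
Proof. by rewrite /PhiR hPhi_chi1. Qed.

Lemma PhiR_norm_le f (M : R) xi : continuous f -> (forall t, X t -> `|f t| <= M) ->
  l2norm (PhiR f xi) <= M * l2norm xi.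
Proof.
move=> cf hM; apply: Phi_norm_le; first exact: C_of_real.
by move=> t Xt; rewrite modulus_real hM.
Qed.

Lemma PhiR_commuting (A : operator R G) f xi : bounded_operator A -> is_adjoint A A ->
  (forall eta, chi (A eta) = A (chi eta)) -> continuous f ->
  PhiR f (A xi) = A (PhiR f xi).
Proof.
move=> bA sA cA cf.
have gens : [set idfun; chi]%classic `<=`
    [set T | bounded_operator T /\ forall eta, T (A eta) = A (T eta)].
  by move=> T gT; split; [exact: cstar_generators_bounded|case: gT => ->].
have [_] := cstar_generated_min (cstar_commuting bA sA) gens (Phi_mem (C_of_real (X := X) cf)).
exact.
Qed.

(** The left action of C(X) commutes with the right one, because the left
convolution by the generator commutes with the right one. *)
Lemma PhiR_right_commute f g xi : continuous f -> continuous g ->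
  PhiR f (right_copy (PhiR g) xi) = right_copy (PhiR g) (PhiR f xi).
Proof.
move=> cf cg; apply: PhiR_commuting => //.
- by apply: right_copy_bounded; exact: PhiR_bounded.
- by apply: right_copy_adjoint; exact: PhiR_adjoint.
move=> eta; rewrite -[in LHS](modular_conjK (chi _)) -[X in modular_conj (modular_conj X)]/(chi (right_copy (PhiR g) eta)).
have E x : right_copy chi (PhiR g x) = PhiR g (right_copy chi x).
  rewrite (@PhiR_commuting (right_copy chi) g x)//.
  - by apply: right_copy_bounded; exact: chi1_bounded.
  - by apply: right_copy_adjoint; exact: chi1_adjoint.
  - by move=> y; have := congr1 (fun T => T y) (@chi1_right_commute R N).
have := E (modular_conj eta); rewrite /right_copy modular_conjK.
by move=> ->.
Qed.

(** * The bimodule functional of a vector *)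

(** The functional a, b |-> <a zeta b, zeta>; it is real for real a and b by
bimod_inner. *)
Definition bimod (zeta : ell2 R G) a b : R :=
  rinner (PhiR a (right_copy (PhiR b) zeta)) zeta.

Lemma right_PhiR_lin (k : R) f g xi : continuous f -> continuous g ->
  right_copy (PhiR (fun t => k * f t + g t)) xi =
  k%:C *: right_copy (PhiR f) xi + right_copy (PhiR g) xi.
Proof.
by move=> cf cg; rewrite /right_copy PhiR_lin// modular_conjD modular_conjZ conjc_real.
Qed.

Lemma bimod_linl zeta (k : R) f g b : continuous f -> continuous g ->
  bimod zeta (fun t => k * f t + g t) b = k * bimod zeta f b + bimod zeta g b.
Proof. by move=> cf cg; rewrite /bimod PhiR_lin// rinnerDl rinnerZl. Qed.

Lemma bimod_linr zeta (k : R) a f g : continuous a -> continuous f -> continuous g ->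
  bimod zeta a (fun t => k * f t + g t) = k * bimod zeta a f + bimod zeta a g.
Proof.
move=> ca cf cg; have lP := (PhiR_bounded ca).1.
by rewrite /bimod right_PhiR_lin// linD// linZ// rinnerDl rinnerZl.
Qed.

Lemma right_PhiR_norm_le f (M : R) xi : continuous f -> (forall t, X t -> `|f t| <= M) ->
  l2norm (right_copy (PhiR f) xi) <= M * l2norm xi.
Proof.
move=> cf hM; rewrite /right_copy modular_conj_norm -(modular_conj_norm xi).
exact: PhiR_norm_le.
Qed.

Lemma spectrum_bound_ge0 f (M : R) : (forall t, X t -> `|f t| <= M) -> 0 <= M.
Proof. by move=> /(_ 0 spectrum0); apply: le_trans. Qed.

Lemma bimod_inner_le (A B : R) a b xi eta : continuous a -> continuous b ->
  (forall t, X t -> `|a t| <= A) -> (forall t, X t -> `|b t| <= B) ->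
  `|rinner (PhiR a (right_copy (PhiR b) xi)) eta| <= A * B * (l2norm xi * l2norm eta).
Proof.
move=> ca cb hA hB; apply: le_trans (rinner_cauchy _ _) _.
rewrite mulrA ler_wpM2r ?l2norm_ge0// -mulrA.
apply: le_trans (PhiR_norm_le _ ca hA) _; rewrite ler_wpM2l ?(spectrum_bound_ge0 hA)//.
exact: right_PhiR_norm_le.
Qed.

Lemma bimod_le (A B : R) a b zeta : continuous a -> continuous b ->
  (forall t, X t -> `|a t| <= A) -> (forall t, X t -> `|b t| <= B) ->
  `|bimod zeta a b| <= A * B * l2norm zeta ^+ 2.
Proof. by move=> ca cb hA hB; rewrite expr2; exact: bimod_inner_le. Qed.

Lemma bimod_inner zeta a b : continuous a -> continuous b ->
  inner (PhiR a (right_copy (PhiR b) zeta)) zeta = (bimod zeta a b)%:C.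
Proof.
move=> ca cb; rewrite /bimod /rinner; set z := inner _ _.
suff : conjc z = z.
  case: z => u v [] /eqP; rewrite -subr_eq0 -opprD oppr_eq0 -mulr2n mulrn_eq0 /=.
  by move/eqP => ->.
rewrite /z -inner_conj -(PhiR_adjoint ca zeta (right_copy (PhiR b) zeta)).
rewrite -(right_copy_adjoint (PhiR_adjoint cb) (PhiR a zeta) zeta).
by rewrite -(PhiR_right_commute zeta ca cb).
Qed.

(** Both actions are self-adjoint and they commute, so that one factor of each
square can be moved to the other side of the inner product. *)
Lemma bimod_sqr zeta a b : continuous a -> continuous b ->
  bimod zeta (fun t => a t * a t) (fun t => b t * b t) =
  l2norm (PhiR a (right_copy (PhiR b) zeta)) ^+ 2.
Proof.
move=> ca cb; rewrite /bimod PhiR_mul// -rinner_norm /rinner.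
have -> : right_copy (PhiR (fun t => b t * b t)) zeta =
    right_copy (PhiR b) (right_copy (PhiR b) zeta).
  by rewrite /right_copy PhiR_mul// modular_conjK.
set B := right_copy (PhiR b).
rewrite (PhiR_adjoint ca (PhiR a (B (B zeta))) zeta) (PhiR_right_commute (B zeta) ca cb).
rewrite (right_copy_adjoint (PhiR_adjoint cb) (PhiR a (B zeta)) (PhiR a zeta)).
by rewrite -/B (PhiR_right_commute zeta ca cb).
Qed.

(** * Spherical polynomials *)

(** The orthogonal polynomials of the trace: spol n evaluated at the Laplacian is
the sum of all words of length n. *)
Fixpoint spol (n : nat) (t : R) : R :=
  match n with
  | 0 => 1
  | n1.+1 => match n1 with
             | 0 => t
             | n2.+1 => spol n1 t * t - (gen_count N n2)%:R * spol n2 t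
             end
  end.

Arguments spol : simpl never.

Lemma spolS n t : spol n.+2 t = spol n.+1 t * t - (gen_count N n)%:R * spol n t.
Proof. by []. Qed.

Lemma continuous_id : continuous (@id R).
Proof. by move=> x; exact: cvg_id. Qed.

Lemma continuous_lin (k : R) f g : continuous f -> continuous g ->
  continuous (fun t => k * f t + g t).
Proof.
move=> cf cg x; apply: (@cvgD R R); last exact: cg.
by apply: (@cvgM R); [exact: (@cvg_cst R)|exact: cf].
Qed.

Lemma continuous_prod f g : continuous f -> continuous g ->
  continuous (fun t => f t * g t).
Proof. by move=> cf cg x; apply: (@cvgM R); [exact: cf|exact: cg]. Qed.

Lemma continuous_const (c : R) : continuous (fun _ : R => c).
Proof. by move=> x; exact: (@cvg_cst R). Qed.

Lemma spol_continuous n : continuous (spol n).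
Proof.
suff: continuous (spol n) /\ continuous (spol n.+1) by case.
elim: n => [|n [IH1 IH2]].
  by split; [exact: (@continuous_const 1)|exact: continuous_id].
split=> //.
have -> : spol n.+2 = fun t => (- (gen_count N n)%:R) * spol n t + spol n.+1 t * t.
  by apply/funext => t; rewrite spolS addrC mulNr.
exact (continuous_lin IH1 (continuous_prod IH2 continuous_id)).
Qed.

Lemma PhiR_spolS n xi : PhiR (spol n.+2) xi =
  - (gen_count N n)%:R%:C *: PhiR (spol n) xi + PhiR (spol n.+1) (chi xi).
Proof.
have -> : spol n.+2 = fun t => (- (gen_count N n)%:R) * spol n t + spol n.+1 t * t.
  by apply/funext => t; rewrite spolS addrC mulNr.
have c1 := @spol_continuous n; have c2 := @spol_continuous n.+1.
have := PhiR_lin (- (gen_count N n)%:R) xi c1 (continuous_prod c2 continuous_id).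
by rewrite PhiR_mul// ?PhiR_id ?real_complexN//; exact: continuous_id.
Qed.

Lemma PhiR_spol0 xi : PhiR (spol 0) xi = xi. Proof. exact: PhiR1. Qed.

Lemma PhiR_spol1 xi : PhiR (spol 1) xi = chi xi. Proof. exact: PhiR_id. Qed.

(** Both sides obey the recursion sphereS. *)
Lemma PhiR_spol n xi h : PhiR (spol n) xi h = sphere n xi h.
Proof.
suff: forall xi h, PhiR (spol n) xi h = sphere n xi h /\
    PhiR (spol n.+1) xi h = sphere n.+1 xi h by move=> /(_ xi h)[].
elim: n => [|n IH] {}xi {}h.
  by rewrite PhiR_spol0 PhiR_spol1 chi1E sphere0 sphere1.
split; first exact: (IH xi h).2.
rewrite PhiR_spolS ell2_addE ell2_scaleE (IH xi h).1 (IH (chi xi) h).2 sphereS.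
have -> : (chi xi : G -> R[i]) = lap xi by apply/funext => k; rewrite chi1E.
rewrite [LHS]addrC mulNr -[in RHS]mulr_natl (_ : (gen_count N n)%:R%:C = (gen_count N n)%:R)//.
exact: (rmorph_nat (real_complex R)).
Qed.

Lemma sphere_delta m (g h : G) :
  sphere m (delta R g) h = (size (word (g * h^-1)%g) == m)%:R.
Proof.
rewrite -[RHS](mulr_natl _) mulr1 -[RHS]/(1 *+ _) -[RHS]sumw_single /sphere.
apply: eq_sumw => w _; rewrite deltaE -mulrnA mulnb; congr (_ *+ nat_of_bool _).
apply/andP/eqP => [[/eqP e rw]|->].
  by rewrite -e mulgK word_wprod.
by rewrite wprod_word mulgVK eqxx; split=> //; exact: reducedP.
Qed.

(** Relates the two-sided action to the counts of coef_near_radial. *)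
Lemma sphere_coef n m (g h : G) :
  PhiR (spol n) (right_copy (PhiR (spol m)) (delta R g)) h = (coef R n m g h)%:C.
Proof.
rewrite PhiR_spol /coef /sphere (@sumw_morph N R R[i] (real_complex R)) //; last first.
  by move=> x y; rewrite real_complexD.
apply: eq_sumw => w _; rewrite /comp /right_copy modular_conjE PhiR_spol.
have -> : (modular_conj (delta R g) : G -> R[i]) = delta R g^-1%g.
  apply/funext => k; rewrite modular_conjE !deltaE conjc_nat.
  by rewrite -(inj_eq (can_inj (@invgK G))) invgK.
rewrite sphere_delta conjc_nat invgK.
by case: (reduced w); case: eqP.
Qed.

Definition sphere_card n : R := sumw n (fun w : seq (letter N) => (reduced w)%:R).

Lemma sphere_cardS n : sphere_card n.+1 = (gen_count N n)%:R * sphere_card n.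
Proof.
rewrite /sphere_card sumwMl /= -sumw_sum; apply: eq_sumw => w sw.
case rw : (reduced w); first by rewrite (sum_prolong (1 : R) rw) sw mulr1.
rewrite mulr0 big1// => x _; by rewrite reduced_cons rw.
Qed.

Lemma sphere_card_ge n : 3 ^+ n <= sphere_card n.
Proof.
elim: n => [|n IH]; first by rewrite /sphere_card /= lexx.
rewrite sphere_cardS exprS ler_pM ?exprn_ge0// ler_nat /gen_count; case: n {IH} => [|n]; lia.
Qed.

Lemma sphere_card_gt0 n : 0 < sphere_card n.
Proof. by apply: lt_le_trans (sphere_card_ge n); rewrite exprn_gt0. Qed.

Lemma spol_inner n m : rinner (PhiR (spol n) (PhiR (spol m) (delta R 1%g))) (delta R 1%g) =
  if n == m then sphere_card n else 0.
Proof.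
rewrite /rinner inner_deltar PhiR_spol /sphere.
rewrite (@sumw_morph N R[i] R (@complex.Re R))//; last by move=> [? ?] [? ?].
rewrite (@eq_sumw _ _ _ _ (fun w => (n == m)%:R * (reduced w)%:R)); last first.
  move=> w sw /=; rewrite PhiR_spol mulg1 sphere_delta mul1g size_word_inv.
  case rw : (reduced w); rewrite ?mulr0n ?mulr0//.
  by rewrite word_wprod// sw; case: eqP; rewrite ?mulr1.
by rewrite -sumwMl -/(sphere_card n); case: eqP => _; rewrite ?mul1r ?mul0r.
Qed.

(** * Vectors orthogonal to the masa *)

Lemma spol_masa n : @laplacian_masa R N (PhiR (spol n)).
Proof.
move=> B [[vB _] chiB]; have [Bb _ <-] := vB.
have Bchi : B chi by exact: chiB.
split; first by apply: PhiR_bounded; exact: spol_continuous.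
move=> S [bS cS]; apply/funext => xi; rewrite /=.
have cchi x : chi (S x) = S (chi x) by have := congr1 (fun T => T x) (cS _ Bchi).
suff: forall xi, PhiR (spol n) (S xi) = S (PhiR (spol n) xi) /\ PhiR (spol n.+1) (S xi) = S (PhiR (spol n.+1) xi) by move=> /(_ xi)[].
elim: n => [|n IH] {}xi; first by rewrite !PhiR_spol0 !PhiR_spol1 cchi.
split; first exact: (IH xi).2.
by rewrite !PhiR_spolS (IH xi).1 cchi (IH (chi xi)).2 (linD _ _ bS.1) (linZ _ _ bS.1).
Qed.

(** The sum over a sphere is the inner product with an element of the masa. *)
Lemma orthogonal_sphere_sum zeta n :
  orthogonal_complement (L2_subalgebra (@laplacian_masa R N)) zeta ->
  sphere n zeta 1%g = 0.
Proof.
move=> Hz; have : inner zeta (PhiR (spol n) (delta R 1%g)) = 0.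
  apply: Hz => e e0; exists (PhiR (spol n)); first exact: spol_masa.
  by rewrite subrr l2norm0.
by rewrite -(PhiR_adjoint (@spol_continuous n)) inner_deltar PhiR_spol.
Qed.

(** The double commutant of the Laplacian is a von Neumann algebra inside
L(F_N), so it contains the masa. *)
Lemma masa_double_commutant :
  @laplacian_masa R N `<=` commutant (commutant [set chi]%classic).
Proof.
have trip (M : set (operator R G)) : M `<=` @bounded_operator R G ->
    commutant (commutant (commutant M)) = commutant M.
  move=> bM; apply/seteqP; split => T [bT cT]; split=> // S MS.
    apply: cT; split; first exact: bM.
    by move=> U [bU cU]; rewrite cU.
  by case: MS => bS cS; rewrite cS.
move=> T AT; apply: AT; split; last first.
  by move=> _ ->; split; [exact: chi1_bounded|move=> S [_ cS]; rewrite cS].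
split; last first.
  move=> S [bS cS] M [[bM _ MM] tM].
  have Mchi U : commutant M U -> U \o chi = chi \o U.
    move=> [bU cU]; apply/funext => xi; rewrite /comp chi1_letters !sum_opE (lin_sum _ _ _ bU.1).
    apply: eq_bigr => x _.
    have Mx : M (left_translation (letg x)^-1%g) by apply: tM; exists (letg x)^-1%g.
    by have := congr1 (fun V => V xi) (cU _ Mx).
  rewrite -MM; split=> // U cU; apply: cS; split; first by case: cU.
  by move=> _ ->; exact: Mchi.
split.
- by move=> S [].
- move=> S [bS cS]; split; first exact: adjoint_bounded.
  move=> U [bU cU].
  have aU : commutant [set chi]%classic (adjoint U).
    split; first exact: adjoint_bounded.
    move=> _ ->; apply/funext => xi; rewrite /comp; apply: ell2_eqP => g; rewrite -!inner_deltar.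
    have aUU := is_adjointC (is_adjointP bU).
    have cx y : U (chi y) = chi (U y) by have := congr1 (fun V => V y) (cU _ erefl).
    by rewrite (aUU (chi xi)) (@chi1_adjoint R N xi) -cx -(aUU xi) -(@chi1_adjoint R N (adjoint U xi)).
  apply/funext => xi; rewrite /comp; apply: ell2_eqP => g; rewrite -!inner_deltar.
  have aS := is_adjointC (is_adjointP bS); have aU' := is_adjointP bU.
  have cx y : S (adjoint U y) = adjoint U (S y) by have := congr1 (fun V => V y) (cS _ aU).
  by rewrite (aS (U xi)) (aU' xi) -cx -(aS xi) -(aU' (adjoint S xi)).
- by rewrite trip// => S [].
Qed.

(** The unitary flip_op i0 commutes with the Laplacian, hence with the masa; as it
fixes delta 1, it fixes L^2 of the masa, whereas it changes the sign of zeta0. *)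
Lemma zeta0_orthogonal (i0 i1 : 'I_N) (N0 : (0 < N)%N) : i0 != i1 ->
  orthogonal_complement (L2_subalgebra (@laplacian_masa R N)) (zeta0 R N0 i0 i1).
Proof.
move=> i01 xi Axi; set z := zeta0 _ _ _ _.
have zT T : @laplacian_masa R N T -> inner z (T (delta R 1%g)) = 0.
  move=> /masa_double_commutant [bT cT].
  have cf : commutant [set chi]%classic (flip_op i0).
    by split; [exact: flip_op_bounded|move=> _ ->; exact: flip_op_chi1].
  have E : flip_op i0 (T (delta R 1%g)) = T (delta R 1%g).
    by have := congr1 (fun V => V (delta R 1%g)) (cT _ cf); rewrite /comp flip_op_delta1.
  have := flip_op_inner i0 z (T (delta R 1%g)); rewrite E flip_zeta0// innerNl.
  by move=> /esym/eqP; rewrite -addr_eq0 -mulr2n mulrn_eq0 => /eqP.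
apply: Normc.eq0_normc; apply/eqP; rewrite eq_le modulus_ge0 andbT.
apply/ler_addgt0Pl => e e0; rewrite addr0.
have e1 : 0 < e / (l2norm z + 1) by rewrite divr_gt0// ltr_wpDl ?l2norm_ge0.
have [T AT Te] := Axi _ e1.
have -> : inner z xi = inner z (xi - T (delta R 1%g)).
  by rewrite innerDr innerNr (zT T AT) oppr0 addr0.
apply: le_trans (inner_cauchy _ _) _.
apply: le_trans (mulr_frac_le e0 (l2norm_ge0 z)); rewrite [leRHS]mulrC.
by rewrite ler_wpM2l ?l2norm_ge0// ltW.
Qed.

(** * Truncations to balls *)

Definition trunc (K : nat) zeta : ell2 R G :=
  ell2_restrict (fun g : G => (size (word g) <= K)%N) zeta.

Lemma trunc_cvg zeta (e : R) : 0 < e -> exists K, l2norm (zeta - trunc K zeta) < e.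
Proof.
move=> /(ell2_finite_approx zeta)[s hs].
exists (\max_(g <- s) size (word g)); apply: hs => g gs.
by rewrite -topredE /= (big_rem g gs) /= leq_maxl.
Qed.

Definition ballsum (V : zmodType) K (f : G -> V) : V :=
  \sum_(k < K.+1) sumw k (fun w => f (wprod w) *+ reduced w).

Lemma ballsum_morph (V W : zmodType) (phi : V -> W) K (f : G -> V) :
  phi 0 = 0 -> {morph phi : x y / x + y} ->
  phi (ballsum K f) = ballsum K (fun g : G => phi (f g)).
Proof.
move=> p0 pD; rewrite /ballsum (big_morph phi pD p0); apply: eq_bigr => k _.
rewrite (sumw_morph _ _ p0 pD); apply: eq_sumw => w _ /=.
by case: (reduced w).
Qed.

Lemma ballsumD (V : zmodType) K (f1 f2 : G -> V) :
  ballsum K (fun g : G => f1 g + f2 g) = ballsum K f1 + ballsum K f2.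
Proof.
rewrite /ballsum -big_split /=; apply: eq_bigr => k _; rewrite -sumwD.
by apply: eq_sumw => w _; rewrite mulrnDl.
Qed.

Lemma trunc_ballsum K zeta : trunc K zeta = ballsum K (fun g : G => zeta g *: delta R g).
Proof.
apply: ell2_eqP => h.
rewrite (@ballsum_morph _ _ (fun xi : ell2 R G => xi h))//.
rewrite /ballsum (eq_bigr (fun k : 'I_K.+1 => zeta h *+ (size (word h) == k))); last first.
  move=> k _; rewrite -sumw_single; apply: eq_sumw => w _.
  rewrite ell2_scaleE deltaE; case rw : (reduced w); last first.
    by rewrite mulr0n; case: eqP => // e; move: (reducedP h); rewrite -e rw.
  rewrite mulr1n; case: (eqVneq w (word h)) => [->|ne].
    by rewrite wprod_word eqxx mulr1.
  case: eqP => [e|_]; last by rewrite mulr0.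
  by case/eqP: ne; rewrite e word_wprod.
rewrite /trunc [LHS]/=.
case: leqP => hK.
  rewrite -ltnS in hK; rewrite (bigD1 (Ordinal hK))//= eqxx big1 ?addr0// => k kh.
  case: eqP => // e; case/eqP: kh; exact: val_inj.
by rewrite big1// => k _; case: eqP => // e; move: (ltn_ord k); lia.
Qed.

Lemma modulus_ballsum K (f : G -> R[i]) (b : G -> R) :
  (forall g : G, (size (word g) <= K)%N -> modulus (f g) <= b g) ->
  modulus (ballsum K f) <= ballsum K b.
Proof.
move=> fb; rewrite /ballsum.
apply: (@le_trans _ _ (\sum_(k < K.+1) modulus (sumw k (fun w => f (wprod w) *+ reduced w)))).
  elim/big_ind2 : _ => [|x1 x2 y1 y2 h1 h2|//]; first by rewrite Normc.normc0.
  by apply: le_trans (modulus_add _ _) _; exact: lerD.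
apply: ler_sum => k _.
have H n (f1 : seq (letter N) -> R[i]) (b1 : seq (letter N) -> R) :
    (forall w, size w = n -> modulus (f1 w) <= b1 w) -> modulus (sumw n f1) <= sumw n b1.
  elim: n f1 b1 => [|n IH] f1 b1 h /=; first exact: h.
  apply: (@le_trans _ _ (\sum_(x : letter N) modulus (sumw n (fun w => f1 (x :: w))))).
    elim/big_ind2 : _ => [|x1 x2 y1 y2 h1 h2|//]; first by rewrite Normc.normc0.
    by apply: le_trans (modulus_add _ _) _; exact: lerD.
  by apply: ler_sum => x _; apply: IH => w sw; apply: h; rewrite /= sw.
apply: H => w sw; case rw : (reduced w); last by rewrite !mulr0n Normc.normc0.
by rewrite !mulr1n; apply: fb; rewrite word_wprod// sw -ltnS.
Qed.

(** The coefficients are combinations of the counts coef n m g h over the support of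
the truncation.  Replacing these counts by a radial function of h costs a
bounded error, and the radial part contributes sums of zeta over spheres, which
vanish because zeta is orthogonal to the masa. *)
Lemma coefficients_bounded zeta K :
  orthogonal_complement (L2_subalgebra (@laplacian_masa R N)) zeta ->
  exists2 C : R, 0 <= C &
    forall n m, `|bimod (trunc K zeta) (spol n) (spol m)| <= C.
Proof.
move=> Hz; have N0 : (0 < N)%N by lia.
pose M : R := ((2 * N) ^ (K.+1 + K.+1))%:R.
pose S := ballsum K (fun g : G => modulus (zeta g)).
have S0 : 0 <= S.
  by apply: le_trans (modulus_ge0 _) (@modulus_ballsum K zeta _ _).
exists (S * (M * S)); first by rewrite !mulr_ge0 ?ler0n.
move=> n m; set zK := trunc K zeta.
pose A xi := PhiR (spol n) (right_copy (PhiR (spol m)) xi).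
have bA : bounded_operator A.
  apply: bounded_operator_comp; first by apply: PhiR_bounded; exact: spol_continuous.
  by apply: right_copy_bounded; apply: PhiR_bounded; exact: spol_continuous.
have inner_g (g : G) : (size (word g) <= K)%N -> modulus (inner (A (delta R g)) zK) <= M * S.
  move=> gK; have [Psi [psi psiE] hPsi] := coef_near_radial R N0 n m (ltn0Sn K) (leqW gK).
  have -> : inner (A (delta R g)) zK =
      ballsum K (fun v => conjc (zeta v) * (coef R n m g v)%:C).
    rewrite /zK trunc_ballsum (@ballsum_morph _ _ (fun xi : ell2 R G => inner (A (delta R g)) xi)).
    - by congr ballsum; apply/funext => v; rewrite innerZr inner_deltar sphere_coef.
    - exact: inner0r.
    - by move=> x y; rewrite innerDr.
  have -> : ballsum K (fun v => conjc (zeta v) * (coef R n m g v)%:C) =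
      ballsum K (fun v => conjc (zeta v) * (coef R n m g v - Psi v)%:C).
    apply/eqP; rewrite -subr_eq0; apply/eqP.
    transitivity (ballsum K (fun v => conjc (zeta v) * (Psi v)%:C)).
      apply/eqP; rewrite subr_eq -ballsumD; apply/eqP; congr ballsum; apply/funext => v.
      by rewrite -mulrDr -real_complexD addrC subrK.
    rewrite /ballsum big1// => k _.
    transitivity ((psi k)%:C * conjc (sphere k zeta 1%g)); last first.
      by rewrite orthogonal_sphere_sum// conjc0 mulr0.
    rewrite /sphere (@sumw_morph _ _ _ (@conjc R)) ?conjc0//; last exact: conjcD.
    rewrite sumwMl; apply: eq_sumw => w sw /=.
    case rw : (reduced w); last by rewrite !mulr0n conjc0 mulr0.
    by rewrite !mulr1n mulg1 psiE word_wprod// sw mulrC.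
  rewrite [leRHS]mulrC /S mulrC /M.
  have -> : M * ballsum K (fun v => modulus (zeta v)) = ballsum K (fun v => M * modulus (zeta v)).
    by apply: ballsum_morph; [exact: mulr0|move=> x y; rewrite mulrDr].
  apply: modulus_ballsum => v vK; rewrite Normc.normcM mulrC modulus_real.
  apply: ler_pM; rewrite ?normr_ge0 ?modulus_ge0//; first exact/hPsi/leqW.
  by case: (zeta v) => a b; rewrite /= -[leLHS]/(Num.sqrt (a ^+ 2 + (- b) ^+ 2)) sqrrN.
rewrite /bimod -/zK; apply: le_trans (ler_Re_modulus _) _.
rewrite -/(A zK) {1}/zK trunc_ballsum (@ballsum_morph _ _ (fun xi : ell2 R G => inner (A xi) zK)).
- rewrite [leRHS]mulrC.
  have -> : M * S * S = ballsum K (fun v => M * S * modulus (zeta v)).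
    by apply: ballsum_morph; [exact: mulr0|move=> x y; rewrite mulrDr].
  apply: modulus_ballsum => v vK; rewrite (linZ _ _ bA.1) innerZl Normc.normcM mulrC.
  by rewrite ler_wpM2r ?modulus_ge0// inner_g.
- by rewrite (lin0 bA.1) inner0l.
- by move=> x y; rewrite (linD _ _ bA.1) innerDl.
Qed.

(** * The spherical polynomials are orthogonal for the trace *)

Variable lambda : probability (measurableTypeR R) R.
Hypothesis hlambda : trace_measure X Phi lambda.
Local Notation T2 := (measurableTypeR R * measurableTypeR R)%type.
Local Notation mm := ((lambda \x lambda)%E : probability T2 R).
Local Notation D := (X `*` X : set T2).
Local Notation II f := (Rintegral mm D f).
Let r0 : 0 < radius := radius_gt0.

Lemma trace_integral f : continuous f ->
  rinner (PhiR f (delta R 1%g)) (delta R 1%g) = Rintegral lambda X f.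
Proof.
move=> cf; have := hlambda.2 _ (C_of_real (X := X) cf).
by rewrite /rinner /trace /PhiR => ->.
Qed.

Lemma spol_integral n m : Rintegral lambda X (fun t => spol n t * spol m t) =
  if n == m then sphere_card n else 0.
Proof.
rewrite -trace_integral ?PhiR_mul ?spol_inner//; try exact: spol_continuous.
by apply: continuous_prod; exact: spol_continuous.
Qed.

(** The family dual to spol for the trace. *)
Definition nspol n t : R := (sphere_card n)^-1 * spol n t.

Lemma nspol_continuous n : continuous (nspol n).
Proof. by apply: continuous_prod; [exact: continuous_const|exact: spol_continuous]. Qed.

Let mX : measurable (X : set (measurableTypeR R)).
Proof. exact: measurable_itv. Qed.

Let iX f : continuous f -> lambda.-integrable X (EFin \o f).
Proof.
move=> cf; apply: (bounded_measurable_integrable lambda mX).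
exact: (bounded_measurable_continuous r0).
Qed.

Lemma nspol_spol_integral n m : Rintegral lambda X (fun t => spol n t * nspol m t) = (n == m)%:R.
Proof.
have -> : (fun t => spol n t * nspol m t) = fun t => (sphere_card m)^-1 * (spol n t * spol m t).
  by apply/funext => t; rewrite /nspol mulrCA.
rewrite RintegralZl//; last first.
  by apply: iX; apply: continuous_prod; exact: spol_continuous.
rewrite spol_integral; case: eqP => [->|_]; last by rewrite mulr0.
by rewrite mulVf// gt_eqF// sphere_card_gt0.
Qed.

(** Any ratio between 1 / sqrt 3 and 1 serves in nspol_L1, as |S_n| >= 3^n. *)
Definition rate : R := 3 / 5.

(** The square of nspol n has integral 1 / |S_n| <= 3^-n, and
2 |y| <= q + y^2 / q for q = rate^n. *)
Lemma nspol_L1 n : Rintegral lambda X (fun t => `|nspol n t|) <= rate ^+ n.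
Proof.
have q0 : 0 < rate ^+ n by rewrite exprn_gt0// divr_gt0.
have c2 : continuous (fun t => spol n t * spol n t).
  by apply: continuous_prod; exact: spol_continuous.
pose k := (sphere_card n)^-1 ^+ 2 / (2 * rate ^+ n).
apply: (@le_trans _ _ (Rintegral lambda X (fun t => k * (spol n t * spol n t) + rate ^+ n / 2))).
  apply: le_Rintegral => //.
  - apply: (bounded_measurable_integrable lambda mX); apply: bounded_measurable_norm.
    exact: (bounded_measurable_continuous r0 (@nspol_continuous n)).
  - by apply: iX; apply: continuous_lin => //; exact: continuous_const.
  move=> t _; have -> : k * (spol n t * spol n t) = `|nspol n t| ^+ 2 / (2 * rate ^+ n).
    by rewrite (real_normK (num_real _)) /nspol /k exprMn; ring.
  move: (normr_ge0 (nspol n t)) => y0; set y := `|_| in y0 *; set q := rate ^+ n in q0 *.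
  rewrite -subr_ge0.
  have -> : y ^+ 2 / (2 * q) + q / 2 - y = (y - q) ^+ 2 / (2 * q).
    by field; rewrite gt_eqF.
  by rewrite divr_ge0 ?sqr_ge0// mulr_ge0// ltW.
have i1 := iX (continuous_prod (continuous_const (c := k)) c2).
have i2 := iX (continuous_const (c := rate ^+ n / 2)).
rewrite RintegralD//.
rewrite (RintegralZl k mX (iX c2)).
rewrite spol_integral eqxx Rintegral_cst//.
have l1 : fine (lambda X) <= 1.
  by rewrite -lee_fin fineK ?fin_num_measure// probability_le1.
have s0 := sphere_card_gt0 n; have s3 := sphere_card_ge n.
have kE : k * sphere_card n = (sphere_card n)^-1 / (2 * rate ^+ n).
  by rewrite /k; field; rewrite !gt_eqF.
have h1 : (sphere_card n)^-1 <= rate ^+ n * rate ^+ n.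
  apply: (@le_trans _ _ ((3 ^+ n)^-1)); first by rewrite lef_pV2// posrE exprn_gt0.
  by rewrite -exprMn -exprVn lerXn2r ?nnegrE ?invr_ge0 ?mulr_ge0 ?divr_ge0// /rate; lra.
have h2 : k * sphere_card n <= rate ^+ n / 2.
  rewrite kE ler_pdivrMr ?mulr_gt0//; apply: le_trans h1 _.
  by set q := rate ^+ n; have -> : q / 2 * (2 * q) = q * q by field.
have h3 : rate ^+ n / 2 * fine (lambda X) <= rate ^+ n / 2.
  by rewrite -[leRHS]mulr1 ler_wpM2l// divr_ge0// ltW.
by rewrite [leRHS](splitr (rate ^+ n)) lerD.
Qed.

(** * Kernels with bounded coefficients *)

Lemma nspol_lipschitz n : lipschitz_on radius (nspol n).
Proof.
apply: lipschitz_on_prod; first exact: lipschitz_on_cst.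
suff: lipschitz_on radius (spol n) /\ lipschitz_on radius (spol n.+1) by case.
elim: n => [|n [IH1 IH2]].
  by split; [exact: (@lipschitz_on_cst _ _ 1)|exact: lipschitz_on_id].
split=> //.
have -> : spol n.+2 = fun t => (- (gen_count N n)%:R) * spol n t + spol n.+1 t * t.
  by apply/funext => t; rewrite spolS addrC mulNr.
by apply: lipschitz_on_lin => //; apply: lipschitz_on_prod => //; exact: lipschitz_on_id.
Qed.

(** A partial sum of the expansion of a density whose integral against
spol n and spol m is c n m. *)
Definition kernel K (c : nat -> nat -> R) (t s : R) : R :=
  \sum_(n < K) \sum_(m < K) c n m * (nspol n t * nspol m s).

Lemma kernel_lipschitz K c : lipschitz_square radius (kernel K c).
Proof.
have H n : lipschitz_square radius (fun t s => \sum_(m < K) c n m * (nspol n t * nspol m s)).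
  by apply: lipschitz_square_sum => m; apply: lipschitz_square_tensor; exact: nspol_lipschitz.
have := @lipschitz_square_sum _ radius _ (index_enum 'I_K) (fun=> 1) _ (fun n : 'I_K => H n).
congr lipschitz_square; apply/funext => t; apply/funext => s.
by apply: eq_bigr => n _; rewrite mul1r.
Qed.

Lemma tensor_bounded a b : continuous a -> continuous b ->
  bounded_measurable D (fun p : T2 => a p.1 * b p.2).
Proof. exact: (bounded_measurable_tensor r0). Qed.

Let mD : measurable D. Proof. exact: (measurable_square radius). Qed.

Let iD (f : T2 -> R) : bounded_measurable D f -> mm.-integrable D (EFin \o f).
Proof. exact: (bounded_measurable_integrable mm mD). Qed.

Lemma kernel_bounded K c : bounded_measurable D (fun p : T2 => kernel K c p.1 p.2).
Proof.
apply: bounded_measurable_sum => n; apply: bounded_measurable_sum => m.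
by apply: bounded_measurableZ; apply: tensor_bounded; exact: nspol_continuous.
Qed.

Lemma kernel_test_sum K c a b : continuous a -> continuous b ->
  II (fun p : T2 => a p.1 * b p.2 * kernel K c p.1 p.2) =
  \sum_(n < K) \sum_(m < K) c n m * (Rintegral lambda X (fun t => a t * nspol n t) *
                                    Rintegral lambda X (fun t => b t * nspol m t)).
Proof.
move=> ca cb.
have cn f n : continuous f -> continuous (fun t => f t * nspol n t).
  by move=> cf; apply: continuous_prod => //; exact: nspol_continuous.
have -> : (fun p : T2 => a p.1 * b p.2 * kernel K c p.1 p.2) = fun p : T2 =>
    \sum_(n < K) \sum_(m < K) c n m * ((a p.1 * nspol n p.1) * (b p.2 * nspol m p.2)).
  apply/funext => p; rewrite /kernel mulr_sumr; apply: eq_bigr => n _.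
  by rewrite mulr_sumr; apply: eq_bigr => m _; ring.
have bt n m : bounded_measurable D
    (fun p : T2 => (a p.1 * nspol n p.1) * (b p.2 * nspol m p.2)).
  exact (tensor_bounded (cn a n ca) (cn b m cb)).
rewrite Rintegral_sum//; last first.
  by move=> n; apply: bounded_measurable_sum => m; exact: bounded_measurableZ.
apply: eq_bigr => n _; rewrite Rintegral_sum//; last by move=> m; exact: bounded_measurableZ.
apply: eq_bigr => m _; rewrite (RintegralZl _ mD (iD (bt n m))).
by rewrite (Rintegral_tensor lambda r0 (cn a n ca) (cn b m cb)).
Qed.

Lemma kernel_spol K c n m : (n < K)%N -> (m < K)%N ->
  II (fun p : T2 => spol n p.1 * spol m p.2 * kernel K c p.1 p.2) = c n m.
Proof.
move=> nK mK; rewrite kernel_test_sum; try exact: spol_continuous.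
rewrite (bigD1 (Ordinal nK))//= [X in _ + X]big1 ?addr0; last first.
  move=> i ni; rewrite big1// => j _; rewrite nspol_spol_integral.
  by rewrite (_ : (n == i) = false) ?mul0r ?mulr0//; apply/negP => /eqP e; case/eqP: ni; exact: val_inj.
rewrite (bigD1 (Ordinal mK))//= [X in _ + X]big1 ?addr0; last first.
  move=> i ni; rewrite !nspol_spol_integral.
  by rewrite (_ : (m == i) = false) ?mulr0//; apply/negP => /eqP e; case/eqP: ni; exact: val_inj.
by rewrite !nspol_spol_integral !eqxx !mulr1.
Qed.

Lemma kernel_L1 K c (w : nat -> nat -> R) : (forall n m, `|c n m| <= w n m) ->
  II (fun p : T2 => `|kernel K c p.1 p.2|) <=
  \sum_(n < K) \sum_(m < K) w n m * (rate ^+ n * rate ^+ m).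
Proof.
move=> hc.
have w0 n m : 0 <= w n m by apply: le_trans (hc n m).
have cn n : continuous (fun t => `|nspol n t|).
  move=> t; apply: (@continuous_comp R R R); first exact: nspol_continuous.
  exact: norm_continuous.
have bt n m : bounded_measurable D (fun p : T2 => w n m * (`|nspol n p.1| * `|nspol m p.2|)).
  by apply: bounded_measurableZ; exact (tensor_bounded (cn n) (cn m)).
apply: (@le_trans _ _ (II (fun p : T2 =>
  \sum_(n < K) \sum_(m < K) w n m * (`|nspol n p.1| * `|nspol m p.2|)))).
  apply: le_Rintegral => //.
  - by apply: iD; apply: bounded_measurable_norm; exact: kernel_bounded.
  - by apply: iD; apply: bounded_measurable_sum => n; apply: bounded_measurable_sum => m.
  move=> p _; apply: le_trans (ler_norm_sum _ _ _) _; apply: ler_sum => n _.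
  apply: le_trans (ler_norm_sum _ _ _) _; apply: ler_sum => m _.
  by rewrite !normrM ler_wpM2r// mulr_ge0.
rewrite Rintegral_sum//; last by move=> n; exact: bounded_measurable_sum.
apply: ler_sum => n _; rewrite Rintegral_sum//; apply: ler_sum => m _.
rewrite (RintegralZl _ mD (iD (tensor_bounded (cn n) (cn m)))).
rewrite (Rintegral_tensor lambda r0 (cn n) (cn m)) ler_wpM2l//.
apply: ler_pM; rewrite ?nspol_L1//; by apply: Rintegral_ge0.
Qed.

Lemma rate_gt0 : 0 < rate. Proof. by rewrite divr_gt0. Qed.

Lemma rate_sum K : \sum_(n < K) rate ^+ n <= 5 / 2.
Proof.
suff -> : \sum_(n < K) rate ^+ n = 5 / 2 - 5 / 2 * rate ^+ K.
  by rewrite lerBlDr lerDl mulr_ge0 ?exprn_ge0// ?divr_ge0// ltW// rate_gt0.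
elim: K => [|K IH]; first by rewrite big_ord0 expr0; ring.
by rewrite big_ord_recr/= IH exprS /rate; field.
Qed.

Lemma rate_tail J K : \sum_(n < J) (K <= n)%N%:R * rate ^+ n <= 5 / 2 * rate ^+ K.
Proof.
have p0 := exprn_gt0 _ rate_gt0.
suff : \sum_(n < J) (K <= n)%N%:R * rate ^+ n <=
    5 / 2 * rate ^+ K - (K <= J)%N%:R * (5 / 2 * rate ^+ J).
  move=> h; apply: le_trans h _; rewrite lerBlDr lerDl !mulr_ge0// ltW//; exact: p0.
elim: J => [|J IH].
  rewrite big_ord0 expr0 mulr1 leqn0; case: eqP => [->|_]; first by rewrite expr0 mulr1 mul1r subrr.
  by rewrite mul0r subr0 mulr_ge0// ltW// p0.
rewrite big_ord_recr/=; move: IH; set S := \sum_(_ < J) _ => IH.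
have e : 5 / 2 * rate ^+ J.+1 = 3 / 2 * rate ^+ J by rewrite exprS /rate; field.
case: (ltngtP K J.+1) => KJ.
- have KJ' : (K <= J)%N by lia.
  by move: IH; rewrite KJ' e !mul1r; lra.
- have KJ' : (K <= J)%N = false by lia.
  by move: IH; rewrite KJ' !mul0r; lra.
have KJ' : (K <= J)%N = false by lia.
move: IH; rewrite KJ' KJ !mul0r mul1r subrr addr0 subr0 => IH.
have : S = 0 by rewrite /S big1// => i _; rewrite KJ (_ : (J < i)%N = false) ?mul0r//; have := ltn_ord i; lia.
by move=> ->.
Qed.

Definition cut K (c : nat -> nat -> R) n m : R := if (n < K)%N && (m < K)%N then c n m else 0.

Lemma kernel_cut K J c t s : (K <= J)%N -> kernel K c t s = kernel J (cut K c) t s.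
Proof.
move=> KJ; rewrite /kernel.
rewrite (big_ord_widen J (fun n => \sum_(m < K) c n m * (nspol n t * nspol m s)) KJ) big_mkcond.
apply: eq_bigr => n _; rewrite /cut; case: ifP => nK /=; last by rewrite big1// => m _; rewrite mul0r.
rewrite (big_ord_widen J (fun m => c n m * (nspol n t * nspol m s)) KJ) big_mkcond.
by apply: eq_bigr => m _; case: ifP => //; rewrite mul0r.
Qed.

Lemma kernel_tail K J c (C : R) : (K <= J)%N -> (forall n m, `|c n m| <= C) ->
  II (fun p : T2 => `|kernel J c p.1 p.2 - kernel K c p.1 p.2|) <= 25 / 2 * C * rate ^+ K.
Proof.
move=> KJ hC; have C0 : 0 <= C by apply: le_trans (hC 0%N 0%N).
pose d n m := c n m - cut K c n m.
have -> : (fun p : T2 => `|kernel J c p.1 p.2 - kernel K c p.1 p.2|) =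
    fun p : T2 => `|kernel J d p.1 p.2|.
  apply/funext => p; rewrite (kernel_cut _ _ _ KJ) /kernel -sumrB; congr (`|_|).
  by apply: eq_bigr => n _; rewrite -sumrB; apply: eq_bigr => m _; rewrite -mulrBl.
pose w (n m : nat) : R := C * (K <= n)%N%:R + C * (K <= m)%N%:R.
have hw n m : `|d n m| <= w n m.
  rewrite /d /w /cut; case: (ltnP n K) => nK; case: (ltnP m K) => mK /=.
  - by rewrite subrr normr0 !mulr0 addr0.
  - by rewrite subr0 mulr0 add0r mulr1.
  - by rewrite subr0 mulr0 addr0 mulr1.
  - by rewrite subr0 mulr1; apply: le_trans (hC n m) _; rewrite lerDl.
apply: le_trans (kernel_L1 J hw) _.
pose S := \sum_(n < J) rate ^+ n; pose T := \sum_(n < J) (K <= n)%N%:R * rate ^+ n.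
have -> : \sum_(n < J) \sum_(m < J) w n m * (rate ^+ n * rate ^+ m) = 2 * C * (S * T).
  have -> : 2 * C * (S * T) = C * (T * S) + C * (S * T) by ring.
  rewrite -[in RHS]/T {1}/T /S mulr_suml [in RHS]mulr_suml !mulr_sumr -big_split /=.
  apply: eq_bigr => n _; rewrite /T !mulr_sumr -big_split /=; apply: eq_bigr => m _.
  by rewrite /w; ring.
have S0 : 0 <= S by apply: sumr_ge0 => n _; rewrite exprn_ge0// ltW// rate_gt0.
have T0 : 0 <= T by apply: sumr_ge0 => n _; rewrite mulr_ge0 ?exprn_ge0// ltW// rate_gt0.
have h : S * T <= 5 / 2 * (5 / 2 * rate ^+ K) by rewrite ler_pM ?rate_sum ?rate_tail.
have -> : 25 / 2 * C * rate ^+ K = 2 * C * (5 / 2 * (5 / 2 * rate ^+ K)) by field.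
by rewrite ler_wpM2l// mulr_ge0.
Qed.

Lemma kernel_L1_bound K c (C : R) : (forall n m, `|c n m| <= C) ->
  II (fun p : T2 => `|kernel K c p.1 p.2|) <= 25 / 4 * C.
Proof.
move=> hC; have C0 : 0 <= C by apply: le_trans (hC 0%N 0%N).
apply: le_trans (kernel_L1 K (w := fun _ _ => C) hC) _.
have -> : \sum_(n < K) \sum_(m < K) C * (rate ^+ n * rate ^+ m) =
    C * ((\sum_(n < K) rate ^+ n) * (\sum_(n < K) rate ^+ n)).
  rewrite mulr_suml mulr_sumr; apply: eq_bigr => n _.
  by rewrite !mulr_sumr.
have S0 : 0 <= \sum_(n < K) rate ^+ n by apply: sumr_ge0 => n _; rewrite exprn_ge0// ltW// rate_gt0.
have := rate_sum K; move: S0; set S := \sum_(_ < K) _ => S0 S1.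
by rewrite [leRHS]mulrC ler_wpM2l//; nra.
Qed.

(** * Bounded bilinear functionals on C(X) *)

(** Multiplication by the variable maps spol n to a combination of its neighbours,
so that the span of these functions contains all monomials. *)
Lemma spol_span (P : (R -> R) -> Prop) : (forall n, P (spol n)) ->
  (forall k f g, continuous f -> continuous g -> P f -> P g -> P (fun t => k * f t + g t)) ->
  forall p : {poly R}, P (fun t => p.[t]).
Proof.
move=> Ps Pl p.
pose Q f := continuous f /\ P f.
have Ql k f g : Q f -> Q g -> Q (fun t => k * f t + g t).
  by move=> [cf Pf] [cg Pg]; split; [exact: continuous_lin|exact: Pl].
have Qs n : Q (spol n) by split; [exact: spol_continuous|exact: Ps].
have QX n m : Q (fun t => t ^+ n * spol m t).
  elim: n m => [|n IH] m.
    by rewrite (_ : (fun t => _) = spol m)//; apply/funext => t; rewrite expr0 mul1r.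
  case: m => [|m].
    rewrite (_ : (fun t => _) = fun t => t ^+ n * spol 1 t)//.
    by apply/funext => t; rewrite exprSr mulr1.
  have := Ql (gen_count N m)%:R _ _ (IH m) (IH m.+2); congr Q; apply/funext => t.
  by rewrite spolS exprSr; ring.
suff H n : Q (fun t => \sum_(i < n) p`_i * t ^+ i).
  have [_] := H (size p); congr P; apply/funext => t; by rewrite horner_coef.
elim: n => [|n IH].
  have := Ql (-1) _ _ (Qs 0%N) (Qs 0%N); congr Q; apply/funext => t.
  by rewrite big_ord0 mulN1r addNr.
have := Ql p`_n _ _ (QX n 0%N) IH; congr Q; apply/funext => t.
by rewrite big_ord_recr/= addrC mulr1.
Qed.

Definition bounded_bilinear (L : R) (F : (R -> R) -> (R -> R) -> R) : Prop :=
  [/\ forall k f g b, continuous f -> continuous g -> continuous b ->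
        F (fun t => k * f t + g t) b = k * F f b + F g b,
      forall k a f g, continuous a -> continuous f -> continuous g ->
        F a (fun t => k * f t + g t) = k * F a f + F a g &
      forall A B a b, continuous a -> continuous b ->
        (forall t, X t -> `|a t| <= A) -> (forall t, X t -> `|b t| <= B) ->
        `|F a b| <= L * (A * B)].

Lemma bounded_bilinearB L1 L2 F1 F2 : bounded_bilinear L1 F1 -> bounded_bilinear L2 F2 ->
  bounded_bilinear (L1 + L2) (fun a b => F1 a b - F2 a b).
Proof.
move=> [l1 r1 b1] [l2 r2 b2]; split.
- by move=> k f g b cf cg cb; rewrite l1// l2//; ring.
- by move=> k a f g ca cf cg; rewrite r1// r2//; ring.
move=> A B a b ca cb hA hB; apply: le_trans (ler_normB _ _) _.
by rewrite mulrDl lerD ?b1 ?b2.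
Qed.

(** A bounded sequence of bilinear functionals that eventually vanishes on each
pair of spherical polynomials tends to 0 pointwise, by density. *)
Lemma bilinear_limit (L : R) (F : nat -> (R -> R) -> (R -> R) -> R) :
  (forall K, bounded_bilinear L (F K)) ->
  (forall n m, exists K0, forall K, (K0 <= K)%N -> F K (spol n) (spol m) = 0) ->
  forall a b, continuous a -> continuous b -> forall e : R, 0 < e ->
  exists K0, forall K, (K0 <= K)%N -> `|F K a b| <= e.
Proof.
move=> bF Fs a b ca cb e e0.
have lin0 (u v : nat -> R) k : (exists K0, forall K, (K0 <= K)%N -> u K = 0) ->
    (exists K0, forall K, (K0 <= K)%N -> v K = 0) ->
    exists K0, forall K, (K0 <= K)%N -> k * u K + v K = 0.
  move=> [K1 h1] [K2 h2]; exists (maxn K1 K2) => K; rewrite geq_max => /andP[k1 k2].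
  by rewrite h1// h2// mulr0 addr0.
have pp (p q : {poly R}) : exists K0, forall K, (K0 <= K)%N ->
    F K (fun t => p.[t]) (fun t => q.[t]) = 0.
  have H1 : forall m, exists K0, forall K, (K0 <= K)%N -> F K (fun t => p.[t]) (spol m) = 0.
    move=> m; pose P f := exists K0, forall K, (K0 <= K)%N -> F K f (spol m) = 0.
    apply: (spol_span (P := P)) => [n|k f g cf cg Pf Pg]; first exact: Fs.
    have [K0 hK] := lin0 _ _ k Pf Pg; exists K0 => K kK; have [l1 _ _] := bF K.
    by rewrite l1 ?hK//; exact: spol_continuous.
  pose P g := exists K0, forall K, (K0 <= K)%N -> F K (fun t => p.[t]) g = 0.
  apply: (spol_span (P := P)) => [n|k f g cf cg Pf Pg]; first exact: H1.
  have [K0 hK] := lin0 _ _ k Pf Pg; exists K0 => K kK; have [_ l2 _] := bF K.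
  by rewrite l2 ?hK//; exact: continuous_horner.
have [A hA] := continuous_bounded r0 ca; have [B hB] := continuous_bounded r0 cb.
have A0 : 0 <= A := spectrum_bound_ge0 hA; have B0 : 0 <= B := spectrum_bound_ge0 hB.
have one : forall t, X t -> `|(fun=> 1 : R) t| <= 1 by move=> t _; rewrite normr1.
have L0 : 0 <= L.
  have [_ _ b1] := bF 0%N.
  have := b1 1 1 _ _ (continuous_const (c := 1)) (continuous_const (c := 1)) one one.
  by rewrite !mulr1; exact: le_trans.
pose M := (L + 1) * (A + B + 1).
have M0 : 0 < M by rewrite mulr_gt0// ?ltr_wpDl ?addr_ge0.
pose d := Num.min 1 (e / M).
have d0 : 0 < d by rewrite lt_min ltr01 divr_gt0.
have [p hp] := real_poly_approx ca d0; have [q hq] := real_poly_approx cb d0.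
have [K0 hK] := pp p q; exists K0 => K /hK F0.
have [l1 l2 bd] := bF K.
have cp : continuous (fun t => p.[t]) by exact: continuous_horner.
have cq : continuous (fun t => q.[t]) by exact: continuous_horner.
have cap : continuous (fun t => a t - p.[t]).
  by move=> t; apply: (@cvgB R R); [exact: ca|exact: cp].
have cbq : continuous (fun t => b t - q.[t]).
  by move=> t; apply: (@cvgB R R); [exact: cb|exact: cq].
have E : F K a b = F K (fun t => a t - p.[t]) b + F K (fun t => p.[t]) (fun t => b t - q.[t]).
  have {1}-> : a = fun t => 1 * (a t - p.[t]) + p.[t] by apply/funext => t; rewrite mul1r subrK.
  rewrite l1// mul1r; congr (_ + _).
  have {1}-> : b = fun t => 1 * (b t - q.[t]) + q.[t] by apply/funext => t; rewrite mul1r subrK.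
  by rewrite l2// mul1r F0 addr0.
have hpA t : X t -> `|p.[t]| <= A + d.
  move=> Xt; rewrite -[p.[t]](subrK (a t)) addrC; apply: le_trans (ler_normD _ _) _.
  by rewrite lerD ?hA// distrC hp.
have b1 := bd _ _ _ _ cap cb hp hB; have b2 := bd _ _ _ _ cp cbq hpA hq.
rewrite E; apply: le_trans (ler_normD _ _) _; apply: le_trans (lerD b1 b2) _.
have d1 : d <= 1 by rewrite ge_min lexx.
have d2 : d * M <= e by rewrite -ler_pdivlMr// ge_min lexx orbT.
apply: le_trans d2; rewrite /M -mulrDr.
apply: (@le_trans _ _ (L * (d * (A + B + 1)))).
  by rewrite ler_wpM2l//; nra.
by rewrite mulrCA ler_wpM2l ?(ltW d0)// ler_wpM2r ?addr_ge0// lerDl.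
Qed.

Lemma bimod_bilinear zeta : bounded_bilinear (l2norm zeta ^+ 2) (bimod zeta).
Proof.
split=> [k f g b cf cg _|k a f g ca cf cg|A B a b ca cb hA hB].
- exact: bimod_linl.
- exact: bimod_linr.
by rewrite mulrC; exact: bimod_le.
Qed.

Lemma bounded_mul_integrable (f h : T2 -> R) : bounded_measurable D f ->
  mm.-integrable D (EFin \o h) -> mm.-integrable D (EFin \o (fun p => f p * h p)).
Proof.
move=> [mf [M hM]] ih.
apply: (integrableMr mD (h := f) (g := EFin \o h) _ _ ih); first exact: measurable_funTS.
exists M; split; first exact: num_real.
by move=> y My x Dx; apply: le_trans (hM x Dx) _; exact: ltW.
Qed.

Lemma Rintegral_mul_bound (f h : T2 -> R) (M : R) : bounded_measurable D f ->
  (forall p, D p -> `|f p| <= M) -> mm.-integrable D (EFin \o h) ->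
  `|II (fun p => f p * h p)| <= M * II (fun p => `|h p|).
Proof.
move=> bf hM ih.
have ihn : mm.-integrable D (EFin \o (fun p => `|h p|)) by exact: integrable_norm.
apply: le_trans (le_normr_Rintegral mD (bounded_mul_integrable bf ih)) _.
rewrite -(RintegralZl _ mD ihn); apply: le_Rintegral => //.
- by have ifh := bounded_mul_integrable bf ih; exact: integrable_norm.
- exact: (bounded_mul_integrable (bounded_measurable_cst D M) ihn).
by move=> p Dp; rewrite normrM ler_wpM2r// hM.
Qed.

Definition weighted (h : T2 -> R) a b : R := II (fun p : T2 => a p.1 * b p.2 * h p).

Lemma weighted_bilinear (h : T2 -> R) (L : R) : mm.-integrable D (EFin \o h) ->
  II (fun p => `|h p|) <= L -> bounded_bilinear L (weighted h).
Proof.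
move=> ih hL.
have i a b ca cb := bounded_mul_integrable (@tensor_bounded a b ca cb) ih.
have lin k (f1 f2 : T2 -> R) : mm.-integrable D (EFin \o f1) -> mm.-integrable D (EFin \o f2) ->
    II (fun p => k * f1 p + f2 p) = k * II f1 + II f2.
  move=> i1 i2; rewrite RintegralD ?RintegralZl//.
  exact: (bounded_mul_integrable (bounded_measurable_cst D k) i1).
split.
- move=> k f g b cf cg cb; rewrite /weighted -(lin _ _ _ (i _ _ cf cb) (i _ _ cg cb)).
  by congr (Rintegral _ _ _); apply/funext => p; ring.
- move=> k a f g ca cf cg; rewrite /weighted -(lin _ _ _ (i _ _ ca cf) (i _ _ ca cg)).
  by congr (Rintegral _ _ _); apply/funext => p; ring.
move=> A B a b ca cb hA hB.
apply: (@le_trans _ _ (A * B * II (fun p => `|h p|))).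
  apply: Rintegral_mul_bound => //; first exact: tensor_bounded.
  by move=> p [p1 p2]; rewrite normrM ler_pM ?hA ?hB.
rewrite mulrC ler_wpM2r// mulr_ge0//; [exact: (spectrum_bound_ge0 hA)|exact: (spectrum_bound_ge0 hB)].
Qed.

Lemma bilinear_suml L F I (l : seq I) (f : I -> R -> R) b : bounded_bilinear L F ->
  (forall i, continuous (f i)) -> continuous b ->
  continuous (fun t => \sum_(i <- l) f i t) /\
  F (fun t => \sum_(i <- l) f i t) b = \sum_(i <- l) F (f i) b.
Proof.
move=> [lF _ _] cf cb; elim: l => [|i l [c IH]].
  have E : (fun t => \sum_(i <- [::]) f i t) = fun _ : R => 0 by apply/funext => t; rewrite big_nil.
  have c0 := continuous_const (c := 0).
  rewrite E big_nil; split=> //.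
  have := lF (-1) _ _ _ c0 c0 cb.
  rewrite (_ : (fun t => -1 * 0 + 0) = fun _ : R => 0); last by apply/funext => t; rewrite mulr0 addr0.
  by move: (F _ _) => x; lra.
have E : (fun t => \sum_(i <- i :: l) f i t) = fun t => 1 * f i t + \sum_(i <- l) f i t.
  by apply/funext => t; rewrite big_cons mul1r.
by rewrite E big_cons lF// mul1r IH; split=> //; exact: continuous_lin.
Qed.

Lemma bounded_bilinearC L F : bounded_bilinear L F -> bounded_bilinear L (fun a b => F b a).
Proof.
move=> [l1 l2 b1]; split=> [k f g b cf cg cb|k a f g ca cf cg|A B a b ca cb hA hB].
- exact: l2.
- exact: l1.
by rewrite [A * B]mulrC; exact: b1.
Qed.

(** * Tests on partitions of unity *)

Section Partition.
Variables (n : nat) (phi : 'I_n -> R -> R) (kappa : 'I_n -> 'I_n -> R).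
Hypothesis hphi : partition_of_unity phi.
Hypothesis kappa1 : forall i j, `|kappa i j| <= 1.

Let s i t : R := Num.sqrt (phi i t).
Let cs i : continuous (s i).
Proof.
move=> t; apply: (@continuous_comp R R R); last exact: sqrt_continuous.
by have [c _ _] := hphi; exact: c.
Qed.

Let T i j zeta := l2norm (PhiR (s i) (right_copy (PhiR (s j)) zeta)).

Let TE i j zeta : bimod zeta (phi i) (phi j) = T i j zeta ^+ 2.
Proof.
have E k : phi k = fun t => s k t * s k t.
  by apply/funext => t; rewrite -expr2 sqr_sqrtr//; have [_ p _] := hphi; exact: p.
by rewrite (E i) (E j) bimod_sqr.
Qed.

Let TB i j x y : T i j x <= T i j y + T i j (x - y).
Proof.
have b1 := PhiR_bounded (@cs i); have b2 := right_copy_bounded (PhiR_bounded (@cs j)).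
rewrite /T -{1}(subrK y x) (linD _ _ b2.1) (linD _ _ b1.1) addrC; exact: l2normD.
Qed.

(** The constant function 1 is the sum of the phi i. *)
Lemma partition_sum zeta : \sum_(i < n) \sum_(j < n) T i j zeta ^+ 2 = l2norm zeta ^+ 2.
Proof.
have [cphi _ phi1] := hphi.
have bb := bimod_bilinear zeta; have bbC := bounded_bilinearC bb.
have E : (fun t => \sum_(i < n) phi i t) = fun=> 1 by apply/funext => t; exact: phi1.
have c1 := continuous_const (c := 1).
transitivity (bimod zeta (fun=> 1) (fun=> 1)); last first.
  rewrite /bimod PhiR1 -rinner_norm /right_copy PhiR1 modular_conjK //.
rewrite -{1}E (bilinear_suml _ bb cphi c1).2; apply: eq_bigr => i _.
rewrite -E (bilinear_suml _ bbC cphi (cphi i)).2; apply: eq_bigr => j _.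
by rewrite TE.
Qed.

Lemma partition_test_le zeta :
  `|\sum_(i < n) \sum_(j < n) kappa i j * bimod zeta (phi i) (phi j)| <= l2norm zeta ^+ 2.
Proof.
rewrite -partition_sum; apply: le_trans (ler_norm_sum _ _ _) _; apply: ler_sum => i _.
apply: le_trans (ler_norm_sum _ _ _) _; apply: ler_sum => j _.
by rewrite TE normrM (ger0_norm (sqr_ge0 _)) -[leRHS]mul1r ler_wpM2r ?sqr_ge0.
Qed.

(** Each term is the square of a seminorm of the vector; the inequality between
arithmetic and geometric means bounds the sum of the increments by sums of
squares, hence independently of the partition. *)
Lemma partition_test_diff zeta zeta' (e : R) : 0 < e -> l2norm (zeta - zeta') <= e ->
  `|\sum_(i < n) \sum_(j < n) kappa i j * bimod zeta (phi i) (phi j) -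
    \sum_(i < n) \sum_(j < n) kappa i j * bimod zeta' (phi i) (phi j)| <=
  e * (1 + l2norm zeta ^+ 2 + l2norm zeta' ^+ 2).
Proof.
move=> e0 de.
apply: (@le_trans _ _ (\sum_(i < n) \sum_(j < n)
   (e^-1 * T i j (zeta - zeta') ^+ 2 + e * (T i j zeta ^+ 2 + T i j zeta' ^+ 2)))).
  rewrite -sumrB; apply: le_trans (ler_norm_sum _ _ _) _; apply: ler_sum => i _.
  rewrite -sumrB; apply: le_trans (ler_norm_sum _ _ _) _; apply: ler_sum => j _.
  rewrite -mulrBr !TE normrM.
  apply: (@le_trans _ _ `|T i j zeta ^+ 2 - T i j zeta' ^+ 2|).
    by rewrite -[leRHS]mul1r ler_wpM2r.
  have h1 := TB i j zeta zeta'; have h2 := TB i j zeta' zeta.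
  have h3 : T i j (zeta' - zeta) = T i j (zeta - zeta').
    have b1 := PhiR_bounded (@cs i); have b2 := right_copy_bounded (PhiR_bounded (@cs j)).
    by rewrite /T -opprB (linN _ b2.1) (linN _ b1.1) l2normN.
  rewrite h3 in h2.
  have x0 : 0 <= T i j zeta := l2norm_ge0 _; have y0 : 0 <= T i j zeta' := l2norm_ge0 _.
  have d0 : 0 <= T i j (zeta - zeta') := l2norm_ge0 _.
  move: h1 h2 x0 y0 d0; set x := T i j zeta; set y := T i j zeta'; set d := T i j (_ - _).
  move=> h1 h2 x0 y0 d0.
  apply: (@le_trans _ _ (d * (x + y))).
    by rewrite ler_norml; apply/andP; split; nra.
  have -> : e^-1 * d ^+ 2 + e * (x ^+ 2 + y ^+ 2) =
    (d / e) ^+ 2 * e + e * (x ^+ 2 + y ^+ 2) by field; rewrite gt_eqF.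
  have -> : d * (x + y) = (d / e) * (x + y) * e by field; rewrite gt_eqF.
  set z := d / e; rewrite [e * _]mulrC -mulrDl ler_wpM2r ?(ltW e0)//.
  have h : 0 <= (z - (x + y) / 2) ^+ 2 := sqr_ge0 _.
  by have := sqr_ge0 (x - y); move: h; rewrite !expr2; nra.
under eq_bigr do rewrite big_split -!mulr_sumr big_split /=.
rewrite big_split -!mulr_sumr big_split /= !partition_sum.
have -> : e * (1 + l2norm zeta ^+ 2 + l2norm zeta' ^+ 2) =
  e + e * (l2norm zeta ^+ 2 + l2norm zeta' ^+ 2) by ring.
rewrite lerD2r mulrC ler_pdivrMr// expr2 ler_pM// ?l2norm_ge0//.
Qed.

End Partition.

Lemma bimod_diff zeta zeta' (A B : R) a b : continuous a -> continuous b ->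
  (forall t, X t -> `|a t| <= A) -> (forall t, X t -> `|b t| <= B) ->
  `|bimod zeta a b - bimod zeta' a b| <=
  A * B * (l2norm (zeta - zeta') * (l2norm zeta + l2norm zeta')).
Proof.
move=> ca cb hA hB.
pose S x := PhiR a (right_copy (PhiR b) x).
have b1 := PhiR_bounded ca; have b2 := right_copy_bounded (PhiR_bounded cb).
have -> : bimod zeta a b - bimod zeta' a b =
    rinner (S (zeta - zeta')) zeta + rinner (S zeta') (zeta - zeta').
  rewrite /S (linB _ _ b2.1) (linB _ _ b1.1) -!/(S _) /bimod -!/(S _).
  by rewrite rinnerDl rinnerNl rinnerDr rinnerNr; ring.
apply: le_trans (ler_normD _ _) _; rewrite mulrDr mulrDr lerD//.
  exact: bimod_inner_le.
rewrite [l2norm (_ - _) * _]mulrC; exact: bimod_inner_le.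
Qed.

(** * Approximation of the functional by kernels *)

Definition coefs zeta (n m : nat) : R := bimod zeta (spol n) (spol m).

(** By bilinear_limit the functional is the limit of the integrals against longer
partial sums, and these differ from kernel K by an L^1 tail. *)
Lemma kernel_estimate zeta (C : R) K n (kappa : 'I_n -> 'I_n -> R) (a b : 'I_n -> R -> R) (M : R) :
  (forall n m, `|bimod zeta (spol n) (spol m)| <= C) ->
  (forall i, continuous (a i)) -> (forall i, continuous (b i)) -> 0 <= M ->
  (forall t s, X t -> X s ->
     `|\sum_(i < n) \sum_(j < n) kappa i j * (a i t * b j s)| <= M) ->
  `|\sum_(i < n) \sum_(j < n) kappa i j * bimod zeta (a i) (b j) -
    II (fun p : T2 => (\sum_(i < n) \sum_(j < n) kappa i j * (a i p.1 * b j p.2)) *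
          kernel K (coefs zeta) p.1 p.2)| <= M * (25 / 2 * C * rate ^+ K).
Proof.
move=> hC ca cb M0 hM; set c := coefs zeta.
pose F J a b := bimod zeta a b - weighted (fun p : T2 => kernel J c p.1 p.2) a b.
have ik J := iD (kernel_bounded J c).
have bF J : bounded_bilinear (l2norm zeta ^+ 2 + 25 / 4 * C) (F J).
  apply: bounded_bilinearB; first exact: bimod_bilinear.
  by apply: weighted_bilinear => //; exact: kernel_L1_bound.
have Fs n' m : exists K0, forall J, (K0 <= J)%N -> F J (spol n') (spol m) = 0.
  exists (maxn n' m).+1 => J; rewrite gtn_max => /andP[h1 h2].
  by rewrite /F /weighted kernel_spol// /c /coefs subrr.
apply/ler_addgt0Pr => e e0.
pose W := \sum_(i < n) \sum_(j < n) `|kappa i j|.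
have W0 : 0 <= W by apply: sumr_ge0 => i _; apply: sumr_ge0.
have e1 : 0 < e / (W + 1) by rewrite divr_gt0// ltr_wpDl.
have [f hf] := choice (fun x : 'I_n * 'I_n => bilinear_limit bF Fs (ca x.1) (cb x.2) e1).
pose J := maxn K (\max_x f x).
pose t (p : T2) : R := \sum_(i < n) \sum_(j < n) kappa i j * (a i p.1 * b j p.2).
have bt i j : bounded_measurable D (fun p : T2 => a i p.1 * b j p.2) by exact: tensor_bounded.
have bt' : bounded_measurable D t.
  by apply: bounded_measurable_sum => i; apply: bounded_measurable_sum => j; exact: bounded_measurableZ.
have E : II (fun p => t p * kernel J c p.1 p.2) =
    \sum_(i < n) \sum_(j < n) kappa i j * weighted (fun p : T2 => kernel J c p.1 p.2) (a i) (b j).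
  have -> : (fun p => t p * kernel J c p.1 p.2) = fun p : T2 =>
      \sum_(i < n) \sum_(j < n) kappa i j * (a i p.1 * b j p.2 * kernel J c p.1 p.2).
    apply/funext => p; rewrite /t mulr_suml; apply: eq_bigr => i _.
    by rewrite mulr_suml; apply: eq_bigr => j _; ring.
  have bk i j := bounded_measurableM (bt i j) (kernel_bounded J c).
  rewrite Rintegral_sum//; last first.
    by move=> i; apply: bounded_measurable_sum => j; exact: bounded_measurableZ.
  apply: eq_bigr => i _; rewrite Rintegral_sum//; last by move=> j; exact: bounded_measurableZ.
  by apply: eq_bigr => j _; rewrite (RintegralZl _ mD (iD (bk i j))).
set S := \sum_(i < n) _.
have h1 : `|S - II (fun p => t p * kernel J c p.1 p.2)| <= e.
  rewrite E /S -sumrB; apply: le_trans (ler_norm_sum _ _ _) _.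
  apply: (@le_trans _ _ (W * (e / (W + 1)))); last by rewrite mulrC; exact: mulr_frac_le.
  rewrite mulr_suml; apply: ler_sum => i _; rewrite -sumrB mulr_suml.
  apply: le_trans (ler_norm_sum _ _ _) _; apply: ler_sum => j _.
  rewrite -mulrBr normrM ler_wpM2l//; apply: (hf (i, j)).
  by rewrite leq_max; apply/orP; right; exact: leq_bigmax.
have bd : bounded_measurable D (fun p : T2 => kernel J c p.1 p.2 - kernel K c p.1 p.2).
  by apply: bounded_measurableB; exact: kernel_bounded.
have h2 : `|II (fun p => t p * kernel J c p.1 p.2) - II (fun p => t p * kernel K c p.1 p.2)| <=
    M * (25 / 2 * C * rate ^+ K).
  rewrite -RintegralB//; last 2 first.
  - by apply: iD; apply: bounded_measurableM => //; exact: kernel_bounded.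
  - by apply: iD; apply: bounded_measurableM => //; exact: kernel_bounded.
  have -> : (fun p => t p * kernel J c p.1 p.2 - t p * kernel K c p.1 p.2) =
      fun p : T2 => t p * (kernel J c p.1 p.2 - kernel K c p.1 p.2).
    by apply/funext => p; rewrite mulrBr.
  apply: (@le_trans _ _ (M * II (fun p : T2 => `|kernel J c p.1 p.2 - kernel K c p.1 p.2|))).
    apply: Rintegral_mul_bound => //; last exact: iD.
    by move=> p [p1 p2]; exact: hM.
  rewrite ler_wpM2l//; apply: kernel_tail => //; exact: leq_maxl.
rewrite -[X in `|X|](subrKA (II (fun p => t p * kernel J c p.1 p.2))).
by apply: le_trans (ler_normD _ _) _; rewrite addrC lerD.
Qed.

(** The error is controlled both on partitions of unity, whatever their size,
which determines h in L^1, and on single tensors, which identifies the limit. *)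
Definition kernel_approx zeta (e : R) (h : R -> R -> R) : Prop :=
  [/\ lipschitz_square radius h, bounded_measurable D (fun p : T2 => h p.1 p.2),
    forall n (phi : 'I_n -> R -> R) (kappa : 'I_n -> 'I_n -> R),
      partition_of_unity phi -> (forall i j, `|kappa i j| <= 1) ->
      `|\sum_(i < n) \sum_(j < n) kappa i j * bimod zeta (phi i) (phi j) -
        II (fun p : T2 => (\sum_(i < n) \sum_(j < n) kappa i j * (phi i p.1 * phi j p.2)) *
              h p.1 p.2)| <= e &
    forall A B a b, continuous a -> continuous b ->
      (forall t, X t -> `|a t| <= A) -> (forall t, X t -> `|b t| <= B) ->
      `|bimod zeta a b - weighted (fun p : T2 => h p.1 p.2) a b| <= e * (A * B)].

Lemma power_small (q e : R) : 0 <= q -> q < 1 -> 0 < e ->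
  exists K, forall k, (K <= k)%N -> q ^+ k <= e.
Proof.
move=> q0 q1 e0; have q1' : `|q| < 1 by rewrite ger0_norm.
have /cvgrPdist_lt /(_ e e0) [K _ hK] := cvg_expr q1'.
exists K => k /hK /ltW; rewrite sub0r normrN; apply: le_trans; exact: ler_norm.
Qed.

(** A truncation of zeta, then a partial sum of its expansion. *)
Lemma kernel_approx_exists zeta (e : R) :
  orthogonal_complement (L2_subalgebra (@laplacian_masa R N)) zeta -> 0 < e ->
  exists h, kernel_approx zeta e h.
Proof.
move=> Hz e0; set x := l2norm zeta; have x0 : 0 <= x := l2norm_ge0 _.
pose L := 1 + x ^+ 2 + (x + 1) ^+ 2.
have L0 : 0 < L by rewrite /L -addrA ltr_pwDl// addr_ge0// sqr_ge0.
pose e1 := Num.min 1 (e / 2 / L).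
have e10 : 0 < e1 by rewrite lt_min ltr01 !divr_gt0.
have e11 : e1 <= 1 by rewrite ge_min lexx.
have e1L : e1 * L <= e / 2 by rewrite -ler_pdivlMr// ge_min lexx orbT.
have [K1 /ltW hK1] := trunc_cvg zeta e10; set z := trunc K1 zeta in hK1.
have zx : l2norm z <= x + 1.
  have zE : z = zeta - (zeta - z) by rewrite subKr.
  rewrite zE; apply: (le_trans (l2normB _ _)); rewrite lerD2l.
  exact (le_trans hK1 e11).
have z0 : 0 <= l2norm z := l2norm_ge0 _.
have [C C0 hC] := coefficients_bounded K1 Hz; rewrite -/z in hC.
have [K hK] : exists K, 25 / 2 * C * rate ^+ K <= e / 2.
  have C1 : 0 < 25 / 2 * C + 1 by rewrite ltr_wpDl// mulr_ge0// divr_ge0.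
  have [||K hK] := @power_small rate (e / 2 / (25 / 2 * C + 1)) (ltW rate_gt0).
  - by rewrite /rate; lra.
  - by rewrite !divr_gt0.
  exists K; have := hK K (leqnn K); rewrite ler_pdivlMr// => h; apply: le_trans h.
  by rewrite mulrC ler_wpM2l ?exprn_ge0 ?(ltW rate_gt0)// lerDl.
have zL : 1 + x ^+ 2 + l2norm z ^+ 2 <= L by rewrite /L lerD2l lerXn2r ?nnegrE ?addr_ge0.
exists (kernel K (coefs z)); split.
- exact: kernel_lipschitz.
- exact: kernel_bounded.
- move=> n phi kappa hphi hkappa; have [cphi phi0 phi1] := hphi.
  have one : forall t s, X t -> X s ->
      `|\sum_(i < n) \sum_(j < n) kappa i j * (phi i t * phi j s)| <= 1.
    move=> t s _ _; apply: (@le_trans _ _ (\sum_(i < n) \sum_(j < n) phi i t * phi j s)).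
      apply: le_trans (ler_norm_sum _ _ _) _; apply: ler_sum => i _.
      apply: le_trans (ler_norm_sum _ _ _) _; apply: ler_sum => j _.
      rewrite normrM (ger0_norm (mulr_ge0 (phi0 i t) (phi0 j s))) -[leRHS]mul1r.
      by rewrite ler_wpM2r ?mulr_ge0.
    under eq_bigr do rewrite -mulr_sumr phi1 mulr1.
    by rewrite phi1.
  have h1 := partition_test_diff hphi hkappa e10 hK1.
  have h2 := kernel_estimate K hC cphi cphi ler01 one; rewrite mul1r in h2.
  set S := \sum_(i < n) _ in h1 *; set S' := \sum_(i < n) _ in h1 h2.
  rewrite -(subrKA S'); apply: le_trans (ler_normD _ _) _.
  rewrite [leRHS](splitr e) lerD ?(le_trans h2)// (le_trans h1)// (le_trans _ e1L)//.
  by rewrite ler_wpM2l// ltW.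
move=> A B a b ca cb hA hB.
have A0 := spectrum_bound_ge0 hA; have B0 := spectrum_bound_ge0 hB.
have h1 := bimod_diff zeta z ca cb hA hB.
have one : forall t s, X t -> X s ->
    `|\sum_(i < 1) \sum_(j < 1) 1 * (a t * b s)| <= A * B.
  by move=> t s Xt Xs; rewrite !big_ord1 mul1r normrM ler_pM ?hA ?hB.
have AB0 : 0 <= A * B by rewrite mulr_ge0.
have := @kernel_estimate z C K 1 (fun _ _ => 1) (fun=> a) (fun=> b) _ hC (fun=> ca) (fun=> cb) AB0 one.
rewrite !big_ord1 mul1r.
rewrite (_ : II _ = weighted (fun p : T2 => kernel K (coefs z) p.1 p.2) a b); last first.
  by congr (Rintegral _ _ _); apply/funext => p; rewrite !big_ord1 mul1r.
move=> h2; rewrite -(subrKA (bimod z a b)); apply: le_trans (ler_normD _ _) _.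
rewrite [e in leRHS](splitr e) mulrDl lerD//.
  apply: (le_trans h1); rewrite mulrC ler_wpM2r//; apply: le_trans e1L.
  apply: (ler_pM (l2norm_ge0 _) (addr_ge0 x0 z0) hK1).
  by rewrite -/x /L; have := sqr_ge0 x; move: zx; lra.
by apply: (le_trans h2); rewrite mulrC ler_wpM2r.
Qed.

(** Both kernels agree on tests up to their errors, and tests compute the L^1 norm. *)
Lemma kernel_approx_L1 zeta (e e' e1 : R) h h' : 0 < e1 ->
  kernel_approx zeta e h -> kernel_approx zeta e' h' ->
  II (fun p : T2 => `|h' p.1 p.2 - h p.1 p.2|) <= e + e' + e1.
Proof.
move=> e10 [lh bh th _] [lh' bh' th' _].
have lg : lipschitz_square radius (fun t s => h' t s - h t s).
  have := lipschitz_square_lin (-1) lh lh'; congr lipschitz_square.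
  by apply/funext => t; apply/funext => s; rewrite mulN1r addrC.
have bg : bounded_measurable D (fun p : T2 => h' p.1 p.2 - h p.1 p.2) by exact: bounded_measurableB.
have [n [phi [kappa [hphi k1 hII]]]] := L1_norm_tests lambda r0 e10 lg bg.1.
apply: (le_trans hII); rewrite lerD2r.
have [cphi _ _] := hphi.
have bt : bounded_measurable D (fun p : T2 =>
    \sum_(i < n) \sum_(j < n) kappa i j * (phi i p.1 * phi j p.2)).
  apply: bounded_measurable_sum => i; apply: bounded_measurable_sum => j.
  by apply: bounded_measurableZ; exact: tensor_bounded.
have -> : (fun p : T2 => (\sum_(i < n) \sum_(j < n) kappa i j * (phi i p.1 * phi j p.2)) *
    (h' p.1 p.2 - h p.1 p.2)) = fun p : T2 =>
    (\sum_(i < n) \sum_(j < n) kappa i j * (phi i p.1 * phi j p.2)) * h' p.1 p.2 -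
    (\sum_(i < n) \sum_(j < n) kappa i j * (phi i p.1 * phi j p.2)) * h p.1 p.2.
  by apply/funext => p; rewrite mulrBr.
have i1 := iD (bounded_measurableM bt bh'); have i2 := iD (bounded_measurableM bt bh).
rewrite (RintegralB mD i1 i2).
have := th n phi kappa hphi k1; have := th' n phi kappa hphi k1.
rewrite !ler_norml => /andP[a1 a2] /andP[a3 a4]; move: a1 a4; lra.
Qed.

(** The tests of the functional itself are at most the squared norm of zeta. *)
Lemma kernel_approx_bound zeta (e e1 : R) h : 0 < e1 -> kernel_approx zeta e h ->
  II (fun p : T2 => `|h p.1 p.2|) <= l2norm zeta ^+ 2 + e + e1.
Proof.
move=> e10 [lh bh th _].
have [n [phi [kappa [hphi k1 hII]]]] := L1_norm_tests lambda r0 e10 lh bh.1.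
apply: (le_trans hII); rewrite lerD2r.
have := th n phi kappa hphi k1; have := partition_test_le hphi k1 zeta.
rewrite !ler_norml => /andP[a1 a2] /andP[a3 a4]; move: a2 a3; lra.
Qed.

(** Kernels of geometrically increasing accuracy form a rapidly convergent
sequence in L^1 by kernel_approx_L1, and their limit is the density. *)
Lemma density_exists zeta :
  orthogonal_complement (L2_subalgebra (@laplacian_masa R N)) zeta ->
  exists h : T2 -> R, [/\ measurable_fun [set: T2] h, mm.-integrable D (EFin \o h),
    forall a b, continuous a -> continuous b -> weighted h a b = bimod zeta a b &
    II (fun p => `|h p|) <= l2norm zeta ^+ 2].
Proof.
move=> Hz.
have q0 k : 0 < (1 / 2) ^+ k / 4 :> R by rewrite divr_gt0// exprn_gt0// divr_gt0.
have [hk hkP] := choice (fun k => kernel_approx_exists Hz (q0 k)).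
pose hs k (p : T2) := hk k p.1 p.2.
have bhs k : bounded_measurable D (hs k) by have [_ ? _ _] := hkP k.
have rapid k : II (fun p => `|hs k.+1 p - hs k p|) <= (1 / 2) ^+ k.
  apply: le_trans (kernel_approx_L1 (e1 := (1 / 2) ^+ k / 4) _ (hkP k) (hkP k.+1)) _; first exact: q0.
  by rewrite exprS; have := q0 k; set q := (1 / 2) ^+ k; lra.
have [mh ih hcvg] := rapid_limitP mD bhs rapid.
set h := rapid_limit hs in mh ih hcvg.
have ihn : mm.-integrable D (EFin \o (fun p => `|h p|)) by exact: integrable_norm.
have late e : 0 < e -> exists k, II (fun p => `|hs k p - h p|) <= e /\ (1 / 2) ^+ k / 4 <= e.
  move=> e0; have [k1 hk1] := hcvg e e0.
  have [||k2 hk2] := @power_small (1 / 2) e _ _ e0; [lra|lra|].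
  exists (maxn k1 k2); split; first by apply: hk1; exact: leq_maxl.
  apply: le_trans (hk2 (maxn k1 k2) (leq_maxr _ _)).
  by have := q0 (maxn k1 k2); set q := _ ^+ _; lra.
have id k : mm.-integrable D (EFin \o (fun p => hs k p - h p)).
  by have := integrableB mD (iD (bhs k)) ih; congr (_.-integrable _ _).
exists h; split=> //.
- move=> a b ca cb.
  have [A hA] := continuous_bounded r0 ca; have [B hB] := continuous_bounded r0 cb.
  have A0 : 0 <= A := spectrum_bound_ge0 hA; have B0 : 0 <= B := spectrum_bound_ge0 hB.
  have AB0 : 0 <= 2 * (A * B) by rewrite !mulr_ge0.
  apply/eqP; rewrite -subr_eq0 -normr_eq0 eq_le normr_ge0 andbT.
  apply/ler_addgt0Pr => e e0; rewrite add0r.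
  have [|k [k1 k2]] := late (e / (2 * (A * B) + 1)); first by rewrite divr_gt0// ltr_wpDl.
  apply: le_trans (mulr_frac_le e0 AB0); set d := e / _ in k1 k2 *.
  have [_ _ _ /(_ A B a b ca cb hA hB) h1] := hkP k.
  have h2 : `|weighted (hs k) a b - weighted h a b| <= A * B * d.
    have bab := tensor_bounded ca cb.
    rewrite /weighted -(RintegralB mD (bounded_mul_integrable bab (iD (bhs k))) (bounded_mul_integrable bab ih)).
    have -> : (fun p => a p.1 * b p.2 * hs k p - a p.1 * b p.2 * h p) =
      fun p : T2 => a p.1 * b p.2 * (hs k p - h p) by apply/funext => p; rewrite mulrBr.
    apply: (@le_trans _ _ (A * B * II (fun p => `|hs k p - h p|))).
      by apply: Rintegral_mul_bound => // p [p1 p2]; rewrite normrM ler_pM ?hA ?hB.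
    by rewrite ler_wpM2l// mulr_ge0.
  rewrite distrC -(subrKA (weighted (hs k) a b)); apply: le_trans (ler_normD _ _) _.
  apply: le_trans (lerD h1 h2) _.
  have : (1 / 2) ^+ k / 4 * (A * B) <= d * (A * B) by rewrite ler_wpM2r// mulr_ge0.
  by set u := _ ^+ k / 4 * _; lra.
apply/ler_addgt0Pr => e e0; have e4 : 0 < e / 4 by rewrite divr_gt0.
have [k [k1 k2]] := late _ e4.
have h1 := kernel_approx_bound e4 (hkP k).
have h2 : II (fun p => `|h p|) <= II (fun p => `|hs k p|) + II (fun p => `|hs k p - h p|).
  have in1 : mm.-integrable D (EFin \o (fun p => `|hs k p|)).
    by apply: iD; exact: bounded_measurable_norm.
  have in2 : mm.-integrable D (EFin \o (fun p => `|hs k p - h p|)).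
    by have i' := id k; exact: integrable_norm.
  rewrite -(RintegralD mD in1 in2); apply: le_Rintegral => //.
    by have := integrableD mD in1 in2; congr (_.-integrable _ _).
  by move=> p _; rewrite -{1}[h p](subKr (hs k p)); exact: ler_normB.
by move: h1 h2 k1 k2; rewrite /hs; lra.
Qed.

(** * From densities to left-right measures *)

(** The total integral of h is the squared norm of zeta, which bounds the integral
of its absolute value; hence h is nonnegative almost everywhere. *)
Lemma abs_density_integral zeta (h f : T2 -> R) :
  mm.-integrable D (EFin \o h) ->
  (forall a b, continuous a -> continuous b -> weighted h a b = bimod zeta a b) ->
  II (fun p => `|h p|) <= l2norm zeta ^+ 2 -> bounded_measurable D f ->
  II (fun p => f p * `|h p|) = II (fun p => f p * h p).
Proof.
move=> ih hw hn bf; have [_ [M hM]] := bf.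
have ihn : mm.-integrable D (EFin \o (fun p => `|h p|)) by exact: integrable_norm.
have ih' : mm.-integrable D (EFin \o (fun p => `|h p| - h p)).
  by have := integrableB mD ihn ih; congr (_.-integrable _ _).
have hI : II h = l2norm zeta ^+ 2.
  have c1 := continuous_const (c := 1).
  have <- : bimod zeta (fun=> 1) (fun=> 1) = l2norm zeta ^+ 2.
    by rewrite /bimod PhiR1 -rinner_norm /right_copy PhiR1 modular_conjK.
  by rewrite -(hw _ _ c1 c1); congr (Rintegral _ _ _); apply/funext => p; rewrite !mul1r.
apply/eqP; rewrite -subr_eq0 -(RintegralB mD (bounded_mul_integrable bf ihn) (bounded_mul_integrable bf ih)).
have -> : (fun p => f p * `|h p| - f p * h p) = fun p => f p * (`|h p| - h p).
  by apply/funext => p; rewrite mulrBr.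
rewrite -normr_eq0 eq_le normr_ge0 andbT.
apply: (le_trans (Rintegral_mul_bound bf hM ih')).
have -> : (fun p => `| `|h p| - h p|) = fun p => `|h p| - h p.
  by apply/funext => p; rewrite ger0_norm// subr_ge0 ler_norm.
have M0 : 0 <= M by apply: le_trans (hM (0, 0) (conj spectrum0 spectrum0)).
by rewrite (RintegralB mD ihn ih) hI mulr_ge0_le0// subr_le0.
Qed.

Local Notation ic := (0 +i* 1 : R[i]).

Lemma conjc_ic : conjc ic = - ic.
Proof. by apply/eqP; rewrite eq_complex /= oppr0 !eqxx. Qed.

(** The adjoint and the modular conjugation are conjugate linear, so the right
action is linear in b. *)
Lemma right_action_split zeta (b : R -> R[i]) b1 b2 : C_of X b ->
  continuous b1 -> continuous b2 ->
  (forall t, X t -> b t = (b1 t)%:C + ic * (b2 t)%:C) ->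
  right_action zeta (Phi b) = right_copy (PhiR b1) zeta + ic *: right_copy (PhiR b2) zeta.
Proof.
move=> cb c1 c2 hb; rewrite /right_action -(Phi_conj hPhi cb).
have c1' := C_of_real (X := X) c1; have c2' := C_of_real (X := X) c2.
have -> : Phi (fun t => conjc (b t)) = - ic *: PhiR b2 + PhiR b1.
  rewrite /PhiR -(Phi_linear hPhi (- ic) c2' c1').
  apply: (Phi_ext (C_of_conj cb) (C_of_lin c2' c1')).
  move=> t Xt; rewrite hb// conjcD conjcM !conjc_real addrC; congr (_ * _ + _).
  exact: conjc_ic.
rewrite op_linE modular_conjD modular_conjZ addrC conjcN; congr (_ + _ *: _).
by rewrite conjc_ic opprK.
Qed.

Lemma Phi_split (a : R -> R[i]) a1 a2 xi : C_of X a ->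
  continuous a1 -> continuous a2 ->
  (forall t, X t -> a t = (a1 t)%:C + ic * (a2 t)%:C) ->
  Phi a xi = PhiR a1 xi + ic *: PhiR a2 xi.
Proof.
move=> ca c1 c2 ha.
have c1' := C_of_real (X := X) c1; have c2' := C_of_real (X := X) c2.
have -> : Phi a = ic *: PhiR a2 + PhiR a1.
  rewrite /PhiR -(Phi_linear hPhi ic c2' c1').
  apply: (Phi_ext ca (C_of_lin c2' c1')).
  by move=> t Xt; rewrite ha// addrC.
by rewrite op_linE addrC.
Qed.

(** The retraction onto X extends the real and imaginary parts to the line. *)
Lemma C_of_split (a : R -> R[i]) : C_of X a -> exists a1 a2 : R -> R,
  [/\ continuous a1, continuous a2 & forall t, X t -> a t = (a1 t)%:C + ic * (a2 t)%:C].
Proof.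
move=> ca; exists ((fun t => complex.Re (a t)) \o clamp (- radius) radius),
  ((fun t => complex.Im (a t)) \o clamp (- radius) radius); split.
- by apply: continuous_comp_clamp => //; exact: (C_of_Re ca).
- by apply: continuous_comp_clamp => //; exact: (C_of_Im ca).
move=> t Xt; rewrite /comp (clamp_id Xt) mulrC.
by case: (a t) => u v; apply/eqP; rewrite eq_complex /=; apply/andP; split; apply/eqP; ring.
Qed.

Lemma is_eta_density zeta (h : T2 -> R) (H : density_on mm D h) :
  (forall a b, continuous a -> continuous b -> weighted h a b = bimod zeta a b) ->
  is_eta X Phi zeta (density_measure H).
Proof.
move=> hw; split; first exact: (density_measureC H).
move=> a b ca cb.
have [a1 [a2 [ca1 ca2 ha]]] := C_of_split ca; have [b1 [b2 [cb1 cb2 hb]]] := C_of_split cb.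
rewrite (right_action_split zeta cb cb1 cb2 hb) (Phi_split _ ca ca1 ca2 ha).
have l1 := (PhiR_bounded ca1).1; have l2 := (PhiR_bounded ca2).1.
rewrite (linD _ _ l1) (linD _ _ l2) (linZ _ _ l1) (linZ _ _ l2).
rewrite scalerDr !innerDl !innerZl !bimod_inner// -!hw//.
have ih : mm.-integrable D (EFin \o h) by case: H.
have eta_int f1 f2 g1 g2 (k : R) (u : T2 -> R) : continuous f1 -> continuous f2 ->
    continuous g1 -> continuous g2 ->
    (forall p, D p -> u p = k * (f1 p.1 * f2 p.2) + g1 p.1 * g2 p.2) ->
    Rintegral (density_measure H) D u = k * weighted h f1 f2 + weighted h g1 g2.
  move=> cf1 cf2 cg1 cg2 hu.
  pose v (p : T2) := k * (f1 p.1 * f2 p.2) + g1 p.1 * g2 p.2.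
  have -> : Rintegral (density_measure H) D u = Rintegral (density_measure H) D v.
    by apply: eq_Rintegral => p /set_mem Dp; exact: hu.
  have bf := tensor_bounded cf1 cf2; have bg := tensor_bounded cg1 cg2.
  have bv : bounded_measurable D v by apply: bounded_measurableD => //; exact: bounded_measurableZ.
  rewrite (integral_density_measure H bv).
  have i1 := bounded_mul_integrable bf ih; have i2 := bounded_mul_integrable bg ih.
  have i3 := bounded_mul_integrable (bounded_measurable_cst D k) i1.
  rewrite -(RintegralZl k mD i1) -(RintegralD mD i3 i2).
  by congr (Rintegral _ _ _); apply/funext => p; rewrite /v; ring.
rewrite /cintegral (eta_int a2 b2 a1 b1 (-1)) // ?(eta_int a1 b2 a2 b1 1)//.
- by apply/eqP; rewrite eq_complex /=; apply/andP; split; apply/eqP; ring.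
- by move=> p [p1 p2]; rewrite ha// hb//= ; ring.
- by move=> p [p1 p2]; rewrite ha// hb//= ; ring.
Qed.

(** * The density of the distinguished vector *)

(** Equal to (4 N^2 - t^2) / (2 N (2 N - 1)). *)
Definition weight t : R := nspol 0 t - nspol 2 t.

Lemma weight_continuous : continuous weight.
Proof. by move=> t; apply: (@cvgB R R); exact: nspol_continuous. Qed.

Lemma weight_integral n : Rintegral lambda X (fun t => spol n t * weight t) = density_coef R n.
Proof.
have i m := iX (continuous_prod (@spol_continuous n) (@nspol_continuous m)).
have -> : (fun t => spol n t * weight t) = fun t => spol n t * nspol 0 t - spol n t * nspol 2 t.
  by apply/funext => t; rewrite mulrBr.
rewrite (RintegralB mX (i 0%N) (i 2)) !nspol_spol_integral.
by case: n {i} => [|[|[|n]]] //=; rewrite ?subr0 ?sub0r.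
Qed.

(** On X one has t^2 <= 4 (2 N - 1) < 4 N^2, as N > 1. *)
Lemma weight_gt0 t : X t -> 0 < weight t.
Proof.
move=> Xt; rewrite /weight /nspol.
have -> : sphere_card 0 = 1 by [].
pose c : R := (2 * N)%:R.
have c4 : 4 <= c by rewrite /c ler_nat; lia.
have -> : sphere_card 2 = (c - 1) * c.
  rewrite !sphere_cardS; have -> : sphere_card 0 = 1 by [].
  rewrite mulr1 -[gen_count N 0]/(2 * N)%N -[gen_count N 1]/(2 * N).-1 -/c; congr (_ * _).
  by rewrite -subn1 natrB//; lia.
rewrite -[spol 0 t]/(1 : R) -[spol 2 t]/(t * t - c * 1) invr1 !mulr1.
have t2 : t * t <= 4 * (c - 1).
  have r2 : radius ^+ 2 = 4 * (c - 1).
    by rewrite /radius exprMn sqr_sqrtr -?/c; [rewrite -natrX|lra].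
  rewrite -r2 -expr2 -(real_normK (num_real t)) lerXn2r ?nnegrE ?(ltW radius_gt0)//.
  exact: spectrumP.
have cc : 0 < (c - 1) * c by rewrite mulr_gt0//; lra.
rewrite subr_gt0 mulrC ltr_pdivrMr// mul1r.
by have : 0 < (c - 2) * (c - 2) by [rewrite mulr_gt0//; lra]; move: t2; lra.
Qed.

Section DistinguishedVector.
Variables (N0 : (0 < N)%N) (i0 i1 : 'I_N).
Hypothesis i01 : i0 != i1.
Local Notation zeta0 := (zeta0 R N0 i0 i1).

(** The absolute value makes it nonnegative off the square too. *)
Definition density0 (p : T2) : R := `|l2norm zeta0 ^+ 2 * (weight p.1 * weight p.2)|.

Let density0E p : D p -> density0 p = l2norm zeta0 ^+ 2 * (weight p.1 * weight p.2).
Proof.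
move=> [p1 p2]; rewrite /density0 ger0_norm// mulr_ge0 ?sqr_ge0//.
by rewrite mulr_ge0// ltW// weight_gt0.
Qed.

Let density0_bounded : bounded_measurable D density0.
Proof.
apply: bounded_measurable_norm; apply: bounded_measurableZ.
by apply: tensor_bounded; exact: weight_continuous.
Qed.

Lemma density0_on : density_on mm D density0.
Proof. by split; [exact: mD|case: density0_bounded|exact: iD|move=> p; exact: normr_ge0]. Qed.

Lemma density0_gt0 p : D p -> 0 < density0 p.
Proof.
move=> Dp; rewrite density0E//; case: Dp => p1 p2.
apply: mulr_gt0; last by rewrite mulr_gt0 ?weight_gt0.
rewrite lt0r sqr_ge0 andbT sqrf_eq0; apply/eqP => /l2norm0_eq0; exact: zeta0_neq0.
Qed.

Lemma zeta0_bimod_spol n m : bimod zeta0 (spol n) (spol m) =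
  l2norm zeta0 ^+ 2 * (density_coef R n * density_coef R m).
Proof.
pose xi := right_copy (PhiR (spol m)) zeta0.
have h1 h : xi h = conjc (sphere m (modular_conj zeta0) h^-1%g).
  by rewrite /xi /right_copy modular_conjE PhiR_spol.
have := @zeta0_coefficients R N N0 i0 i1 i01 n m xi h1 (PhiR (spol n) xi) (PhiR_spol n xi).
rewrite /bimod -/xi /rinner => ->; rewrite inner_l2norm -real_complexM /=.
by rewrite mulrC.
Qed.

Lemma density0_weighted a b : continuous a -> continuous b ->
  weighted density0 a b = bimod zeta0 a b.
Proof.
move=> ca cb.
have bF (K : nat) : bounded_bilinear (l2norm zeta0 ^+ 2 + II (fun p => `|density0 p|))
    (fun a b => bimod zeta0 a b - weighted density0 a b).
  by apply: bounded_bilinearB; [exact: bimod_bilinear|apply: weighted_bilinear => //; exact: iD].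
have Fs n m : exists K0, forall K, (K0 <= K)%N ->
    bimod zeta0 (spol n) (spol m) - weighted density0 (spol n) (spol m) = 0.
  exists 0%N => _ _; apply/eqP; rewrite subr_eq0 zeta0_bimod_spol; apply/eqP.
  have cs k := continuous_prod (@spol_continuous k) weight_continuous.
  rewrite -!weight_integral -(Rintegral_tensor lambda r0 (cs n) (cs m)).
  rewrite -(RintegralZl _ mD (iD (tensor_bounded (cs n) (cs m)))).
  by apply: eq_Rintegral => p /set_mem Dp; rewrite density0E//; ring.
apply/esym/eqP; rewrite -subr_eq0 -normr_eq0 eq_le normr_ge0 andbT.
apply/ler_addgt0Pr => e e0; rewrite add0r.
by have [K0 hK] := bilinear_limit bF Fs ca cb e0; exact: (hK K0).
Qed.

End DistinguishedVector.

Lemma square_conull : mm (~` D) = 0%E.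
Proof.
have mXC : measurable (~` X : set (measurableTypeR R)) by exact: measurableC.
have m1 : measurable ((~` X) `*` setT : set T2) by exact: measurableX.
have m2 : measurable (setT `*` (~` X) : set T2) by exact: measurableX.
have l0 : lambda (~` X) = 0%E := hlambda.1.
apply/eqP; rewrite eq_le measure_ge0 andbT.
apply: (@le_trans _ _ (mm ((~` X) `*` setT `|` setT `*` (~` X)))).
  apply: le_measure; rewrite ?inE; [exact: measurableC|exact: measurableU|].
  move=> [t s] /= /not_andP[h|h]; [by left; split|by right; split].
have e1 : mm ((~` X) `*` setT) = (lambda (~` X) * lambda setT)%E by exact: product_measure1E.
have e2 : mm (setT `*` (~` X)) = (lambda setT * lambda (~` X))%E by exact: product_measure1E.
apply: (le_trans (measureU2 mm m1 m2)).
by rewrite [X in (X + _)%E]e1 [X in (_ + X)%E]e2 l0 mul0e mule0 adde0.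
Qed.

Lemma left_right_measure_product :
  left_right_measure (@laplacian_masa R N) X Phi mm.
Proof.
have N0 : (0 < N)%N by lia.
pose i0 : 'I_N := Ordinal N0; pose i1 : 'I_N := Ordinal hN.
have i01 : i0 != i1 by [].
have H0 := density0_on N0 i0 i1.
have dom0 : mm `<< density_measure H0.
  by apply: dominated_density_measure; [exact: square_conull|exact: density0_gt0].
exists (zeta0 R N0 i0 i1), (density_measure H0); split.
- exact: zeta0_orthogonal.
- exact: zeta0_neq0.
- by apply: is_eta_density => a b; exact: density0_weighted.
- move=> zeta Hz; have [h [mh ih hw hn]] := density_exists Hz.
  have H : density_on mm D (fun p => `|h p|).
    split=> //; [exact: measurableT_comp|exact: integrable_norm].
  exists (density_measure H).
    apply: is_eta_density => a b ca cb; rewrite -hw//.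
    exact: (abs_density_integral ih hw hn (tensor_bounded ca cb)).
  exact: null_dominates_trans (density_measure_dominated H) dom0.
by split=> //; exact: density_measure_dominated.
Qed.

End PhiCalculus.

Theorem theorem3p4 (R : realType) (N : nat) (hN : (2 <= N)%N)
    (Phi : (R -> R[i]) -> operator R (free_group N))
    (hPhi : C_of_isomorphism (@chi1_spectrum R N)
              (cstar_generated [set idfun; @chi1 R N]%classic) Phi)
    (hPhi_chi1 : Phi (fun t : R => t%:C) = @chi1 R N)
    (lambda : probability (measurableTypeR R) R)
    (hlambda : trace_measure (@chi1_spectrum R N) Phi lambda) :
  left_right_measure (@laplacian_masa R N) (@chi1_spectrum R N) Phi
    (lambda \x lambda)%E.
Proof. exact: (left_right_measure_product hN hPhi hPhi_chi1 hlambda). Qed.
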